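(* Let $T>0$, let $\sigma\ge 0$, let $a:[0,T]\to[0,+\infty)$ be bounded and continuous, and let $h:[0,T)\to[0,+\infty)$ be positive. Assume that $h$ is continuously differentiable on $[0,T)$ and that there are constants $\bar h>0$ and $\omega\ge 0$ such that $$\frac{\bar h}{T-t}\le h(t)\le \frac{\bar h}{T-t}+\omega,\qquad 0<t<T .$$ Let $X=(X_t)_{0\le t\le T}$ be the CIR bridge, i.e. the unique pathwise solution, continuous on $[0,T]$, of $$\mathrm{d}X_t=\bigl(a(t)-h(t)X_t\bigr)\,\mathrm{d}t+\sigma\sqrt{h(t)X_t}\,\mathrm{d}B_t,\qquad 0<t<T,\qquad X_0=0,$$ where $(B_t)_{t\ge 0}$ is a one-dimensional standard Brownian motion. Then for any $t\in[0,T]$ the average $\mathbb{E}[X_t]$ and the variance $\mathbb{V}[X_t]$ are given by $$\mathbb{E}[X_t]=\int_0^t a(s)\exp\left(-\int_s^t h(u)\,\mathrm{d}u\right)\mathrm{d}s$$ and $$\mathbb{V}[X_t]=\sigma^2\int_0^t h(s)\,\mathbb{E}[X_s]\exp\left(-2\int_s^t h(u)\,\mathrm{d}u\right)\mathrm{d}s,$$ respectively.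
   Context: All processes are defined on a complete probability space $(\Omega,\mathbb{F},\mathbb{P})$ (with the usual filtration for which $B$ is a Brownian motion), and the equation is understood in the Itô sense. A solution takes values in $[0,+\infty)$, so that the square root is well defined. It satisfies the equation on $[0,T-\delta]$ for every $\delta\in(0,T)$, and its value at $T$ is the limit $\lim_{t\to T-0}X_t$; under the stated assumptions on $a,h,\sigma$ there is a unique such pathwise solution, and $X_T=0$ almost surely. $\mathbb{V}[X_t]=\mathbb{E}[(X_t-\mathbb{E}[X_t])^2]$. At $t=T$ one has $\int_s^T h(u)\,\mathrm{d}u=+\infty$ for $s<T$, and the formulas are read with $\exp(-\infty)=0$. *)

(* Defs.v *)
From mathcomp Require Export all_boot all_order all_algebra.
From mathcomp Require Export all_classical all_reals all_analysis.
From mathcomp Require Export measurable_realfun.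

Set Implicit Arguments.
Unset Strict Implicit.
Unset Printing Implicit Defensive.

Import Order.TTheory GRing.Theory Num.Theory.
Import numFieldNormedType.Exports.

Local Open Scope classical_set_scope.
Local Open Scope ring_scope.

Section calculus.
Context {R : realType}.

(* C^1 on [0, T[: the difference quotients are taken inside [0, T[, hence the
   derivative at 0 is the right derivative; values of h outside [0, T[ are
   irrelevant. *)
Definition C1_on_co (T : R) (h : R -> R) : Prop :=
  exists dh : R -> R, {within `[0, T[, continuous dh} /\
    forall t, 0 <= t < T ->
      (fun u => (h u - h t) / (u - t)) @ within `[0, T[ (t^') --> dh t.

End calculus.

Section stochastic_integral.
Context {d : measure_display} {Omega : measurableType d} {R : realType}.
Variable P : probability Omega R.
(* Only the times 0 <= t matter, for filtrations as well as for processes. *)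
Implicit Types (F : R -> set (set Omega)) (B H X : R -> Omega -> R).

Definition measurable_wrt (G : set (set Omega)) (Y : Omega -> R) : Prop :=
  forall A : set R, measurable A -> G (Y @^-1` A).

Definition filtration F : Prop :=
  [/\ forall t, 0 <= t -> sigma_algebra setT (F t),
      forall t, 0 <= t -> F t `<=` measurable &
      forall s t, 0 <= s -> s <= t -> F s `<=` F t].

Definition usual_filtration F : Prop :=
  [/\ filtration F,
      forall N : set Omega, P.-negligible N -> F 0 N &
      forall t, 0 <= t -> \bigcap_(s in [set s | t < s]) F s `<=` F t].

(* The second argument of normal_prob is the standard deviation. *)
Definition brownian_motion F B : Prop :=
  [/\ forall t, 0 <= t -> measurable_wrt (F t) (B t),
      {ae P, forall w, B 0 w = 0},
      {ae P, forall w, {within `[0, +oo[, continuous (B ^~ w)}},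
      forall s t, 0 <= s -> s < t -> forall A : set R, measurable A ->
        P [set w | A (B t w - B s w)] = normal_prob 0 (Num.sqrt (t - s)) A &
      forall s t, 0 <= s -> s < t -> forall (E : set Omega) (A : set R),
        F s E -> measurable A ->
        P (E `&` [set w | A (B t w - B s w)]) =
          (P E * P [set w | A (B t w - B s w)%R])%E].

(* The simple process \sum_(i < n) xi_i 1_]t_i, t_(i+1)] with xi_i bounded and
   F_(t_i)-measurable. *)
Record simple_process F := SimpleProcess {
  sp_size : nat;
  sp_time : nat -> R;
  sp_coef : nat -> Omega -> R;
  sp_time_ge0 : 0 <= sp_time 0%N;
  sp_time_le : forall i, sp_time i <= sp_time i.+1;
  sp_coef_meas : forall i, measurable_wrt (F (sp_time i)) (sp_coef i);
  sp_coef_bounded : forall i, exists C : R, forall w, `|sp_coef i w| <= C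
}.

Definition sp_val F (phi : simple_process F) (s : R) (w : Omega) : R :=
  \sum_(i < sp_size phi) sp_coef phi i w *
    \1_(`]sp_time phi i, sp_time phi i.+1]%classic : set R) s.

Definition sp_integral F B (phi : simple_process F) (t : R) (w : Omega) : R :=
  \sum_(i < sp_size phi) sp_coef phi i w *
    (B (Num.min (sp_time phi i.+1) t) w - B (Num.min (sp_time phi i) t) w).

Definition cvg_to0_in_probability (Z : nat -> Omega -> \bar R) : Prop :=
  (forall n, measurable_fun setT (Z n)) /\
  forall e : R, 0 < e ->
    P [set w | (e%:E <= `|Z n w|)%E] @[n --> \oo] --> 0%E.

(* "Y is (a version of) the Ito integral \int_0^t H_s dB_s", for an adapted
   integrand H with measurable, square-integrable paths on [0, t]: Y is the
   limit in probability of the integrals of simple processes phi_n such that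
   \int_0^t (phi_n - H)^2 ds tends to 0 in probability. It determines Y up to
   almost sure equality. *)
Definition ito_integral F B H (t : R) (Y : Omega -> R) : Prop :=
  measurable_fun setT Y /\
  exists phi : nat -> simple_process F,
    cvg_to0_in_probability (fun n w =>
      (\int[lebesgue_measure]_(s in `[0%R, t])
         ((sp_val (phi n) s w - H s w) ^+ 2)%:E)%E) /\
    cvg_to0_in_probability (fun n w => (sp_integral B (phi n) t w - Y w)%:E).

(* X solves dX = (a - h X) dt + sigma sqrt(h X) dB on [0, T[, X_0 = 0, with
   values in [0, +oo[ and continuous paths on the closed interval [0, T]; the
   continuity at T makes X_T the left limit of X. *)
Definition cir_bridge (T : R) (a h : R -> R) (sigma : R) F B X : Prop :=
  [/\ forall t, 0 <= t <= T -> measurable_wrt (F t) (X t),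
      forall t w, 0 <= t <= T -> 0 <= X t w,
      {ae P, forall w, {within `[0, T], continuous (X ^~ w)}},
      {ae P, forall w, X 0 w = 0} &
      forall t, 0 <= t < T -> exists M : Omega -> R,
        ito_integral F B (fun s w => sigma * Num.sqrt (h s * X s w)) t M /\
        {ae P, forall w, X t w =
          (\int[lebesgue_measure]_(s in `[0, t]) (a s - h s * X s w)) + M w}].

End stochastic_integral.

(* Main.v *)
(* The integral I of an elementary process satisfies E exp(I - <I>/2) = 1.  By
   Fatou's lemma every Ito integral M of an integrand H then satisfies
   E exp(l (M - I(phi)) - l^2 \int (H - phi)^2) <= 1 for every real l and every
   elementary phi, without any localization.  Two choices matter.
   - For phi = 0 and H^2 = sigma^2 h X, a small l > 0 lets the drift -h X absorb
     l \int H^2, whence exponential moments of X_t that are uniform in t.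
   - Averaging over l and -l gives E (M - I(phi))^2 <= 2 E \int (H - phi)^2; with
     phi the samples of H on finer and finer grids, E M_t = 0 and
     E M_s M_t = sigma^2 \int_0^s h E X for s <= t.
   With e = exp (\int_0 h), integration by parts along each path reads
   e X = \int e a + e M - \int e' M, and both moments follow by Fubini.  Finally
   E X_t tends to 0 as t tends to T because \int_s^T h = +oo, so that X_T = 0 almost
   surely by Fatou's lemma, while both right-hand sides vanish at T. *)

Require Import Defs.
From mathcomp Require Import ring lra.
Set Implicit Arguments.
Unset Strict Implicit.
Unset Printing Implicit Defensive.
Import Order.TTheory GRing.Theory Num.Theory.
Import numFieldNormedType.Exports.
Local Open Scope classical_set_scope.
Local Open Scope ring_scope.

(** * Integrable and square-integrable random variables *)

(** [ito_integral] provides convergence in probability only, and no moment of X is known beforehand,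
    so the isometry cannot be taken for granted for X; the exponential identity requires no moments,
    which is why it comes first. Passing to the limit in it costs a factor: (phi_n - psi)^2 <= 2
    (phi_n - H)^2 + 2 (psi - H)^2 turns the compensator l^2/2 into l^2. This only spoils the
    constant in the bound on E (M - I(psi))^2, and that bound merely has to show that grid integrals
    converge to M in mean square; the exact covariance then comes from their own isometry. Since e
    is continuously differentiable, integration by parts involves Lebesgue integrals in time only,
    and for W = \int e' M the mean of W^2 reduces to covariances through W^2 = 2 \int W W'. The
    coefficients are frozen outside [0, t0] with t0 < T, and X is replaced by a version all of whose
    paths are continuous, so that the analysis deals with functions continuous on the whole line;
    null sets belong to F_0, which keeps this version adapted. *)

Section expectation_toolkit.
Context {d : measure_display} {T : measurableType d} {R : realType}.
Variable Q : probability T R.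
Implicit Types (f g : T -> R) (k : R).

Definition L1 f := Q.-integrable setT (EFin \o f).

Definition EE f : R := \int[Q]_x f x.

Lemma L1_meas f : L1 f -> measurable_fun setT f.
Proof. by move=> /integrableP[/measurable_EFinP]. Qed.

Lemma L1_cst k : L1 (fun=> k).
Proof. exact: finite_measure_integrable_cst. Qed.

Lemma L1D f g : L1 f -> L1 g -> L1 (fun x => f x + g x).
Proof.
by move=> jf jg; rewrite /L1; under [_ \o _]eq_fun do rewrite /= EFinD; exact: integrableD.
Qed.

Lemma L1Z k f : L1 f -> L1 (fun x => k * f x).
Proof.
by move=> jf; rewrite /L1; under [_ \o _]eq_fun do rewrite /= EFinM; exact: integrableZl.
Qed.

Lemma L1B f g : L1 f -> L1 g -> L1 (fun x => f x - g x).
Proof.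
by move=> jf jg; rewrite /L1; under [_ \o _]eq_fun do rewrite /= EFinB; exact: integrableB.
Qed.

Lemma L1_le f g : measurable_fun setT f -> (forall x, `|f x| <= g x) -> L1 g -> L1 f.
Proof.
move=> mf fg; apply: le_integrable => //; first exact: measurableT_comp.
by move=> x _ /=; rewrite lee_fin (le_trans (fg x))// ler_norm.
Qed.

Lemma L1_abs f : L1 f -> L1 (fun x => `|f x|).
Proof. by move=> jf; rewrite /L1; exact: (integrable_norm jf). Qed.

Lemma EE_EFin f : L1 f -> (\int[Q]_x (f x)%:E)%E = (EE f)%:E.
Proof.
by move=> jf; rewrite /EE /Rintegral fineK//; exact: integrable_fin_num.
Qed.

Lemma EE_eq f g : f =1 g -> EE f = EE g.
Proof. by move=> fg; apply: eq_Rintegral. Qed.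

Lemma EE_cst k : EE (fun=> k) = k.
Proof.
by rewrite /EE Rintegral_cst//= (_ : Q setT = 1%E) ?mulr1//; exact: probability_setT.
Qed.

Lemma EED f g : L1 f -> L1 g -> EE (fun x => f x + g x) = EE f + EE g.
Proof. by move=> jf jg; rewrite /EE RintegralD. Qed.

Lemma EEB f g : L1 f -> L1 g -> EE (fun x => f x - g x) = EE f - EE g.
Proof. by move=> jf jg; rewrite /EE RintegralB. Qed.

Lemma EEZ k f : L1 f -> EE (fun x => k * f x) = k * EE f.
Proof. by move=> jf; rewrite /EE RintegralZl. Qed.

Lemma EE_le f g : L1 f -> L1 g -> (forall x, f x <= g x) -> EE f <= EE g.
Proof. by move=> jf jg fg; apply: le_Rintegral. Qed.

Lemma EE_ge0 f : (forall x, 0 <= f x) -> 0 <= EE f.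
Proof. by move=> f0; apply: Rintegral_ge0. Qed.

Lemma L1_ge0 f (C : R) : measurable_fun setT f -> (forall x, 0 <= f x) ->
  (\int[Q]_x (f x)%:E <= C%:E)%E -> L1 f.
Proof.
move=> mf f0 fC; apply/integrableP; split; first exact: measurableT_comp.
under eq_integral do rewrite /= ger0_norm//.
exact: (le_lt_trans fC (ltry _)).
Qed.

Definition L2 f := measurable_fun setT f /\ L1 (fun x => f x ^+ 2).

Lemma L2M f g : L2 f -> L2 g -> L1 (fun x => f x * g x).
Proof.
move=> [mf jf] [mg jg]; apply: (@L1_le _ (fun x => f x ^+ 2 + g x ^+ 2)).
- exact: measurable_funM.
- move=> x; rewrite normrM -[f x ^+ 2]real_normK ?num_real// -[g x ^+ 2]real_normK ?num_real//.
  by have := sqr_ge0 (`|f x| - `|g x|); have := sqr_ge0 (`|f x| + `|g x|); nra.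
- exact: L1D.
Qed.

Lemma L2_cst k : L2 (fun=> k).
Proof. by split; [exact: measurable_cst|exact: L1_cst]. Qed.

Lemma L2_L1 f : L2 f -> L1 f.
Proof.
move=> [mf jf]; apply: (@L1_le _ (fun x => f x ^+ 2 + 1)) => //.
- move=> x; rewrite -[f x ^+ 2]real_normK ?num_real//.
  by have := sqr_ge0 (`|f x| - 1); have := sqr_ge0 (`|f x|); nra.
- by apply: L1D => //; exact: L1_cst.
Qed.

Lemma L2D f g : L2 f -> L2 g -> L2 (fun x => f x + g x).
Proof.
move=> jf jg; have [mf jf2] := jf; have [mg jg2] := jg.
split; first exact: measurable_funD.
under [X in L1 X]eq_fun do rewrite sqrrD.
apply: L1D => //; apply: L1D => //.
under eq_fun do rewrite -mulr_natl.
by apply: L1Z; exact: L2M.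
Qed.

Lemma L2Z k f : L2 f -> L2 (fun x => k * f x).
Proof.
move=> [mf jf]; split; first exact: measurable_funM.
by under [X in L1 X]eq_fun do rewrite exprMn; exact: L1Z.
Qed.

Lemma L2B f g : L2 f -> L2 g -> L2 (fun x => f x - g x).
Proof.
move=> jf jg; under eq_fun do rewrite -mulN1r.
by apply: L2D => //; exact: L2Z.
Qed.

Lemma L2_sum (I : Type) (r : seq I) (p : pred I) (f : I -> T -> R) :
  (forall i, p i -> L2 (f i)) -> L2 (fun x => \sum_(i <- r | p i) f i x).
Proof.
move=> jf; elim: r => [|i r IH].
  by under eq_fun do rewrite big_nil; exact: L2_cst.
under eq_fun do rewrite big_cons.
by case pi : (p i) => //; apply: L2D => //; exact: jf.
Qed.

Lemma L1_sum (I : Type) (r : seq I) (p : pred I) (f : I -> T -> R) :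
  (forall i, p i -> L1 (f i)) -> L1 (fun x => \sum_(i <- r | p i) f i x).
Proof.
move=> jf; elim: r => [|i r IH].
  by under eq_fun do rewrite big_nil; exact: L1_cst.
under eq_fun do rewrite big_cons.
by case pi : (p i) => //; apply: L1D => //; exact: jf.
Qed.

Lemma EE_sum (I : Type) (r : seq I) (p : pred I) (f : I -> T -> R) :
  (forall i, p i -> L1 (f i)) ->
  EE (fun x => \sum_(i <- r | p i) f i x) = \sum_(i <- r | p i) EE (f i).
Proof.
move=> jf; elim: r => [|i r IH].
  by under EE_eq do rewrite big_nil; rewrite EE_cst big_nil.
under EE_eq do rewrite big_cons.
rewrite big_cons; case pi : (p i) => //.
by rewrite EED// ?IH//; [exact: jf|exact: L1_sum].
Qed.

End expectation_toolkit.

(** * Lower and upper bounds on the hyperbolic cosine *)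

Section hyperbolic.
Context {R : realType}.
Implicit Types x y z : R.

(** The difference of the two sides vanishes at 0 and has derivative e^y + e^-y - 2 = (e^y - 1)^2 /
    e^y >= 0. *)
Lemma expR_sinh_lower z : 0 <= z -> z *+ 2 <= expR z - expR (- z).
Proof.
move=> z0.
pose g := fun y : R => expR y - expR (- y) - y *+ 2.
have dg y : is_derive y 1 g (expR y + expR (- y) - 2).
  rewrite /g; apply: is_derive_eq; rewrite /GRing.scale /=; ring.
have : g 0 <= g z.
  apply: (@ger0_derive1_ndecry R g 0) => //.
  - by move=> y _; rewrite derive1E derive_val expRN; have := expR_gt0 y; set e := expR y => e0;
     rewrite (_ : _ - 2 = (e - 1) ^+ 2 / e) ?divr_ge0 ?sqr_ge0 ?(ltW e0)//; field; rewrite gt_eqF.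
  - by apply: continuous_subspaceT => y; apply: differentiable_continuous; apply/derivable1_diffP.
by rewrite /g oppr0 subrr mul0rn subrr subr_ge0.
Qed.

(** Since e^y + e^-y - 2 is the square of e^(y/2) - e^(-y/2), this follows from the bound on the
    hyperbolic sine at y/2. *)
Lemma cosh_lower y : 2 + y ^+ 2 <= expR y + expR (- y).
Proof.
wlog y0 : y / 0 <= y.
  by move=> H; case: (lerP 0 y) => [|y0]; [exact: H|have := H (- y); rewrite opprK sqrrN [expR (- y) + _]addrC => -> //; rewrite oppr_ge0 ltW].
have := expR_sinh_lower (divr_ge0 y0 (ler0n R 2)).
rewrite [X in _ -> _ <= expR X + expR (- X)](splitr y) opprD !expRD expRN.
have := expR_gt0 (y / 2); set e := expR (y / 2) => e0.
rewrite (_ : y / 2 *+ 2 = y); last by field.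
move=> H; have : y ^+ 2 <= (e - e^-1) ^+ 2 by rewrite ler_sqr ?nnegrE// (le_trans y0).
suff -> : (e - e^-1) ^+ 2 = e * e + e^-1 * e^-1 - 2 by lra.
by field; rewrite gt_eqF.
Qed.

(** A second-order expansion in l with a remainder of order l^3, whose coefficient is independent of
    l and has a finite Gaussian mean; dividing by l^2 and letting l tend to 0 isolates the second
    moment. The 6 is 3!, from y^3 <= 3! e^y. *)
Lemma cosh_upper l y : 0 < l <= 1 ->
  expR (l * y) + expR (- (l * y)) - 2 <=
  l ^+ 2 * (y ^+ 2 + l * (6 * (expR (2 * y) + expR (- (2 * y))))).
Proof.
move=> /andP[l0 l1].
wlog y0 : y / 0 <= y.
  move=> H; case: (lerP 0 y) => [|y0]; first exact: H.
  have := H (- y); rewrite !mulrN !opprK sqrrN.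
  rewrite [expR (- (l * y)) + _]addrC [expR (- (2 * y)) + _]addrC => -> //.
  by rewrite oppr_ge0 ltW.
have ly0 : 0 <= l * y by rewrite mulr_ge0// ltW.
have := expR_sinh_lower (divr_ge0 ly0 (ler0n R 2)).
have -> : expR (l * y) + expR (- (l * y)) - 2 =
    (expR (l * y / 2) - expR (- (l * y / 2))) ^+ 2.
  rewrite [in LHS](splitr (l * y)) opprD !expRD !expRN.
  have := expR_gt0 (l * y / 2); set e := expR _ => e0.
  by field; rewrite gt_eqF.
(* This is e^-x >= 1 - x at x = l y, multiplied by e^(x/2). *)
have : expR (l * y / 2) - expR (- (l * y / 2)) <= l * y * expR (l * y / 2).
  have := expR_ge1Dx (- (l * y)); rewrite [in X in _ <= X -> _](splitr (l * y)) opprD expRD expRN.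
  have := expR_gt0 (l * y / 2); set e := expR _ => e0 H.
  have : (1 - l * y) * e <= e^-1 / e * e by rewrite ler_pM2r.
  by rewrite mulfVK ?gt_eqF//; lra.
set u := _ - _ => u1 u2.
have u0 : 0 <= u by rewrite (le_trans _ u2)// mulrn_wge0 ?divr_ge0.
have {u1 u2} : u ^+ 2 <= (l * y) ^+ 2 * expR (l * y).
  rewrite [X in _ * expR X](splitr (l * y)) expRD -expr2 -exprMn.
  by rewrite ler_sqr ?nnegrE ?(le_trans u0).
move/le_trans; apply.
rewrite exprMn -mulrA ler_pM2l ?exprn_gt0//.
have ely : expR (l * y) <= expR y.
  by rewrite ler_expR ler_piMl.
have e1 : expR (l * y) <= 1 + l * y * expR (l * y).
  have := expR_ge1Dx (- (l * y)); rewrite expRN.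
  have := expR_gt0 (l * y); set e := expR _ => e0 H.
  have : (1 - l * y) * e <= e^-1 * e by rewrite ler_pM2r.
  by rewrite mulVf ?gt_eqF//; lra.
have e2 : y ^+ 3 <= 6 * expR y.
  have := expR_ge1Dxn 2 y0; rewrite (_ : (3`!)%:R = 6 :> R)//.
  rewrite -(ler_pM2r (_ : 0 < 6))//  mulrDl mulfVK//; lra.
have e3 : y ^+ 3 * expR y <= 6 * expR (2 * y).
  rewrite (_ : 2 * y = y + y) ?expRD ?mulrA ?ler_wpM2r ?expR_ge0//; ring.
have e4 := expR_ge0 (- (2 * y)).
have e5 : y ^+ 2 * expR (l * y) <= y ^+ 2 + l * (y ^+ 3 * expR y).
  apply: (le_trans (ler_wpM2l (sqr_ge0 y) e1)).
  rewrite (_ : _ * (1 + _) = y ^+ 2 + l * (y ^+ 3 * expR (l * y))); last by ring.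
  by rewrite lerD2l ler_wpM2l ?(ltW l0)// ler_wpM2l ?exprn_ge0.
apply: (le_trans e5); rewrite lerD2l ler_pM2l//.
by apply: (le_trans e3); rewrite ler_pM2l// lerDl.
Qed.

End hyperbolic.

(** * Moments of the centred normal law, obtained from its Laplace transform *)

Section normal.
Context {R : realType}.
Local Notation mu := (@lebesgue_measure R).

(** [normal_pdf] agrees almost everywhere with the Radon-Nikodym derivative, because both have the
    same integral over every measurable set; the change of variables is available for the latter. *)
Lemma ge0_integral_normal_prob (m s : R) (f : R -> \bar R) :
  s != 0 -> measurable_fun setT f -> (forall x, 0 <= f x)%E ->
  (\int[normal_prob m s]_x f x = \int[mu]_x (f x * (normal_pdf m s x)%:E))%E.
Proof.
move=> s0 mf f0.
have dom := normal_prob_dominates m s.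
rewrite -(Radon_Nikodym_SigmaFinite.change_of_variables dom)//.
apply: ae_eq_integral => //.
- apply: emeasurable_funM => //.
  exact: (measurable_int _ (Radon_Nikodym_SigmaFinite.f_integrable dom)).
- apply: emeasurable_funM => //.
  exact: measurableT_comp (measurable_normal_pdf m s).
- have := @integral_ae_eq _ _ R mu setT measurableT (EFin \o normal_pdf m s)
    (Radon_Nikodym_SigmaFinite.f (normal_prob m s) mu)
    (Radon_Nikodym_SigmaFinite.f_integrable dom)
    (measurable_int _ (integrable_normal_pdf m s)).
  have H : forall E : set R, E `<=` setT -> measurable E ->
    (\int[mu]_(x in E) Radon_Nikodym_SigmaFinite.f (normal_prob m s) mu x =
    \int[mu]_(x in E) (EFin \o normal_pdf m s) x)%E.
    by move=> E _ mE; rewrite -Radon_Nikodym_SigmaFinite.f_integral.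
  by move=> /(_ H); apply: filterS => x /= /(_ I) -> _.
Qed.

(** Completing the square: tilting the centred density by e^(l x) gives e^(l^2 s^2 / 2) times the
    density of mean l s^2, whose integral is 1. *)
Lemma normal_prob_mgf (s l : R) : s != 0 ->
  (\int[normal_prob 0 s]_x (expR (l * x))%:E = (expR (l ^+ 2 * s ^+ 2 / 2))%:E)%E.
Proof.
move=> s0; rewrite ge0_integral_normal_prob//; last first.
  apply: measurableT_comp => //; exact: measurableT_comp.
transitivity (\int[mu]_x ((expR (l ^+ 2 * s ^+ 2 / 2))%:E *
    (normal_pdf (l * s ^+ 2) s x)%:E))%E.
  apply: eq_integral => x _; rewrite -!EFinM; congr EFin.
  rewrite !normal_pdfE// /normal_fun mulrCA [RHS]mulrCA -!expRD; congr (_ * expR _).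
  by field.
rewrite ge0_integralZl//.
- by rewrite integral_normal_pdf mule1.
- exact: measurableT_comp (measurable_normal_pdf _ _).
- by move=> x _; rewrite lee_fin normal_pdf_ge0.
Qed.

Section normal_moments.
Variable s : R.
Hypothesis s0 : s != 0.
Local Notation N := (normal_prob 0 s).

Lemma normal_prob_exp_integrable (l : R) : L1 N (fun x => expR (l * x)).
Proof.
apply: (@L1_ge0 _ _ _ _ _ (expR (l ^+ 2 * s ^+ 2 / 2))).
- by apply: measurableT_comp => //; exact: measurable_funM.
- by move=> x; exact: expR_ge0.
- by rewrite normal_prob_mgf.
Qed.

Lemma EE_normal_exp (l : R) : EE N (fun x => expR (l * x)) = expR (l ^+ 2 * s ^+ 2 / 2).
Proof. by rewrite /EE /Rintegral normal_prob_mgf. Qed.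

Lemma normal_prob_id_L2 : L2 N id.
Proof.
split => //; apply: (@L1_le _ _ _ N _ (fun x : R => expR (1 * x) + expR (- 1 * x))).
- exact: measurable_funX.
- move=> x /=; rewrite mul1r mulN1r ger0_norm ?sqr_ge0//.
  by have := cosh_lower x; lra.
- by apply: L1D; exact: normal_prob_exp_integrable.
Qed.

(** Letting l tend to 0. This replaces derivatives at l = 0 in the moment computations, and limits
    of error terms later on. *)
Lemma le_small (a b c : R) : (forall l : R, 0 < l <= 1 -> a <= b + l * c) -> a <= b.
Proof.
move=> H; have c0 : 0 < 1 + `|c| by rewrite ltr_pwDl.
apply/ler_addgt0Pr => e e0.
pose l := Num.min 1 (e / (1 + `|c|)).
have l0 : 0 < l by rewrite lt_min ltr01 divr_gt0.
have /H/le_trans : 0 < l <= 1 by rewrite l0 ge_min lexx.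
apply; rewrite lerD2l; apply: (le_trans (ler_wpM2l (ltW l0) (ler_norm c))).
apply: (@le_trans _ _ (l * (1 + `|c|))); first by rewrite ler_pM2l// lerDr.
by rewrite -ler_pdivlMr// ge_min lexx orbT.
Qed.

Lemma expR_upper (u v : R) : 0 <= u <= v -> expR u - 1 <= u * expR v.
Proof.
move=> /andP[u0 uv]; apply: (@le_trans _ _ (u * expR u)); last first.
  by rewrite ler_wpM2l// ler_expR.
have := expR_ge1Dx (- u); rewrite expRN.
have := expR_gt0 u; set e := expR u => e0 H.
have : (1 - u) * e <= e^-1 * e by rewrite ler_pM2r.
by rewrite mulVf ?gt_eqF//; lra.
Qed.

Let expR_upper_normal l : l ^+ 2 <= 1 -> expR (l ^+ 2 * s ^+ 2 / 2) - 1 <=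
  l ^+ 2 * (s ^+ 2 / 2 * expR (s ^+ 2 / 2)).
Proof.
move=> l1; apply: (le_trans (expR_upper (v := s ^+ 2 / 2) _)).
  rewrite -mulrA mulr_ge0 ?sqr_ge0 ?divr_ge0 ?sqr_ge0//=.
  by rewrite ler_piMl// divr_ge0 ?sqr_ge0.
by rewrite -!mulrA.
Qed.

(** Integrating 1 + l x <= e^(l x) gives l E x <= e^(l^2 s^2 / 2) - 1, which is of order l^2.
    Dividing by l of either sign leaves nothing as l tends to 0. *)
Lemma EE_normal_id : EE N id = 0.
Proof.
have i1 := L2_L1 normal_prob_id_L2.
have H (l : R) : l ^+ 2 <= 1 -> l * EE N id <= l ^+ 2 * (s ^+ 2 / 2 * expR (s ^+ 2 / 2)).
  move=> /expR_upper_normal; apply: le_trans.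
  rewrite lerBrDl -(EEZ _ i1) -[X in X + _](EE_cst N) -EED; [|exact: L1_cst|exact: L1Z].
  rewrite -EE_normal_exp; apply: EE_le.
  - by apply: L1D; [exact: L1_cst|exact: L1Z].
  - exact: normal_prob_exp_integrable.
  - by move=> x; exact: expR_ge1Dx.
apply/eqP; rewrite eq_le; apply/andP; split.
- apply: (@le_small _ _ (s ^+ 2 / 2 * expR (s ^+ 2 / 2))) => l /andP[l0 l1].
  rewrite add0r -(ler_pM2l l0); set c := _ * expR _.
  by rewrite (_ : l * (l * c) = l ^+ 2 * c) ?H ?expr_le1 ?(ltW l0)//; rewrite mulrA expr2.
- rewrite -oppr_le0.
  apply: (@le_small _ _ (s ^+ 2 / 2 * expR (s ^+ 2 / 2))) => l /andP[l0 l1].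
  rewrite add0r -(ler_pM2l l0) mulrN -mulNr; set c := _ * expR _.
  rewrite (_ : l * (l * c) = (- l) ^+ 2 * c); last by rewrite sqrrN mulrA expr2.
  by rewrite H// sqrrN expr_le1// ltW.
Qed.

(** The mean of e^(l x) + e^(-l x) is 2 e^(l^2 s^2 / 2). The bounds [cosh_lower] and [cosh_upper]
    squeeze it between expansions whose l^2 coefficient is the second moment, up to higher order in
    l. *)
Lemma EE_normal_sqr : EE N (fun x => x ^+ 2) = s ^+ 2.
Proof.
set m := LHS.
have [_ i2] := normal_prob_id_L2.
have ie l := normal_prob_exp_integrable l.
have low l : 2 + l ^+ 2 * m <= expR (l ^+ 2 * s ^+ 2 / 2) *+ 2.
  rewrite [leRHS]mulr2n -{3}(sqrrN l) -!EE_normal_exp -{1}(EE_cst N 2) -(EEZ _ i2).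
  rewrite -EED ?L1Z ?L1_cst// -EED//.
  apply: EE_le.
  - by apply: L1D; [exact: L1_cst|exact: L1Z].
  - exact: L1D.
  - by move=> x; rewrite -exprMn mulNr; exact: cosh_lower.
have upp l : 0 < l <= 1 -> expR (l ^+ 2 * s ^+ 2 / 2) *+ 2 - 2 <=
    l ^+ 2 * (m + l * (12 * expR (2 ^+ 2 * s ^+ 2 / 2))).
  move=> l01; rewrite [X in X - _]mulr2n -{2}(sqrrN l) -!EE_normal_exp -{1}(EE_cst N 2).
  (* The remainder of [cosh_upper] contains two exponentials of equal mean, hence 12 = 6 + 6. *)
  rewrite (_ : 12 * _ = 6 * (expR (2 ^+ 2 * s ^+ 2 / 2) + expR ((-2) ^+ 2 * s ^+ 2 / 2))); last first.
    by rewrite EE_normal_exp sqrrN; ring.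
  rewrite -!EE_normal_exp -!EED// -EEB; [|exact: L1D|exact: L1_cst].
  rewrite -(EEZ _ (L1D (ie _) (ie _))) -EEZ; last by apply: L1Z; exact: L1D.
  rewrite -EED//; last by do 2 apply: L1Z; exact: L1D.
  rewrite -EEZ; last by apply: L1D => //; do 2 apply: L1Z; exact: L1D.
  apply: EE_le; last by move=> x; rewrite !mulNr; exact: cosh_upper.
  - by apply: L1B; [exact: L1D|exact: L1_cst].
  - by apply: L1Z; apply: L1D => //; do 2 apply: L1Z; exact: L1D.
have sqr_gt0 (l : R) : 0 < l -> 0 < l ^+ 2 by move=> l0; rewrite exprn_gt0.
apply/eqP; rewrite eq_le; apply/andP; split.
(* With u = l^2 s^2 / 2 and v = s^2 / 2, one has e^u - 1 <= u + u^2 e^v. Twice the first term is l^2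
   s^2, and the second is of order l^4, hence at most of order l^3. *)
- apply: (@le_small _ _ (s ^+ 2 * s ^+ 2 * expR (s ^+ 2 / 2))) => l /andP[l0 l1].
  have l21 : l ^+ 2 <= 1 by rewrite expr_le1// ltW.
  rewrite -(ler_pM2l (sqr_gt0 l l0)).
  have := low l; set u := l ^+ 2 * s ^+ 2 / 2; set v := s ^+ 2 / 2 => Hl.
  have u0 : 0 <= u by apply: divr_ge0 => //; apply: mulr_ge0; exact: sqr_ge0.
  have uv : u <= v by rewrite /u -mulrA ler_piMl// divr_ge0 ?sqr_ge0.
  have h1 : expR u - 1 <= u * expR u by apply: expR_upper; rewrite u0 lexx.
  have h2 : u * expR u <= u * (1 + u * expR v).
    by rewrite ler_wpM2l// -lerBlDl expR_upper// u0.
  have h3 : u * (u * expR v) <= l ^+ 2 * (l * (v * v * expR v)).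
    rewrite (_ : u * _ = l ^+ 2 * (l ^+ 2 * (v * v * expR v))); last by rewrite /u /v; field.
    rewrite ler_pM2l ?sqr_gt0// ler_wpM2r//.
      by rewrite mulr_ge0 ?expR_ge0// mulr_ge0// divr_ge0// sqr_ge0.
    by rewrite expr2 ler_piMl// ltW.
  have -> : l ^+ 2 * (s ^+ 2 + l * (s ^+ 2 * s ^+ 2 * expR v)) =
    u *+ 2 + l ^+ 2 * (l * (v * v * expR v)) *+ 4 by rewrite /u /v; field.
  have h4 : 0 <= u * (u * expR v) by apply: mulr_ge0 => //; apply: mulr_ge0 => //; exact: expR_ge0.
  by lra.
- apply: (@le_small _ _ (12 * expR (2 ^+ 2 * s ^+ 2 / 2))) => l l01.
  have l0 : 0 < l by case/andP: l01.
  rewrite -(ler_pM2l (sqr_gt0 l l0)); apply: le_trans (upp l l01).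
  by have := expR_ge1Dx (l ^+ 2 * s ^+ 2 / 2); lra.
Qed.

End normal_moments.

End normal.

(** * Joint measurability and independence *)

Section caratheodory_function.
Context {d : measure_display} {Omega : measurableType d} {R : realType}.
Implicit Type f : R -> Omega -> R.

Let grid (n : nat) (s : R) : R := (Num.floor (s * n.+1%:R))%:~R / n.+1%:R.

Let grid_cvg (s : R) : grid n s @[n --> \oo] --> s.
Proof.
apply/cvgrPdist_le => e e0; near=> n.
rewrite /grid; set N : R := n.+1%:R; have N0 : 0 < N by rewrite ltr0n.
have -> : s - (Num.floor (s * N))%:~R / N = (s * N - (Num.floor (s * N))%:~R) / N.
  by field; rewrite gt_eqF.
have /andP[h1 h2] := floor_itv (s * N).
rewrite ger0_norm ?divr_ge0 ?subr_ge0 ?(ltW N0)//.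
apply: (@le_trans _ _ N^-1).
  by rewrite ler_pdivrMr// mulVf ?gt_eqF// lerBlDl; move: h2; rewrite intrD => /ltW.
by apply: ltW; rewrite /N; near: n; exact: (near_infty_natSinv_lt (PosNum e0)).
Unshelve. all: by end_near. Qed.

(* Continuity in time lets one sample the process on a grid, which leaves
   countably many measurable sections. *)
Lemma continuous_measurable_joint f :
  (forall w, continuous (f ^~ w)) -> (forall s, measurable_fun setT (f s)) ->
  measurable_fun setT (fun p : R * Omega => f p.1 p.2).
Proof.
move=> cf mf.
apply: (@measurable_fun_cvg _ _ _ _ (fun n p => f (grid n p.1) p.2)); last first.
  by move=> [s w] _ /=; apply: (@cvg_comp _ _ _ (grid^~ s) (f^~ w) _ (nbhs s)); [exact: grid_cvg|exact: cf].
move=> n _ A mA; rewrite setTI.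
pose S (k : int) := ([set s : R | Num.floor (s * n.+1%:R) = k] `*`
    (f (k%:~R / n.+1%:R) @^-1` A)).
rewrite [X in measurable X](_ : _ = \bigcup_(k : nat) (S k%:Z `|` S (- k%:Z))); last first.
  apply/seteqP; split => [[s w] /= fA|[s w] [k _ /= [[/= sk]|[/= sk]]]]; rewrite /grid ?sk//.
  have [k [kb|kb]] : exists k : nat, Num.floor (s * n.+1%:R) = k%:Z \/ Num.floor (s * n.+1%:R) = - k%:Z.
    by case: (Num.floor _) => k; [exists k; left|exists k.+1; right; rewrite NegzE].
  - by exists k => //=; left; split => //=; rewrite -kb.
  - by exists k => //=; right; split => //=; rewrite -kb.
have mS k : measurable (S k).
  apply: measurableX => /=; last first.
    by rewrite -[X in measurable X]setTI; exact: mf.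
  rewrite (_ : [set _ | _] = `[k%:~R / n.+1%:R, (k + 1)%:~R / n.+1%:R[%classic)//.
  apply/seteqP; split => s /=; rewrite in_itv /= ler_pdivrMr// ltr_pdivlMr//.
    by move=> <-; exact: floor_itv.
  by move=> H; apply: floor_def.
by apply: bigcup_measurable => k _; exact: measurableU.
Qed.

End caratheodory_function.

(** * Integrals of functions of an independent pair *)

Section independence.
Context {d : measure_display} {Omega : measurableType d} {R : realType}.
Variable P : probability Omega R.
Context {d' d2 : measure_display} {T : measurableType d'} {T2 : measurableType d2}.
Variables (Y : Omega -> T) (Z : Omega -> T2) (N : probability T2 R).
Hypotheses (mY : measurable_fun setT Y) (mZ : measurable_fun setT Z).
Hypothesis YZ : forall (A : set T) (A' : set T2), measurable A -> measurable A' ->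
  P (Y @^-1` A `&` Z @^-1` A') = (P (Y @^-1` A) * N A')%E.

Let mYZ : measurable_fun setT (fun w => (Y w, Z w)).
Proof. exact: measurable_fun_pair. Qed.

Let PY : probability T R := distribution P (mfun_Sub (mem_set mY)).

Let PYZ : probability (T * T2)%type R := distribution P (mfun_Sub (mem_set mYZ)).

(** [YZ] prescribes the joint law on measurable rectangles, and these determine a product
    measure. *)
Let law (A : set (T * T2)) : measurable A -> PYZ A = (PY \x N)%E A.
Proof.
move=> mA; apply/esym; exact: product_measure_unique.
Qed.

(** This plays the role of conditioning on [Y]: the first component is frozen and the second is
    integrated against its own law. *)
Lemma ge0_integral_indep (f : T * T2 -> \bar R) :
  measurable_fun setT f -> (forall x, 0 <= f x)%E ->
  (\int[P]_w f (Y w, Z w) = \int[P]_w \int[N]_x f (Y w, x))%E.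
Proof.
move=> mf f0.
transitivity (\int[PYZ]_x f x)%E.
  by rewrite ge0_integral_pushforward.
transitivity (\int[PY \x N]_x f x)%E.
  by apply: eq_measure_integral => A mA _; exact: law.
rewrite fubini_tonelli1//= ge0_integral_pushforward//.
- exact: measurable_fun_fubini_tonelli_F.
- by move=> y _; apply: integral_ge0.
Qed.

Lemma integral_indep (f : T * T2 -> R) :
  measurable_fun setT f -> P.-integrable setT (fun w => (f (Y w, Z w))%:E) ->
  (\int[P]_w (f (Y w, Z w))%:E = \int[P]_w \int[N]_x (f (Y w, x))%:E)%E.
Proof.
move=> mf jf.
have mEf : measurable_fun setT (EFin \o f) by exact: measurableT_comp.
have jf' : (PY \x N)%E.-integrable setT (EFin \o f).
  apply/integrableP; split => //.
  have <- : (\int[PYZ]_x `|(EFin \o f) x| = \int[PY \x N]_x `|(EFin \o f) x|)%E.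
    by apply: eq_measure_integral => A mA _; exact: law.
  rewrite ge0_integral_pushforward//; last exact: measurableT_comp.
  by case/integrableP : jf.
transitivity (\int[PYZ]_x (f x)%:E)%E.
  by rewrite integral_pushforward.
transitivity (\int[PY \x N]_x (f x)%:E)%E.
  by apply: eq_measure_integral => A mA _; exact: law.
rewrite -integral12_prod_meas1//=.
have mF : measurable_fun setT (fubini_F N (EFin \o f)).
  exact: (measurable_int _ (integrable_fubini_F jf')).
rewrite integral_pushforward//.
have /integrableP[_] := integrable_fubini_F jf'.
rewrite ge0_integral_pushforward//; last exact: measurableT_comp.
move=> H; apply/integrableP; split => //.
exact: measurableT_comp.
Qed.

End independence.

(** * Brownian increments along a partition *)

Section measurable_wrt_theory.
Context {d : measure_display} {Omega : measurableType d} {R : realType}.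
Variable G : set (set Omega).
Hypothesis sG : sigma_algebra setT G.
Implicit Types Y Z : Omega -> R.

(** Regards the set of sets [G] as the sigma-algebra of a measurable type, so that the usual closure
    properties of measurable functions become available. *)
Lemma measurable_wrtP Y :
  measurable_wrt G Y <-> measurable_fun setT (Y : g_sigma_algebraType G -> R).
Proof.
split=> mY.
- by move=> _ A mA; rewrite setTI; apply: sub_sigma_algebra; exact: mY.
- move=> A mA; rewrite -(sigma_algebra_id sG) -[X in smallest _ _ X]setTI.
  exact: mY.
Qed.

Lemma measurable_wrt_cst (k : R) : measurable_wrt G (fun=> k).
Proof. by apply/measurable_wrtP; exact: measurable_cst. Qed.

Lemma measurable_wrtD Y Z : measurable_wrt G Y -> measurable_wrt G Z ->
  measurable_wrt G (fun w => Y w + Z w).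
Proof. by move=> /measurable_wrtP ? /measurable_wrtP ?; apply/measurable_wrtP; exact: measurable_funD. Qed.

Lemma measurable_wrtM Y Z : measurable_wrt G Y -> measurable_wrt G Z ->
  measurable_wrt G (fun w => Y w * Z w).
Proof. by move=> /measurable_wrtP ? /measurable_wrtP ?; apply/measurable_wrtP; exact: measurable_funM. Qed.

Lemma measurable_wrt_comp (f : R -> R) Y : measurable_fun setT f ->
  measurable_wrt G Y -> measurable_wrt G (f \o Y).
Proof. by move=> mf /measurable_wrtP ?; apply/measurable_wrtP; exact: measurableT_comp. Qed.

Lemma measurable_wrtB Y Z : measurable_wrt G Y -> measurable_wrt G Z ->
  measurable_wrt G (fun w => Y w - Z w).
Proof. by move=> /measurable_wrtP ? /measurable_wrtP ?; apply/measurable_wrtP; exact: measurable_funB. Qed.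

Lemma measurable_wrt_sum (I : Type) (r : seq I) (p : pred I) (f : I -> Omega -> R) :
  (forall i, p i -> measurable_wrt G (f i)) ->
  measurable_wrt G (fun w => \sum_(i <- r | p i) f i w).
Proof.
move=> mf; elim: r => [|i r IH].
  by under eq_fun do rewrite big_nil; exact: measurable_wrt_cst.
under eq_fun do rewrite big_cons.
by case pi : (p i) => //; apply: measurable_wrtD => //; exact: mf.
Qed.

End measurable_wrt_theory.

(** * Increments that are independent of the past, and their discrete stochastic integrals *)

Section brownian_increments.
Context {d : measure_display} {Omega : measurableType d} {R : realType}.
Variables (P : probability Omega R) (F : R -> set (set Omega)) (B : R -> Omega -> R).
Hypotheses (hF : filtration F) (hB : brownian_motion P F B).

Lemma filtration_sigma t : 0 <= t -> sigma_algebra setT (F t).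
Proof. by case: hF => + _ _; exact. Qed.

Lemma adapted_le s t (Y : Omega -> R) : 0 <= s -> s <= t ->
  measurable_wrt (F s) Y -> measurable_wrt (F t) Y.
Proof. by case: hF => _ _ sub s0 st mY A mA; apply: (sub s) => //; exact: mY. Qed.

Lemma adapted_meas t (Y : Omega -> R) : 0 <= t -> measurable_wrt (F t) Y ->
  measurable_fun setT Y.
Proof. by case: hF => _ sub _ t0 mY _ A mA; rewrite setTI; apply: (sub t) => //; exact: mY. Qed.

Lemma brownian_adapted t : 0 <= t -> measurable_wrt (F t) (B t).
Proof. by case: hB => + _ _ _ _; exact. Qed.

Lemma brownian_meas t : 0 <= t -> measurable_fun setT (B t).
Proof. by move=> t0; apply: (adapted_meas t0); exact: brownian_adapted. Qed.

Section increment.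
Variables s t : R.
Hypotheses (s0 : 0 <= s) (st : s < t).
Local Notation N := (normal_prob 0 (Num.sqrt (t - s))).
Let incr w := B t w - B s w.

Let mincr : measurable_fun setT incr.
Proof. by apply: measurable_funB; apply: brownian_meas => //; exact/(le_trans s0)/ltW. Qed.

Let var_neq0 : Num.sqrt (t - s) != 0.
Proof. by rewrite gt_eqF// sqrtr_gt0 subr_gt0. Qed.

Let var_sqr : Num.sqrt (t - s) ^+ 2 = t - s.
Proof. by rewrite sqr_sqrtr// subr_ge0 ltW. Qed.

Let indep (E : set Omega) (A : set R) : F s E -> measurable A ->
  P (E `&` incr @^-1` A) = (P E * N A)%E.
Proof.
move=> FE mA; case: hB => _ _ _ law ind.
by rewrite /incr (ind s t s0 st E A FE mA) law.
Qed.

(** [U] and [V] belong to the past, so the increment is integrated with both frozen; its Laplace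
    transform at [V] is e^(V^2 (t - s) / 2), which the last term compensates exactly. As an identity
    between integrals of nonnegative functions it covers unbounded [U] and [V]. *)
Lemma integral_exp_increment (U V : Omega -> R) :
  measurable_wrt (F s) U -> measurable_wrt (F s) V ->
  (\int[P]_w (expR (U w + V w * incr w - V w ^+ 2 * (t - s) / 2))%:E =
   \int[P]_w (expR (U w))%:E)%E.
Proof.
move=> mU mV.
have mU' := adapted_meas s0 mU; have mV' := adapted_meas s0 mV.
have mf : measurable_fun setT (fun p : (R * R) * R =>
    (expR (p.1.1 + p.1.2 * p.2 - p.1.2 ^+ 2 * (t - s) / 2))%:E).
  apply: measurableT_comp => //; apply: measurableT_comp => //.
  apply: measurable_funB; last first.
    apply: measurable_funM => //; apply: measurable_funM => //.
    apply: measurable_funX; exact: measurableT_comp.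
  apply: measurable_funD; first exact: measurableT_comp.
  by apply: measurable_funM => //; exact: measurableT_comp.
have mUV : measurable_fun setT (fun w => (U w, V w)) by exact: measurable_fun_pair.
have ind (A : set (R * R)) (A' : set R) : measurable A -> measurable A' ->
    P ((fun w => (U w, V w)) @^-1` A `&` incr @^-1` A') = (P ((fun w => (U w, V w)) @^-1` A) * N A')%E.
  move=> mA mA'; rewrite indep//.
  move: mU mV => /(measurable_wrtP (filtration_sigma s0)) mU1 /(measurable_wrtP (filtration_sigma s0)) mV1.
  have : measurable_fun setT (fun w : g_sigma_algebraType (F s) => (U w, V w)) by exact: measurable_fun_pair.
  move=> /(_ measurableT A mA); rewrite setTI.
  by move=> H; rewrite -(sigma_algebra_id (filtration_sigma s0)).
rewrite (@ge0_integral_indep _ _ _ P _ _ _ (measurableTypeR R) (fun w => (U w, V w)) incr N mUV mincr ind _ mf)//=.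
apply: eq_integral => w _ /=.
  under eq_integral.
    move=> x _; rewrite addrAC expRD EFinM; over.
  rewrite ge0_integralZl//; last first.
    by do 2 apply: measurableT_comp => //; exact: measurable_funM.
  rewrite normal_prob_mgf// -EFinM -expRD var_sqr; congr (expR _)%:E; ring.
Qed.

Lemma increment_mul (G : Omega -> R) (phi : R -> R) :
  measurable_wrt (F s) G -> L1 P G -> L1 N phi ->
  L1 P (fun w => G w * phi (incr w)) /\
  EE P (fun w => G w * phi (incr w)) = EE P G * EE N phi.
Proof.
move=> mG jG jphi; have mG' := adapted_meas s0 mG.
have mphi : measurable_fun setT phi := L1_meas jphi.
have mf : measurable_fun setT (fun p : R * R => p.1 * phi p.2).
  by apply: measurable_funM => //; exact: measurableT_comp.
have ind (A : set R) (A' : set R) : measurable A -> measurable A' ->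
    P (G @^-1` A `&` incr @^-1` A') = (P (G @^-1` A) * N A')%E.
  by move=> mA mA'; rewrite indep//; exact: mG.
have jGp : L1 P (fun w => G w * phi (incr w)).
  apply/integrableP; split.
    apply: measurableT_comp => //; apply: measurable_funM => //.
    exact: measurableT_comp.
  rewrite (@ge0_integral_indep _ _ _ P _ _ _ (measurableTypeR R) G incr N mG' mincr ind (fun p : R * R => `|p.1 * phi p.2|%:E))//=; last first.
    by apply: measurableT_comp => //; exact: measurableT_comp.
  under eq_integral.
    move=> w _; under eq_integral do rewrite normrM EFinM.
    rewrite ge0_integralZl//; last first.
      by apply: measurableT_comp => //; exact: measurableT_comp.
    over.
  rewrite /= ge0_integralZr//; last 2 first.
    by apply: measurableT_comp => //; exact: measurableT_comp.
    by apply: integral_ge0.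
  rewrite lte_mul_pinfty//.
  - exact: integral_ge0.
  - by apply: integrable_fin_num => //; exact: L1_abs.
  - by case/integrableP : jphi.
split => //.
rewrite /EE /Rintegral (@integral_indep _ _ _ P _ _ _ (measurableTypeR R) G incr N mG' mincr ind (fun p : R * R => p.1 * phi p.2))//=.
under eq_integral.
  move=> w _; under eq_integral do rewrite EFinM.
  rewrite integralZl// EE_EFin//; over.
by rewrite integralZr// EE_EFin//.
Qed.

Lemma increment_id (G : Omega -> R) : measurable_wrt (F s) G -> L1 P G ->
  L1 P (fun w => G w * incr w) /\ EE P (fun w => G w * incr w) = 0.
Proof.
move=> mG jG.
have [] := @increment_mul G id mG jG (L2_L1 (normal_prob_id_L2 var_neq0)).
by rewrite EE_normal_id// mulr0.
Qed.

Lemma increment_sqr (G : Omega -> R) : measurable_wrt (F s) G -> L1 P G ->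
  L1 P (fun w => G w * incr w ^+ 2) /\
  EE P (fun w => G w * incr w ^+ 2) = EE P G * (t - s).
Proof.
move=> mG jG.
have [_ j2] := normal_prob_id_L2 var_neq0.
have [] := @increment_mul G (fun x => x ^+ 2) mG jG j2.
by rewrite EE_normal_sqr// var_sqr.
Qed.

End increment.

Section partition.
Variables (tau : nat -> R) (N : nat).
Hypotheses (tau0 : 0 <= tau 0%N) (tau_le : forall i, tau i <= tau i.+1).

Let tau_ge0 i : 0 <= tau i.
Proof. by elim: i => // i IH; exact: le_trans IH (tau_le i). Qed.

Let dB i w := B (tau i.+1) w - B (tau i) w.

Definition stoch_sum (V : nat -> Omega -> R) (n : nat) w := \sum_(i < n) V i w * dB i w.

(** The bracket of two discrete integrals. It is kept bilinear because the isometry is applied to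
    integrals up to two different times. *)
Definition quad_sum (V W : nat -> Omega -> R) (n : nat) w :=
  \sum_(i < n) V i w * W i w * (tau i.+1 - tau i).

Definition step_adapted (V : nat -> Omega -> R) :=
  forall i, (i < N)%N -> measurable_wrt (F (tau i)) (V i).

Lemma stoch_sumS V n w : stoch_sum V n.+1 w = stoch_sum V n w + V n w * dB n w.
Proof. by rewrite /stoch_sum big_ord_recr. Qed.

Lemma quad_sumS V W n w :
  quad_sum V W n.+1 w = quad_sum V W n w + V n w * W n w * (tau n.+1 - tau n).
Proof. by rewrite /quad_sum big_ord_recr. Qed.

Lemma stoch_sum_adapted V n : step_adapted V -> (n <= N)%N ->
  measurable_wrt (F (tau n)) (stoch_sum V n).
Proof.
move=> aV; elim: n => [_|n IH nN].
  by under [X in measurable_wrt _ X]eq_fun do rewrite /stoch_sum big_ord0;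
    apply: measurable_wrt_cst; exact: filtration_sigma.
rewrite (_ : stoch_sum _ _ = fun w => stoch_sum V n w + V n w * dB n w); last first.
  by apply/funext => w; exact: stoch_sumS.
have sF := filtration_sigma (tau_ge0 n.+1).
have up Y := @adapted_le _ _ Y (tau_ge0 n) (tau_le n).
apply: measurable_wrtD => //; first by apply: up; exact/IH/ltnW.
apply: measurable_wrtM => //; first exact/up/aV.
by apply: measurable_wrtB => //; [exact: brownian_adapted|apply: up; exact: brownian_adapted].
Qed.

Lemma quad_sum_adapted V n : step_adapted V -> (n <= N)%N ->
  measurable_wrt (F (tau n)) (quad_sum V V n).
Proof.
move=> aV; elim: n => [_|n IH nN].
  by under [X in measurable_wrt _ X]eq_fun do rewrite /quad_sum big_ord0;
    apply: measurable_wrt_cst; exact: filtration_sigma.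
rewrite (_ : quad_sum _ _ _ = fun w => quad_sum V V n w + V n w * V n w * (tau n.+1 - tau n)); last first.
  by apply/funext => w; exact: quad_sumS.
have sF := filtration_sigma (tau_ge0 n.+1).
have up Y := @adapted_le _ _ Y (tau_ge0 n) (tau_le n).
apply: measurable_wrtD => //; first by apply: up; exact/IH/ltnW.
apply: measurable_wrtM => //; last exact: measurable_wrt_cst.
by apply: measurable_wrtM => //; exact/up/aV.
Qed.

(** The last factor has mean one given the past. There are finitely many steps and every integrand
    is nonnegative, so equality holds for unbounded [V] too. *)
Lemma exp_martingale V n : step_adapted V -> (n <= N)%N ->
  (\int[P]_w (expR (stoch_sum V n w - quad_sum V V n w / 2))%:E = 1)%E.
Proof.
move=> aV; elim: n => [_|n IH nN].
  under eq_integral do rewrite /stoch_sum /quad_sum !big_ord0 mul0r subrr expR0.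
  by rewrite integral_cst// mul1e; exact: probability_setT.
rewrite -(IH (ltnW nN)).
(* A repeated time gives a zero increment; it is treated apart because the normal law is used with a
   nonzero standard deviation. *)
have := tau_le n; rewrite le_eqVlt => /predU1P[ee|lt_n].
  by apply: eq_integral => w _; rewrite stoch_sumS quad_sumS /dB ee !subrr !mulr0 !addr0.
have sF := filtration_sigma (tau_ge0 n).
rewrite -(integral_exp_increment (tau_ge0 n) lt_n
  (U := fun w => stoch_sum V n w - quad_sum V V n w / 2) (V := V n))//; last exact: aV.
  by apply: eq_integral => w _; rewrite stoch_sumS quad_sumS; congr (expR _)%:E; rewrite /dB expr2; field.
apply: measurable_wrtB => //; first by apply: stoch_sum_adapted => //; exact: ltnW.
apply: measurable_wrtM => //; last exact: measurable_wrt_cst.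
by apply: quad_sum_adapted => //; exact: ltnW.
Qed.

Let step_L2 V n : step_adapted V -> (n < N)%N -> L2 P (V n) ->
  L2 P (fun w => V n w * dB n w).
Proof.
move=> aV nN [mV jV].
have mdB : measurable_fun setT (dB n) by apply: measurable_funB; exact: brownian_meas.
split; first exact: measurable_funM.
have := tau_le n; rewrite le_eqVlt => /predU1P[ee|lt_n].
  under [X in L1 _ X]eq_fun do rewrite /dB ee subrr mulr0 expr0n /=.
  exact: L1_cst.
have sF := filtration_sigma (tau_ge0 n).
under [X in L1 _ X]eq_fun do rewrite exprMn.
apply: (proj1 (increment_sqr (tau_ge0 n) lt_n _ jV)).
by under [X in measurable_wrt _ X]eq_fun do rewrite expr2; apply: measurable_wrtM => //; exact: aV.
Qed.

Lemma stoch_sum_L2 V n : step_adapted V -> (forall i, (i < N)%N -> L2 P (V i)) ->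
  (n <= N)%N -> L2 P (stoch_sum V n).
Proof.
move=> aV jV nN; apply: L2_sum => i _.
by apply: step_L2 => //; [|apply: jV]; exact: leq_trans (ltn_ord i) nN.
Qed.

Let step_mean0 n (G : Omega -> R) : measurable_wrt (F (tau n)) G -> L1 P G ->
  L1 P (fun w => G w * dB n w) /\ EE P (fun w => G w * dB n w) = 0.
Proof.
move=> aG jG.
have := tau_le n; rewrite le_eqVlt => /predU1P[ee|lt_n].
  rewrite /dB ee (_ : (fun w => _) = fun=> 0); last by apply/funext => w; rewrite subrr mulr0.
  by split; [exact: L1_cst|exact: EE_cst].
exact: increment_id.
Qed.

Let step_sqr n (G : Omega -> R) : measurable_wrt (F (tau n)) G -> L1 P G ->
  L1 P (fun w => G w * dB n w ^+ 2) /\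
  EE P (fun w => G w * dB n w ^+ 2) = EE P G * (tau n.+1 - tau n).
Proof.
move=> aG jG.
have := tau_le n; rewrite le_eqVlt => /predU1P[ee|lt_n].
  rewrite /dB ee (_ : (fun w => _) = fun=> 0); last first.
    by apply/funext => w; rewrite subrr expr0n mulr0.
  by rewrite subrr mulr0; split; [exact: L1_cst|exact: EE_cst].
exact: increment_sqr.
Qed.

Lemma stoch_sum_mean0 V n : step_adapted V -> (forall i, (i < N)%N -> L2 P (V i)) ->
  (n <= N)%N -> EE P (stoch_sum V n) = 0.
Proof.
move=> aV jV nN; rewrite /stoch_sum EE_sum => [|i _]; last first.
  have iN : (i < N)%N by exact: leq_trans (ltn_ord i) nN.
  by apply: L2_L1; apply: step_L2 => //; exact: jV.
rewrite big1// => i _; have iN : (i < N)%N by exact: leq_trans (ltn_ord i) nN.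
by apply: (proj2 (step_mean0 (aV _ iN) _)); apply: L2_L1; exact: jV.
Qed.

(** In the product of the two sums, the terms linear in the last increment have a coefficient from
    the past and hence mean zero, while the squared increment contributes its length. *)
Lemma stoch_sum_isometry V W n : step_adapted V -> step_adapted W ->
  (forall i, (i < N)%N -> L2 P (V i)) -> (forall i, (i < N)%N -> L2 P (W i)) ->
  (n <= N)%N ->
  EE P (fun w => stoch_sum V n w * stoch_sum W n w) = EE P (quad_sum V W n).
Proof.
move=> aV aW jV jW; elim: n => [_|n IH nN].
  by apply: EE_eq => w; rewrite /stoch_sum /quad_sum !big_ord0 mul0r.
have sF := filtration_sigma (tau_ge0 n).
have sV := stoch_sum_L2 aV jV (ltnW nN).
have sW := stoch_sum_L2 aW jW (ltnW nN).
have mV := stoch_sum_adapted aV (ltnW nN).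
have mW := stoch_sum_adapted aW (ltnW nN).
have jVn := jV n nN; have jWn := jW n nN.
have [j1 e1] := @step_mean0 n (fun w => stoch_sum V n w * W n w + stoch_sum W n w * V n w)
  (measurable_wrtD sF (measurable_wrtM sF mV (aW _ nN)) (measurable_wrtM sF mW (aV _ nN)))
  (L1D (L2M sV jWn) (L2M sW jVn)).
have [j2 e2] := @step_sqr n (fun w => V n w * W n w)
  (measurable_wrtM sF (aV _ nN) (aW _ nN)) (L2M jVn jWn).
transitivity (EE P (fun w => (stoch_sum V n w * stoch_sum W n w +
    (stoch_sum V n w * W n w + stoch_sum W n w * V n w) * dB n w) + V n w * W n w * dB n w ^+ 2)).
  by apply: EE_eq => w; rewrite !stoch_sumS; ring.
have jVW : L1 P (fun w => V n w * W n w * (tau n.+1 - tau n)).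
  by under [X in L1 _ X]eq_fun do rewrite mulrC; apply: L1Z; exact: L2M.
rewrite EED//; last by apply: L1D => //; exact: L2M.
rewrite EED//; last exact: L2M.
rewrite e1 e2 addr0 IH ?(ltnW nN)//.
transitivity (EE P (fun w => quad_sum V W n w + V n w * W n w * (tau n.+1 - tau n))); last first.
  by apply: EE_eq => w; rewrite quad_sumS.
rewrite EED//.
  congr (_ + _); rewrite mulrC -EEZ//; last exact: L2M.
  by apply: EE_eq => w; rewrite mulrC.
rewrite /quad_sum; apply: L1_sum => i _.
have iN : (i < N)%N by exact: ltn_trans (ltn_ord i) nN.
by under [X in L1 _ X]eq_fun do rewrite mulrC; apply: L1Z; apply: L2M; [exact: jV|exact: jW].
Qed.

End partition.

End brownian_increments.

(** * Integrals of elementary processes *)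

Section time_partition.
Context {R : realType}.
Implicit Types (S : seq R) (t u v x : R).
Local Notation mu := (@lebesgue_measure R).

(** No open cell contains [x]. In this form the endpoints 0 and t of a subdivision, and all points
    beyond them, are separated automatically. *)
Definition separates (tau : nat -> R) (N : nat) x :=
  forall k, (k < N)%N -> x < tau k.+1 -> x <= tau k.

Definition subdivision (tau : nat -> R) (N : nat) t :=
  [/\ tau 0%N = 0, tau N = t & forall i, tau i <= tau i.+1].

Lemma subdivision_exists S t : 0 <= t -> exists tau N,
  subdivision tau N t /\ forall x, x \in S -> separates tau N x.
Proof.
move=> t0.
pose L := sort <=%R [seq x <- S | 0 < x < t].
pose s := 0 :: rcons L t.
have Lin x : (x \in L) = (x \in S) && (0 < x < t).
  by rewrite mem_sort mem_filter andbC.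
have ss : sorted <=%R s.
  rewrite /s /= rcons_path.
  have -> : path <=%R 0 L.
    rewrite path_min_sorted ?(sort_sorted (@le_total _ R))//.
    by apply/allP => x; rewrite Lin => /and3P[_ /ltW].
  have := mem_last 0 L; rewrite inE => /predU1P[->//|].
  by rewrite Lin => /and3P[_ _ /ltW].
have st x : x \in s -> x <= t.
  rewrite inE mem_rcons inE => /predU1P[->//|/predU1P[->//|]].
  by rewrite Lin => /and3P[_ _ /ltW].
(* The default value [t] makes [tau] constant after the last point, so it is monotone over all
   indices. *)
pose tau k := nth t s k.
have taut k : tau k <= t.
  rewrite /tau; case: (ltnP k (size s)) => ks; first by apply: st; exact: mem_nth.
  by rewrite nth_default.
have tau_le i : tau i <= tau i.+1.
  rewrite /tau; case: (ltnP i.+1 (size s)) => ks; last by rewrite [leRHS]nth_default.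
  by apply: (sorted_leq_nth le_trans le_refl) => //; rewrite inE; exact: ltnW.
have tau_ge0 i : 0 <= tau i by elim: i => // i IH; exact: le_trans (tau_le i).
exists tau, (size L).+1; split.
  by split => //; rewrite /tau /s /= nth_rcons ltnn eqxx.
move=> x xS k _ xk; case: (leP x 0) => x0; first exact: le_trans x0 _.
case: (ltP x t) => xt; last by have := lt_le_trans xk (le_trans (taut _) xt); rewrite ltxx.
have xs : x \in s by rewrite inE mem_rcons inE Lin xS x0 xt !orbT.
have jx : (index x s < size s)%N by rewrite index_mem.
have tx : tau (index x s) = x by exact: nth_index.
rewrite -tx.
have mono i j : (i <= j)%N -> tau i <= tau j.
  by move=> /subnKC <-; elim: (j - i)%N => [|m IH]; rewrite ?addn0 // addnS (le_trans IH).
case: (leqP (index x s) k) => [/mono//|/mono].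
by rewrite tx => /(lt_le_trans xk); rewrite ltxx.
Qed.

Variables (tau : nat -> R) (N : nat) (t : R).
Hypothesis sub : subdivision tau N t.

Let tau_le i : tau i <= tau i.+1.
Proof. by case: sub. Qed.

Let tau_mono i j : (i <= j)%N -> tau i <= tau j.
Proof.
by move=> /subnKC <-; elim: (j - i)%N => [|m IH]; rewrite ?addn0 // addnS (le_trans IH).
Qed.

Let tau_ge0 i : 0 <= tau i.
Proof. by case: sub => + _ _ => <-; exact: tau_mono. Qed.

Let tau_let i : (i <= N)%N -> tau i <= t.
Proof. by case: sub => _ <- _; exact: tau_mono. Qed.

Lemma sum_indic_increments (f : R -> R) u v : 0 <= u -> u <= v ->
  separates tau N u -> separates tau N v ->
  \sum_(k < N) \1_(`]u, v]%classic : set R) (tau k.+1) * (f (tau k.+1) - f (tau k)) =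
  f (Num.min v t) - f (Num.min u t).
Proof.
move=> u0 uv su sv.
(* [g] is [f] frozen outside [u, v]: since no cell straddles [u] or [v], each term of the sum is an
   increment of [g], and the sum telescopes. *)
pose g x := f (Num.min (Num.min (Num.max x u) v) t).
transitivity (\sum_(0 <= k < N) (g (tau k.+1) - g (tau k))).
  rewrite big_mkord; apply: eq_bigr => k _.
  have ktt := tau_let (ltn_ord k); have kt := le_trans (tau_le k) ktt.
  rewrite indicE mem_setE in_itv /= /g.
  case: (leP (tau k.+1) u) => ku /=.
    have -> : Num.max (tau k) u = u by apply/max_idPr; exact: le_trans ku.
    by rewrite subrr mul0r.
  have uk := su _ (ltn_ord k) ku; rewrite (max_idPl uk).
  case: (leP (tau k.+1) v) => kv /=.
    by rewrite (min_idPl (le_trans (tau_le k) kv)) (min_idPl ktt) (min_idPl kt) mul1r.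
  by rewrite (min_idPr (sv _ (ltn_ord k) kv)) subrr mul0r.
rewrite telescope_sumr// /g; case: sub => -> -> _.
rewrite (max_idPr u0) (min_idPl uv).
case: (leP t u) => tu.
  by rewrite (min_idPl uv) (min_idPr tu) (min_idPr (le_trans tu uv)).
by rewrite (minC t v) -minA minxx.
Qed.

Lemma indic_separated u v s k : (k < N)%N -> separates tau N u -> separates tau N v ->
  tau k < s <= tau k.+1 ->
  \1_(`]u, v]%classic : set R) s = \1_(`]u, v]%classic : set R) (tau k.+1) :> R.
Proof.
move=> kN su sv /andP[ks sk]; rewrite !indicE !mem_setE !in_itv /=.
congr (nat_of_bool (_ && _))%:R.
  by apply/idP/idP => [us|/(su _ kN)/le_lt_trans]; [exact: lt_le_trans us sk|exact].
apply/idP/idP; last exact: le_trans.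
move=> sv'; rewrite leNgt; apply/negP => /(sv _ kN) => vk.
by have := lt_le_trans (le_lt_trans vk ks) sv'; rewrite ltxx.
Qed.

(** The cells are open on the left, which leaves the value at 0 free; it contributes nothing to the
    integral. *)
Lemma integral_step_function (f : R -> R) : measurable_fun setT f -> (forall s, 0 <= f s) ->
  (forall k s, (k < N)%N -> tau k < s <= tau k.+1 -> f s = f (tau k.+1)) ->
  (\int[mu]_(s in `[0%R, t]) (f s)%:E =
   (\sum_(k < N) f (tau k.+1) * (tau k.+1 - tau k))%:E)%E.
Proof.
move=> mf f0 fs; case: sub => E0 EN _.
have mEf A : measurable_fun A (fun s => (f s)%:E).
  by apply: measurable_funTS; exact: measurableT_comp.
suff H n : (n <= N)%N -> (\int[mu]_(s in `[0%R, tau n]) (f s)%:E =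
    (\sum_(k < n) f (tau k.+1) * (tau k.+1 - tau k))%:E)%E by rewrite -EN H.
elim: n => [_|n IH nN].
  by rewrite big_ord0 E0 set_itv1 integral_set1.
rewrite big_ord_recr /= EFinD -(IH (ltnW nN)).
rewrite (@itv_bndbnd_setU _ _ _ (BRight (tau n))) ?bnd_simp ?tau_ge0//.
rewrite ge0_integral_setU//=; first last.
- apply/disj_setPS => x /= [] ; rewrite !in_itv /= => /andP[_ xn] /andP[nx _].
  by have := lt_le_trans nx xn; rewrite ltxx.
- by move=> x _; rewrite lee_fin.
- exact: mEf.
congr (_ + _)%E.
rewrite (eq_integral (cst (f (tau n.+1))%:E)); last first.
  by move=> x; rewrite inE /= in_itv /= => /(fs n x nN) ->.
rewrite integral_cst//= lebesgue_measure_itv /= lte_fin.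
case: ltP => [_|h]; first by rewrite -EFinB -EFinM.
have -> : tau n.+1 = tau n by apply/eqP; rewrite eq_le h tau_le.
by rewrite subrr mulr0 mule0.
Qed.

End time_partition.

(** * Exponential identity and isometry for elementary processes *)

Section elementary_integrand.
Context {d : measure_display} {Omega : measurableType d} {R : realType}.
Variables (P : probability Omega R) (F : R -> set (set Omega)) (B : R -> Omega -> R).
Hypotheses (hF : filtration F) (hB : brownian_motion P F B).
Local Notation mu := (@lebesgue_measure R).

(* Like [simple_process], without the boundedness of the coefficients: the
   diffusion coefficient sampled on a grid is then elementary. *)
Record elementary := Elementary {
  el_size : nat;
  el_time : nat -> R;
  el_coef : nat -> Omega -> R;
  el_time_ge0 : 0 <= el_time 0%N;
  el_time_le : forall i, el_time i <= el_time i.+1;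
  el_coef_meas : forall i, measurable_wrt (F (el_time i)) (el_coef i) }.

Definition elementary_of_simple (phi : simple_process F) : elementary :=
  Elementary (sp_size phi) (sp_time_ge0 phi) (@sp_time_le _ _ _ _ phi) (@sp_coef_meas _ _ _ _ phi).

Definition el_val (phi : elementary) (s : R) (w : Omega) : R :=
  \sum_(i < el_size phi) el_coef phi i w *
    \1_(`]el_time phi i, el_time phi i.+1]%classic : set R) s.

Definition el_integral (phi : elementary) (t : R) (w : Omega) : R :=
  \sum_(i < el_size phi) el_coef phi i w *
    (B (Num.min (el_time phi i.+1) t) w - B (Num.min (el_time phi i) t) w).

Lemma el_time_ge0' phi i : 0 <= el_time phi i.
Proof.
elim: i => [|i IH]; first exact: el_time_ge0.
exact: le_trans (el_time_le _ _).
Qed.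

Definition breakpoints (phi : elementary) := [seq el_time phi i | i <- iota 0 (el_size phi).+1].

Lemma measurable_el_val phi w : measurable_fun setT (fun s => el_val phi s w).
Proof.
by apply: measurable_sum => i; exact: measurable_funM.
Qed.

Section on_subdivision.
Variables (phi : elementary) (tau : nat -> R) (N : nat) (t : R).
Hypotheses (sub : subdivision tau N t)
  (sep : forall x, x \in breakpoints phi -> separates tau N x).

Let sepi i : (i <= el_size phi)%N -> separates tau N (el_time phi i).
Proof. by move=> ile; apply: sep; apply: map_f; rewrite mem_iota /= add0n ltnS. Qed.

Let tau_ge0 i : 0 <= tau i.
Proof. by case: sub => E0 _ le; elim: i => [|i IH]; [rewrite E0|exact: le_trans (le i)]. Qed.

(** The value on a cell is read at its right end but is already known at its left end: a breakpoint
    below [tau k.+1] is at most [tau k]. *)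
Lemma el_val_adapted k : (k < N)%N -> measurable_wrt (F (tau k)) (el_val phi (tau k.+1)).
Proof.
move=> kN; have sF := filtration_sigma hF (tau_ge0 k).
apply: measurable_wrt_sum => // i _; rewrite indicE mem_setE in_itv /=.
case: (ltP (el_time phi i) (tau k.+1)) => /= ik; last first.
  rewrite (_ : (fun w => _) = fun=> 0); last by apply/funext => w; rewrite mulr0.
  exact: measurable_wrt_cst.
apply: measurable_wrtM => //; last exact: measurable_wrt_cst.
apply: (adapted_le hF (el_time_ge0' phi i)); last exact: el_coef_meas.
by apply: (sepi (ltnW (ltn_ord i))).
Qed.

Lemma el_val_step k (s : R) w : (k < N)%N -> tau k < s <= tau k.+1 ->
  el_val phi s w = el_val phi (tau k.+1) w.
Proof.
move=> kN ks; apply: eq_bigr => i _; congr (_ * _).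
by apply: (indic_separated kN _ _ ks); apply: sepi => //; exact: ltnW.
Qed.

(** The integral up to [s] is written on a subdivision of the larger interval [0, t], with the later
    coefficients set to zero. Integrals up to two different times thereby share one subdivision, as
    the isometry requires. *)
Lemma el_integralE (s : R) w : 0 <= s <= t -> separates tau N s ->
  el_integral phi s w =
  stoch_sum B tau (fun k w => el_val phi (tau k.+1) w * (tau k.+1 <= s)%R%:R) N w.
Proof.
move=> /andP[s0 st] seps.
have sepm i : (i <= el_size phi)%N -> separates tau N (Num.min (el_time phi i) s).
  by move=> ile; case: (leP (el_time phi i) s) => _; [exact: sepi|].
rewrite /stoch_sum; under eq_bigr do rewrite /el_val mulr_suml mulr_suml.
rewrite exchange_big /=; apply: eq_bigr => i _.
have ui : 0 <= Num.min (el_time phi i) s by rewrite le_min el_time_ge0'.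
have uv : Num.min (el_time phi i) s <= Num.min (el_time phi i.+1) s.
  by rewrite le_min !ge_min lexx el_time_le orbT.
have := @sum_indic_increments _ _ _ _ sub (fun x => B x w) _ _ ui uv
  (sepm _ (ltnW (ltn_ord i))) (sepm _ (ltn_ord i)).
have mt x : Num.min (Num.min x s) t = Num.min x s.
  by apply/min_idPl; rewrite ge_min st orbT.
rewrite !mt => <-; rewrite mulr_sumr; apply: eq_bigr => k _.
rewrite -!mulrA; congr (_ * _); rewrite mulrA; congr (_ * _).
rewrite !indicE !mem_setE !in_itv /= -natrM mulnb; congr (nat_of_bool _)%:R.
rewrite gt_min le_min; case: (leP (tau k.+1) s) => ks; rewrite ?andbF//= ?orbF ?andbT//.
Qed.

End on_subdivision.

Lemma el_integral_same phi tau N (t : R) w : subdivision tau N t ->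
  (forall x, x \in breakpoints phi -> separates tau N x) -> 
  el_integral phi t w = stoch_sum B tau (fun k => el_val phi (tau k.+1)) N w.
Proof.
move=> sub sep; have [E0 EN le] := sub.
have tt : forall k, (k <= N)%N -> tau k <= t.
  move=> k kN; rewrite -EN -(subnKC kN); elim: (N - k)%N => [|m IH]; rewrite ?addn0// addnS.
  exact: le_trans (le _).
have t0 : 0 <= t by rewrite -E0 tt.
rewrite (el_integralE sub sep); last 2 first.
- by rewrite t0 lexx.
- by move=> k kN tk; have := lt_le_trans tk (tt _ kN); rewrite ltxx.
by apply: eq_bigr => k _; rewrite tt ?mulr1.
Qed.

(** On a subdivision separating the breakpoints of both processes, l times their difference is a
    single discrete integrand, to which [exp_martingale] applies. *)
Lemma el_exp_martingale phi psi (l t : R) : 0 <= t ->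
  (\int[P]_w (expR (l * (el_integral phi t w - el_integral psi t w) - l ^+ 2 / 2 *
     \int[mu]_(s in `[0%R, t]) ((el_val phi s w - el_val psi s w) ^+ 2)))%:E = 1)%E.
Proof.
move=> t0.
have [tau [N [sub sep]]] := subdivision_exists (breakpoints phi ++ breakpoints psi) t0.
have sep1 x : x \in breakpoints phi -> separates tau N x.
  by move=> xp; apply: sep; rewrite mem_cat xp.
have sep2 x : x \in breakpoints psi -> separates tau N x.
  by move=> xp; apply: sep; rewrite mem_cat xp orbT.
have [E0 EN le] := sub.
have tau_ge0 i : 0 <= tau i.
  by elim: i => [|i IH]; [rewrite E0|exact: le_trans (le i)].
pose V k w := l * (el_val phi (tau k.+1) w - el_val psi (tau k.+1) w).
have aV : step_adapted F tau N V.
  move=> k kN; have sF := filtration_sigma hF (tau_ge0 k).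
  apply: measurable_wrtM => //; first exact: measurable_wrt_cst.
  by apply: measurable_wrtB => //; [exact: (el_val_adapted sub sep1)|exact: (el_val_adapted sub sep2)].
rewrite -(exp_martingale hF hB (tau_ge0 0%N) le aV (leqnn N)).
apply: eq_integral => w _; congr (expR _)%:E; congr (_ - _).
  rewrite (el_integral_same w sub sep1) (el_integral_same w sub sep2).
  rewrite /stoch_sum -sumrB mulr_sumr; apply: eq_bigr => k _.
  by rewrite /V; ring.
rewrite /Rintegral (integral_step_function sub) /=; first last.
- move=> k s kN ks; rewrite (el_val_step sep1 w kN ks).
  by rewrite (el_val_step sep2 w kN ks).
- by move=> s; exact: sqr_ge0.
- by apply: measurable_funX; apply: measurable_funB; exact: measurable_el_val.
rewrite /quad_sum mulr_sumr mulr_suml; apply: eq_bigr => k _.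
by rewrite /V; field.
Qed.

Definition L2_coef phi := forall i, (i < el_size phi)%N -> L2 P (el_coef phi i).

Lemma L2_el_val phi (s : R) : L2_coef phi -> L2 P (el_val phi s).
Proof.
move=> jc; apply: L2_sum => i _.
under [X in L2 _ X]eq_fun do rewrite mulrC.
by apply: L2Z; exact: jc.
Qed.

Let prepare phi (s r : R) : 0 <= s <= r -> exists tau N, subdivision tau N r /\
  [/\ forall x, x \in breakpoints phi -> separates tau N x, separates tau N s,
   step_adapted F tau N (fun k w => el_val phi (tau k.+1) w * (tau k.+1 <= s)%R%:R),
   step_adapted F tau N (fun k => el_val phi (tau k.+1)) & 0 <= tau 0%N].
Proof.
move=> /andP[s0 sr]; have r0 := le_trans s0 sr.
have [tau [N [sub sep]]] := subdivision_exists (s :: breakpoints phi) r0.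
have sep1 x : x \in breakpoints phi -> separates tau N x.
  by move=> xp; apply: sep; rewrite inE xp orbT.
exists tau, N; split => //.
have [E0 EN le] := sub.
have tau_ge0 i : 0 <= tau i.
  by elim: i => [|i IH]; [rewrite E0|exact: le_trans (le i)].
split => //; first by apply: sep; rewrite inE eqxx.
- move=> k kN; have sF := filtration_sigma hF (tau_ge0 k).
  apply: measurable_wrtM => //; last exact: measurable_wrt_cst.
  exact: (el_val_adapted sub sep1).
- by move=> k kN; exact: (el_val_adapted sub sep1).
Qed.

Lemma el_integral_L2 phi (t : R) : 0 <= t -> L2_coef phi -> L2 P (el_integral phi t).
Proof.
move=> t0 jc; have [|tau [N [sub [sep seps a1 a2 tau0]]]] := @prepare phi t t; first by rewrite t0 lexx.
have [_ _ le] := sub.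
rewrite (_ : el_integral phi t = stoch_sum B tau (fun k => el_val phi (tau k.+1)) N); last first.
  by apply/funext => w; exact: el_integral_same.
by apply: (stoch_sum_L2 hF hB tau0 le a2) => // i _; exact: L2_el_val.
Qed.

Lemma el_integral_mean0 phi (t : R) : 0 <= t -> L2_coef phi -> EE P (el_integral phi t) = 0.
Proof.
move=> t0 jc; have [|tau [N [sub [sep seps a1 a2 tau0]]]] := @prepare phi t t; first by rewrite t0 lexx.
have [_ _ le] := sub.
rewrite (_ : el_integral phi t = stoch_sum B tau (fun k => el_val phi (tau k.+1)) N); last first.
  by apply/funext => w; exact: el_integral_same.
by apply: (stoch_sum_mean0 hF hB tau0 le a2) => // i _; exact: L2_el_val.
Qed.

Lemma el_integral_isometry phi (s r : R) : 0 <= s <= r -> L2_coef phi ->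
  ((EE P (fun w => el_integral phi s w * el_integral phi r w))%:E =
   \int[P]_w \int[mu]_(u in `[0%R, s]) (el_val phi u w ^+ 2)%:E)%E.
Proof.
move=> sr jc; have [tau [N [sub [sep seps a1 a2 tau0]]]] := @prepare phi s r sr.
have [_ _ le] := sub; have /andP[s0 sler] := sr.
have jV i : (i < N)%N -> L2 P (fun w => el_val phi (tau i.+1) w * (tau i.+1 <= s)%R%:R).
  move=> _; under [X in L2 _ X]eq_fun do rewrite mulrC.
  by apply: L2Z; exact: L2_el_val.
have jW i : (i < N)%N -> L2 P (el_val phi (tau i.+1)) by move=> _; exact: L2_el_val.
have := stoch_sum_isometry hF hB tau0 le a1 a2 jV jW (leqnn N).
rewrite (_ : (fun w => _) = (fun w => el_integral phi s w * el_integral phi r w)); last first.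
  apply/funext => w; rewrite (el_integralE sub sep _ sr seps).
  by rewrite (el_integral_same w sub sep).
move=> ->; rewrite -EE_EFin; last first.
  apply: L1_sum => k _; under [X in L1 _ X]eq_fun do rewrite mulrC.
  by apply: L1Z; apply: L2M; [exact: jV|exact: jW].
apply: eq_integral => w _.
rewrite -(@integral_step_function _ _ _ _ sub (fun u => el_val phi u w * (u <= s)%R%:R * el_val phi u w)); first last.
- move=> k u kN ku; rewrite (el_val_step sep w kN ku).
  congr (_ * _%:R * _); congr nat_of_bool; have /andP[ku1 ku2] := ku.
  apply/idP/idP; last exact: le_trans.
  move=> us; rewrite leNgt; apply/negP => /(seps _ kN) sk.
  by have := lt_le_trans (le_lt_trans sk ku1) us; rewrite ltxx.
- by move=> u; rewrite mulrAC mulr_ge0// -expr2 sqr_ge0.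
- apply: measurable_funM; last exact: measurable_el_val.
  apply: measurable_funM; first exact: measurable_el_val.
  rewrite (_ : (fun u => _) = \1_(`]-oo, s]%classic : set R)); first exact: measurable_indic.
  by apply/funext => u; rewrite indicE mem_setE in_itv.
rewrite integral_mkcond [RHS]integral_mkcond; apply: eq_integral => u _.
rewrite /patch !mem_setE !in_itv /=; case: (leP 0 u) => //= u0.
case: (leP u s) => us; last by rewrite mulr0 mul0r; case: ifP.
by rewrite (le_trans us)// mulr1 expr2.
Qed.

End elementary_integrand.

(** * Exponential bounds for Ito integrals *)

Section fatou_bound.
Context {d : measure_display} {T : measurableType d} {R : realType}.
Variable mu : {measure set T -> \bar R}.

Lemma fatou_le (f : nat -> T -> R) (g : T -> R) (C : \bar R) :
  (forall n, measurable_fun setT (f n)) -> (forall n x, 0 <= f n x) ->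
  (forall x, f n x @[n --> \oo] --> g x) ->
  (forall n, (\int[mu]_x (f n x)%:E <= C)%E) -> (\int[mu]_x (g x)%:E <= C)%E.
Proof.
move=> mf f0 fg fC.
have mEf n : measurable_fun setT (fun x => (f n x)%:E) by exact: measurableT_comp.
have fE0 n x : setT x -> (0 <= (f n x)%:E)%E by rewrite lee_fin.
have := fatou mu measurableT mEf fE0.
rewrite (_ : (fun x => _) = (fun x => (g x)%:E)); last first.
  apply/funext => x; have h : (f n x)%:E @[n --> \oo] --> (g x)%:E.
    by apply: cvg_EFin; [exact: nearW|exact: fg].
  by rewrite (cvg_limn_einf_sup h).
move/le_trans; apply.
rewrite limn_einf_lim; apply: lime_le; first exact: is_cvg_einfs.
apply: nearW => n; apply: le_trans (fC n).
by apply: ereal_inf_lbound; exists n => /=.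
Qed.

End fatou_bound.

(** * From exponential bounds to second moments *)

Section cosh_bound.
Context {d : measure_display} {T : measurableType d} {R : realType}.
Variable P : probability T R.

(** The exponentials at l and -l together dominate l^2 U^2 damped by e^(-l^2 D). Dividing by l^2
    bounds the damped second moment uniformly in l, and Fatou's lemma removes the damping. *)
Lemma exp_supermartingale_sqr (U D : T -> R) : measurable_fun setT U -> L1 P D ->
  (forall w, 0 <= D w) ->
  (forall l : R, (\int[P]_w (expR (l * U w - l ^+ 2 * D w))%:E <= 1)%E) ->
  L2 P U /\ EE P (fun w => U w ^+ 2) <= 2 * EE P D.
Proof.
move=> mU jD D0 H; have mD := L1_meas jD.
have mexp (l : R) : measurable_fun setT (fun w => expR (l * U w - l ^+ 2 * D w)).
  by apply: measurableT_comp => //; apply: measurable_funB; apply: measurable_funM.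
have jexp (l : R) : L1 P (fun w => expR (l * U w - l ^+ 2 * D w)).
  by apply: (L1_ge0 (mexp l) _ (H l)) => w; exact: expR_ge0.
have EEexp (l : R) : EE P (fun w => expR (l * U w - l ^+ 2 * D w)) <= 1.
  by rewrite -lee_fin -EE_EFin.
have mUe (l : R) : measurable_fun setT (fun w => U w ^+ 2 * expR (- (l ^+ 2 * D w))).
  apply: measurable_funM; first exact: measurable_funX.
  by apply: measurableT_comp => //; apply: measurableT_comp => //; exact: measurable_funM.
(* [cosh_lower] is multiplied by e^(-l^2 D), and the loss 2 (1 - e^(-l^2 D)) in the constant term is
   at most 2 l^2 D; this is where the factor 2 in front of E D comes from. *)
have key (l : R) w : 2 + l ^+ 2 * (U w ^+ 2 * expR (- (l ^+ 2 * D w))) <=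
    (expR (l * U w - l ^+ 2 * D w) + expR (- l * U w - (- l) ^+ 2 * D w)) + 2 * l ^+ 2 * D w.
  rewrite sqrrN mulNr !expRD -mulrDl.
  have h1 := cosh_lower (l * U w); rewrite exprMn in h1.
  have h2 := expR_ge1Dx (- (l ^+ 2 * D w)).
  have h3 := ler_wpM2r (expR_ge0 (- (l ^+ 2 * D w))) h1.
  move: h2 h3; set e := expR (- _); set c := expR _ + expR _ => h2 h3.
  have -> : 2 * l ^+ 2 * D w = 2 * (l ^+ 2 * D w) by ring.
  have e1 : (2 + l ^+ 2 * U w ^+ 2) * e = 2 * e + l ^+ 2 * (U w ^+ 2 * e) by ring.
  by rewrite e1 in h3; lra.
have jUe (l : R) : l != 0 -> L1 P (fun w => U w ^+ 2 * expR (- (l ^+ 2 * D w))).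
  move=> l0; have l2 : 0 < l ^+ 2 by rewrite exprn_even_gt0.
  apply: (@L1_le _ _ _ _ _ (fun w => (l ^+ 2)^-1 * ((expR (l * U w - l ^+ 2 * D w) +
     expR (- l * U w - (- l) ^+ 2 * D w)) + 2 * l ^+ 2 * D w))) => //.
  - move=> w; rewrite ger0_norm; last by apply: mulr_ge0; [exact: sqr_ge0|exact: expR_ge0].
    by rewrite ler_pdivlMl//; have := key l w; lra.
  - by apply: L1Z; apply: L1D; [exact: L1D|exact: L1Z].
have bound (l : R) : l != 0 -> EE P (fun w => U w ^+ 2 * expR (- (l ^+ 2 * D w))) <= 2 * EE P D.
  move=> l0; have l2 : 0 < l ^+ 2 by rewrite exprn_even_gt0.
  have := EE_le (L1D (L1_cst P 2) (L1Z (l ^+ 2) (jUe l l0)))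
    (L1D (L1D (jexp l) (jexp (- l))) (L1Z (2 * l ^+ 2) jD)) (key l).
  rewrite EED; [|exact: L1_cst|by apply: L1Z; exact: jUe].
  rewrite EED; [|exact: L1D|exact: L1Z].
  rewrite EED// EE_cst !EEZ//; last exact: jUe.
  move=> h; rewrite -(ler_pM2l l2); have := EEexp l; have := EEexp (- l); lra.
have fin : (\int[P]_w (U w ^+ 2)%:E <= (2 * EE P D)%:E)%E.
  apply: (@fatou_le _ _ _ P (fun n w => U w ^+ 2 * expR (- (n.+1%:R^-1 ^+ 2 * D w)))) => //.
  - by move=> n w; apply: mulr_ge0; [exact: sqr_ge0|exact: expR_ge0].
  - move=> w; have h : (- (n.+1%:R^-1 ^+ 2 * D w) : R) @[n --> \oo] --> (0 : R).
      rewrite [X in _ --> X](_ : 0 = - (0 ^+ 2 * D w)); last by rewrite expr0n mul0r oppr0.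
      apply: cvgN; apply: cvgM; last exact: cvg_cst.
      exact: (cvg_comp _ _ (@cvg_harmonic R) (@exprn_continuous R 2 0)).
    rewrite [X in _ --> X](_ : _ = U w ^+ 2 * expR 0); last by rewrite expR0 mulr1.
    apply: cvgM; first exact: cvg_cst.
    exact: (cvg_comp _ _ h (@continuous_expR R 0)).
  - move=> n; rewrite EE_EFin; last by apply: jUe; rewrite gt_eqF.
    by rewrite lee_fin; apply: bound; rewrite gt_eqF.
have jU2 : L1 P (fun w => U w ^+ 2).
  by apply: L1_ge0 fin => [|w]; [exact: measurable_funX|exact: sqr_ge0].
by split; [split|rewrite -lee_fin -EE_EFin].
Qed.

End cosh_bound.

(** * Passage to the limit in probability *)

Section ito_limit.
Context {d : measure_display} {Omega : measurableType d} {R : realType}.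
Variables (P : probability Omega R) (F : R -> set (set Omega)) (B : R -> Omega -> R).
Hypotheses (hF : filtration F) (hB : brownian_motion P F B).
Local Notation mu := (@lebesgue_measure R).

(* The integrand is jointly measurable and pathwise bounded on [0, t], so that
   all the time integrals below are real numbers. *)
Variables (H : R -> Omega -> R) (t : R).
Hypotheses (t0 : 0 <= t)
  (mH : measurable_fun setT (fun p : R * Omega => H p.1 p.2))
  (bH : forall w, exists C : R, forall s : R, 0 <= s <= t -> `|H s w| <= C).

Definition sqdist (phi : elementary F) (w : Omega) : R :=
  \int[mu]_(s in `[0, t]) ((el_val phi s w - H s w) ^+ 2).

Definition ito_limit (M : Omega -> R) : Prop :=
  exists phi : nat -> elementary F, forall e : R, 0 < e ->
    P [set w | e <= sqdist (phi n) w] @[n --> \oo] --> 0%E /\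
    P [set w | e <= `|el_integral B (phi n) t w - M w|] @[n --> \oo] --> 0%E.

Lemma measurable_section w : measurable_fun setT (H ^~ w).
Proof. exact: (measurable_fun_pair1 w mH). Qed.

Lemma el_coef_measurable (phi : elementary F) i : measurable_fun setT (el_coef phi i).
Proof. exact: (adapted_meas hF (el_time_ge0' phi i) (el_coef_meas phi i)). Qed.

Lemma measurable_el_val_joint (phi : elementary F) :
  measurable_fun setT (fun p : R * Omega => el_val phi p.1 p.2).
Proof.
apply: measurable_sum => i; apply: measurable_funM.
- by apply: measurableT_comp => //; exact: el_coef_measurable.
- by apply: measurableT_comp => //.
Qed.

Lemma el_val_bounded (phi : elementary F) w : exists C : R, forall s : R, `|el_val phi s w| <= C.
Proof.
exists (\sum_(i < el_size phi) `|el_coef phi i w|) => s.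
apply: (le_trans (ler_norm_sum _ _ _)); apply: ler_sum => i _.
by rewrite normrM ler_piMr// indicE; case: (_ \in _); rewrite ?normr1 ?normr0.
Qed.

Lemma integrable_bounded_itv (f : R -> R) (C : R) : measurable_fun setT f ->
  (forall s, 0 <= s <= t -> `|f s| <= C) -> mu.-integrable `[0, t] (EFin \o f).
Proof.
move=> mf fC; apply: measurable_bounded_integrable => //.
- by rewrite /= lebesgue_measure_itv /= lte_fin; case: ifP => // _; rewrite -EFinD ltry.
- exact: measurable_funTS.
- exists C; split; first by rewrite num_real.
  move=> x Cx s /=; rewrite in_itv /= => /fC h; exact: le_trans h (ltW Cx).
Qed.

Lemma norm_sqrB_le (x y C1 C2 : R) : `|x| <= C1 -> `|y| <= C2 ->
  `|(x - y) ^+ 2| <= (C1 + C2) ^+ 2.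
Proof.
move=> xC yC; rewrite normrX.
have h : `|x - y| <= C1 + C2 by rewrite (le_trans (ler_normB _ _))// lerD.
by rewrite lerXn2r ?nnegrE ?(le_trans _ h).
Qed.

Lemma sqdist_integrable (phi : elementary F) w :
  mu.-integrable `[0, t] (EFin \o (fun s => (el_val phi s w - H s w) ^+ 2)).
Proof.
have [C1 h1] := el_val_bounded phi w; have [C2 h2] := bH w.
apply: (@integrable_bounded_itv _ ((C1 + C2) ^+ 2)).
- apply: measurable_funX; apply: measurable_funB; first exact: measurable_el_val.
  exact: measurable_section.
- by move=> s st; apply: norm_sqrB_le; [exact: h1|exact: h2].
Qed.

Lemma sqdist_ge0 phi w : 0 <= sqdist phi w.
Proof. by apply: Rintegral_ge0 => s _; exact: sqr_ge0. Qed.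

Lemma measurable_time_integral (f : R * Omega -> R) : measurable_fun setT f ->
  (forall p, 0 <= f p) ->
  measurable_fun setT (fun w => (\int[mu]_(s in `[0%R, t]) (f (s, w))%:E)%E).
Proof.
move=> mf f0.
pose g (p : R * Omega) : \bar R := (\1_(`[0, t]%classic : set R) p.1 * f p)%:E.
have mg : measurable_fun setT g.
  apply: measurableT_comp => //; apply: measurable_funM => //.
  exact: measurableT_comp.
have := @measurable_fun_fubini_tonelli_G _ _ _ _ R mu g mg _.
rewrite (_ : fubini_G _ _ = fun w => (\int[mu]_(s in `[0%R, t]) (f (s, w))%:E)%E); last first.
  apply/funext => w; rewrite /fubini_G [RHS]integral_mkcond; apply: eq_integral => s _.
  rewrite /g /patch indicE; case: ifP => _; rewrite /= ?mul1r ?mul0r//.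
by apply => p; rewrite lee_fin mulr_ge0.
Qed.

Lemma measurable_sqdist phi : measurable_fun setT (sqdist phi).
Proof.
apply: measurableT_comp => //.
apply: (measurable_time_integral (f := fun p => (el_val phi p.1 p.2 - H p.1 p.2) ^+ 2)).
- by apply: measurable_funX; apply: measurable_funB => //; exact: measurable_el_val_joint.
- by move=> p; exact: sqr_ge0.
Qed.

Lemma measurable_el_integral phi : measurable_fun setT (el_integral (F := F) B phi t).
Proof.
apply: measurable_sum => i; apply: measurable_funM; first exact: el_coef_measurable.
by apply: measurable_funB; apply: (brownian_meas hF hB); rewrite le_min t0 el_time_ge0'.
Qed.

(** Multiplied by l^2 / 2, the right-hand side is l^2 times the two distances to [H]: the one of
    [psi] is the compensator in [ito_exp_bound], and the one of the approximating process vanishes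
    in the limit. *)
Lemma sqdist_triangle phi psi w :
  \int[mu]_(s in `[0, t]) ((el_val phi s w - el_val psi s w) ^+ 2) <=
  2 * sqdist phi w + 2 * sqdist psi w.
Proof.
have i1 := sqdist_integrable phi w; have i2 := sqdist_integrable psi w.
have iZ (f : R -> R) : mu.-integrable `[0, t] (EFin \o f) ->
    mu.-integrable `[0, t] (EFin \o (fun s => 2 * f s)).
  by move=> jf; under [_ \o _]eq_fun do rewrite /= EFinM; exact: integrableZl.
rewrite -!RintegralZl// -RintegralD//; [|exact: iZ|exact: iZ].
apply: le_Rintegral => //.
- have [C1 h1] := el_val_bounded phi w; have [C2 h2] := el_val_bounded psi w.
  apply: (@integrable_bounded_itv _ ((C1 + C2) ^+ 2)).
    by apply: measurable_funX; apply: measurable_funB; exact: measurable_el_val.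
  by move=> s st; apply: norm_sqrB_le; [exact: h1|exact: h2].
- by under [_ \o _]eq_fun do rewrite /= EFinD; apply: integrableD => //; exact: iZ.
- move=> s _; set x := el_val phi s w; set y := el_val psi s w; set z := H s w.
  by have := sqr_ge0 (x + y - 2 * z); nra.
Qed.

Lemma measurable_ge_set (f : Omega -> R) (e : R) : measurable_fun setT f ->
  measurable [set w | e <= f w].
Proof.
move=> mf; rewrite (_ : [set _ | _] = f @^-1` `[e, +oo[%classic).
  by rewrite -[X in measurable X]setTI; exact: mf.
by apply/seteqP; split => w /=; rewrite in_itv /= andbT.
Qed.

(** Convergence holds only in probability, so the exponential is first truncated at a level K: on
    the two small bad events it costs at most K, and elsewhere it is close to an exponential of mean
    one. The truncation is removed at the end by Fatou's lemma, without extracting an almost surely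
    convergent subsequence. *)
Lemma ito_exp_bound (M : Omega -> R) (psi : elementary F) (l : R) :
  measurable_fun setT M -> ito_limit M ->
  (\int[P]_w (expR (l * (M w - el_integral B psi t w) - l ^+ 2 * sqdist psi w))%:E <= 1)%E.
Proof.
move=> mM [phi cphi].
have mI n := measurable_el_integral n; have mD n := measurable_sqdist n.
pose G w := l * (M w - el_integral B psi t w) - l ^+ 2 * sqdist psi w.
have mG : measurable_fun setT (fun w => expR (G w)).
  apply: measurableT_comp => //; apply: measurable_funB; apply: measurable_funM => //.
  exact: measurable_funB.
pose U n w := l * (el_integral B (phi n) t w - el_integral B psi t w) - l ^+ 2 / 2 *
     \int[mu]_(s in `[0, t]) ((el_val (phi n) s w - el_val psi s w) ^+ 2).
have intU n : (\int[P]_w (expR (U n w))%:E = 1)%E.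
  exact: (el_exp_martingale hF hB (phi n) psi l t0).
have mU n : measurable_fun setT (fun w => expR (U n w)).
  apply: measurableT_comp => //; apply: measurable_funB; apply: measurable_funM => //.
    exact: measurable_funB.
  apply: measurableT_comp => //.
  apply: (measurable_time_integral (f := fun p => (el_val (phi n) p.1 p.2 - el_val psi p.1 p.2) ^+ 2)).
  - by apply: measurable_funX; apply: measurable_funB; exact: measurable_el_val_joint.
  - by move=> p; exact: sqr_ge0.
have jU n : L1 P (fun w => expR (U n w)).
  by apply: (@L1_ge0 _ _ _ _ _ 1) => //; rewrite intU.
have EU n : EE P (fun w => expR (U n w)) = 1.
  by apply: EFin_inj; rewrite -EE_EFin.
pose A1 (e : R) n := [set w | e <= sqdist (phi n) w].
pose A2 (e : R) n := [set w | e <= `|el_integral B (phi n) t w - M w|].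
have mA1 e n : measurable (A1 e n).
  exact: measurable_ge_set.
have mA2 e n : measurable (A2 e n).
  by apply: measurable_ge_set; apply: measurableT_comp => //; exact: measurable_funB.
have jA A : measurable A -> L1 P (\1_A : Omega -> R) by exact: integrable_indic.
have EA A : measurable A -> (EE P (\1_A : Omega -> R))%:E = P A.
  by move=> mA; rewrite -EE_EFin ?integral_indic ?setIT//; exact: jA.
(* Off [A1] and [A2] the exponent [G] exceeds that of [U n] by at most |l| e, from the integrals,
   plus l^2 e, from the distance. *)
pose c := `|l| + l ^+ 2.
have bound (K e : R) n : 0 <= K -> 0 < e -> EE P (fun w => Num.min (expR (G w)) K) <=
    expR (c * e) + K * fine (P (A1 e n)) + K * fine (P (A2 e n)).
  move=> K0 e0; rewrite -!EA//=.
  rewrite -[X in X + _ + _]mulr1 -(EU n) -!EEZ//; [|exact: jA..].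
  rewrite -EED; [|exact: L1Z|by apply: L1Z; exact: jA].
  rewrite -EED; [|by apply: L1D; apply: L1Z => //; exact: jA|by apply: L1Z; exact: jA].
  apply: EE_le.
  - apply: (@L1_le _ _ _ _ _ (fun=> K)); [|move=> w|exact: L1_cst].
      exact: measurable_minr.
    by rewrite ger0_norm ?ge_min ?lexx ?orbT// le_min expR_ge0.
  - by do 2 (apply: L1D; last by apply: L1Z; exact: jA); exact: L1Z.
  move=> w; rewrite !indicE.
  have e1 := expR_ge0 (c * e); have e2 := expR_ge0 (U n w).
  have e3 : 0 <= expR (c * e) * expR (U n w) by exact: mulr_ge0.
  have minK : Num.min (expR (G w)) K <= K by rewrite ge_min lexx orbT.
  case: (boolP (w \in A1 e n)) => [_|]; first by case: (_ \in _) => /=; lra.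
  rewrite notin_setE /A1 /= => /negP; rewrite -ltNge => h1.
  case: (boolP (w \in A2 e n)) => [_|]; first by rewrite /=; lra.
  rewrite notin_setE /A2 /= => /negP; rewrite -ltNge => h2.
  rewrite !mulr0 !addr0 -expRD ge_min ler_expR; apply/orP; left.
  have h3 := sqdist_triangle (phi n) psi w.
  have l20 := sqr_ge0 l.
  have h4 : l ^+ 2 * \int[mu]_(s in `[0, t]) ((el_val (phi n) s w - el_val psi s w) ^+ 2) <=
     l ^+ 2 * (2 * sqdist (phi n) w + 2 * sqdist psi w) by exact: ler_wpM2l.
  have h5 : l ^+ 2 * sqdist (phi n) w <= l ^+ 2 * e by rewrite ler_wpM2l// ltW.
  have h6 : l * (M w - el_integral B (phi n) t w) <= `|l| * e.
    by rewrite (le_trans (ler_norm _))// normrM ler_wpM2l// distrC ltW.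
  by rewrite /G /U /c; lra.
have minbound (K : R) : 0 <= K -> EE P (fun w => Num.min (expR (G w)) K) <= 1.
  (* All errors are linear in e: e^(c e) - 1 <= c e e^c for e <= 1, and each bad event has
     probability at most e once n is large. *)
  move=> K0; apply: (@le_small _ _ _ (c * expR c + 2 * K)) => e /andP[e0 e1].
  have [c1 c2] := cphi e e0.
  have fin (A : nat -> set Omega) : (forall n, measurable (A n)) -> P (A n) @[n --> \oo] --> 0%E ->
      \forall n \near \oo, fine (P (A n)) <= e.
    move=> mA /fine_cvgP[_ /cvgrPdist_le /(_ e e0)].
    apply: filterS => n /=; rewrite sub0r normrN; apply: le_trans; exact: ler_norm.
  have [n [n1 n2]] : exists n, fine (P (A1 e n)) <= e /\ fine (P (A2 e n)) <= e.
    have [N1 _ H1] := fin _ (mA1 e) c1; have [N2 _ H2] := fin _ (mA2 e) c2.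
    by exists (maxn N1 N2); split; [apply: H1; exact: leq_maxl|apply: H2; exact: leq_maxr].
  apply: (le_trans (bound K e n K0 e0)).
  have c0 : 0 <= c by rewrite addr_ge0// sqr_ge0.
  have h1 := ler_wpM2l K0 n1; have h2 := ler_wpM2l K0 n2.
  have h3 : expR (c * e) - 1 <= c * e * expR c.
    by apply: expR_upper; rewrite mulr_ge0 ?(ltW e0)//= ler_piMr.
  by lra.
rewrite -/(G _).
apply: (@fatou_le _ _ _ P (fun n w => Num.min (expR (G w)) n%:R)).
- by move=> n; exact: measurable_minr.
- by move=> n w; rewrite le_min expR_ge0 ler0n.
- move=> w; apply: cvg_near_cst; near=> n; apply/min_idPl.
  near: n; exact: nbhs_infty_ger.
- move=> n; rewrite EE_EFin ?lee_fin ?minbound ?ler0n//.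
  apply: (@L1_le _ _ _ _ _ (fun=> n%:R)); [|move=> w|exact: L1_cst].
    exact: measurable_minr.
  by rewrite ger0_norm ?ge_min ?lexx ?orbT// le_min expR_ge0 ler0n.
Unshelve. all: by end_near.
Qed.

Lemma ito_sqr_bound (M : Omega -> R) (psi : elementary F) :
  measurable_fun setT M -> ito_limit M -> L1 P (sqdist psi) ->
  L2 P (fun w => M w - el_integral B psi t w) /\
  EE P (fun w => (M w - el_integral B psi t w) ^+ 2) <= 2 * EE P (sqdist psi).
Proof.
move=> mM cM jD; apply: exp_supermartingale_sqr => //.
- by apply: measurable_funB => //; exact: measurable_el_integral.
- by move=> w; exact: sqdist_ge0.
- by move=> l; exact: ito_exp_bound.
Qed.

End ito_limit.

(** * Limits and time integrals of expectations *)

Section continuous_paths.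
Context {R : realType}.
Local Notation mu := (@lebesgue_measure R).

Lemma continuous_bounded_itv (f : R -> R) (a b : R) : continuous f ->
  exists2 C : R, 0 <= C & forall s : R, a <= s <= b -> `|f s| <= C.
Proof.
move=> cf; case: (leP a b) => ab; last first.
  by exists 0 => // s /andP[/le_trans h /h]; rewrite leNgt ab.
have cnf : {within `[a, b], continuous (fun x => `|f x|)}.
  by apply: continuous_subspaceT => x; apply: cvg_norm; exact: cf.
have [c _ H] := EVT_max ab cnf.
by exists `|f c| => // s sab; apply: H; rewrite in_itv.
Qed.

Lemma continuous_integrable_itv (f : R -> R) (a b : R) : continuous f ->
  mu.-integrable `[a, b] (EFin \o f).
Proof.
move=> cf; apply: continuous_compact_integrable; first exact: segment_compact.
exact: continuous_subspaceT.
Qed.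

Lemma continuous_measurable (f : R -> R) : continuous f -> measurable_fun setT f.
Proof. exact: continuous_measurable_fun. Qed.

End continuous_paths.

Section L2_limits.
Context {d : measure_display} {Omega : measurableType d} {R : realType}.
Variable P : probability Omega R.

(** Bounded second moments give uniform integrability: |Y| <= min(|Y|, c) + Y^2 / c, where the
    truncated part tends to 0 by dominated convergence. *)
Lemma L1_convergence (Y : nat -> Omega -> R) (K : R) :
  (forall n, L2 P (Y n)) -> (forall n, EE P (fun w => Y n w ^+ 2) <= K) ->
  (forall w, Y n w @[n --> \oo] --> (0 : R)) ->
  EE P (fun w => `|Y n w|) @[n --> \oo] --> (0 : R).
Proof.
move=> jY YK Y0.
have jmin (c : R) n : 0 <= c -> L1 P (fun w => Num.min `|Y n w| c).
  move=> c0; apply: (@L1_le _ _ _ _ _ (fun=> c)); [|move=> w|exact: L1_cst].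
    by apply: measurable_minr => //; apply: measurableT_comp => //; exact: (jY n).1.
  by rewrite ger0_norm ?ge_min ?lexx ?orbT// le_min normr_ge0.
have K0 : 0 <= K by apply: le_trans (YK 0%N); apply: EE_ge0 => w; exact: sqr_ge0.
have split_bound (c : R) n : 0 < c -> EE P (fun w => `|Y n w|) <=
    EE P (fun w => Num.min `|Y n w| c) + c^-1 * K.
  move=> c0; apply: (@le_trans _ _ (EE P (fun w => Num.min `|Y n w| c) + c^-1 * EE P (fun w => Y n w ^+ 2))).
    rewrite -EEZ; last exact: (jY n).2.
    rewrite -EED; [|by apply: jmin; exact: ltW|by apply: L1Z; exact: (jY n).2].
    apply: EE_le.
    - by apply: L1_abs; exact: L2_L1.
    - by apply: L1D; [apply: jmin; exact: ltW|apply: L1Z; exact: (jY n).2].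
    move=> w; have q0 : 0 <= c^-1 * Y n w ^+ 2 by apply: mulr_ge0; [rewrite invr_ge0 ltW|exact: sqr_ge0].
    case: (leP `|Y n w| c) => yc; first by rewrite lerDl.
    rewrite (@le_trans _ _ (c^-1 * Y n w ^+ 2)) ?lerDr ?(ltW c0)//.
    by rewrite ler_pdivlMl// -[Y n w ^+ 2]real_normK ?num_real// expr2 ler_wpM2r// ltW.
  by rewrite lerD2l ler_wpM2l// invr_ge0 ltW.
have mincvg (c : R) : 0 < c -> EE P (fun w => Num.min `|Y n w| c) @[n --> \oo] --> (0 : R).
  move=> c0; have c0' := ltW c0.
  have := @dominated_cvg _ _ _ P setT measurableT (fun n w => (Num.min `|Y n w| c)%:E) (fun=> 0%E) (fun=> c%:E).
  move=> H.
  have {}H : (\int[P]_w (Num.min `|Y n w| c)%:E)%E @[n --> \oo] --> (\int[P]_w 0)%E.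
    apply: H.
    - by move=> n; exact: (measurable_int _ (jmin c n c0')).
    - move=> w _; apply: cvg_EFin; first exact: nearW.
      apply/cvgrPdist_le => e e0.
      have /cvgrPdist_le /(_ e e0) := Y0 w; apply: filterS => n.
      rewrite !sub0r !normrN => h; rewrite ger0_norm ?le_min ?normr_ge0//.
      by rewrite ge_min h.
    - by [].
    - exact: finite_measure_integrable_cst.
    - move=> n w _; rewrite lee_fin ger0_norm ?ge_min ?lexx ?orbT//.
      by rewrite le_min normr_ge0.
  have /fine_cvgP[_] : (EE P (fun w => Num.min `|Y n w| c))%:E @[n --> \oo] --> 0%E.
    by move: H; rewrite integral0; under eq_fun do rewrite EE_EFin ?jmin//.
  by [].
apply/cvgrPdist_le => e e0.
(* Chosen so that K / c <= e / 2; the added 1 keeps c positive when K = 0. *)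
pose c := 2 * (K + 1) / e.
have c0 : 0 < c by rewrite divr_gt0// mulr_gt0// ltr_wpDl.
have /cvgrPdist_le /(_ (e / 2)) := mincvg c c0.
rewrite divr_gt0// => /(_ isT); apply: filterS => n.
rewrite !sub0r !normrN => h.
have h1 : c^-1 * K <= e / 2.
  rewrite /c invf_div mulrAC ler_pdivrMr ?mulr_gt0 ?ltr_wpDl//.
  by rewrite (_ : e / 2 * _ = e * (K + 1)); [rewrite ler_pM2l// lerDl|field].
rewrite ger0_norm; last exact: EE_ge0.
have := split_bound c n c0; have := ler_norm (EE P (fun w => Num.min `|Y n w| c)); lra.
Qed.

(** Continuity of the inner product of L^2. Instead of the Cauchy-Schwarz inequality, [mulb] uses |f
    g| <= f^2 / dl + dl g^2 with a free weight: n tends to infinity first, then the weight tends to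
    0. *)
Lemma EE_mul_cvg (U V : Omega -> R) (Un Vn : nat -> Omega -> R) (e : nat -> R) (c : R) :
  (forall n, L2 P (Un n)) -> (forall n, L2 P (Vn n)) ->
  (forall n, L2 P (fun w => U w - Un n w)) -> (forall n, L2 P (fun w => V w - Vn n w)) ->
  (forall n, EE P (fun w => (U w - Un n w) ^+ 2) <= e n) ->
  (forall n, EE P (fun w => (V w - Vn n w) ^+ 2) <= e n) ->
  e n @[n --> \oo] --> (0 : R) ->
  EE P (fun w => Un n w * Vn n w) @[n --> \oo] --> c ->
  L1 P (fun w => U w * V w) /\ EE P (fun w => U w * V w) = c.
Proof.
move=> jUn jVn jdU jdV hU hV e0 UVc.
have jU : L2 P U.
  rewrite (_ : U = fun w => (U w - Un 0%N w) + Un 0%N w); first exact: L2D.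
  by apply/funext => w; rewrite subrK.
have jV : L2 P V.
  rewrite (_ : V = fun w => (V w - Vn 0%N w) + Vn 0%N w); first exact: L2D.
  by apply/funext => w; rewrite subrK.
have jUV := L2M jU jV; split => //.
pose S := EE P (fun w => U w ^+ 2) + EE P (fun w => V w ^+ 2).
have S0 : 0 <= S by apply: addr_ge0; apply: EE_ge0 => w; exact: sqr_ge0.
have mulb (dl : R) (f g : Omega -> R) (ef eg : R) : 0 < dl -> L2 P f -> L2 P g ->
    EE P (fun w => f w ^+ 2) <= ef -> EE P (fun w => g w ^+ 2) <= eg ->
    `|EE P (fun w => f w * g w)| <= (dl^-1 * ef + dl * eg).
  move=> dl0 jf jg hf hg.
  have dli : 0 < dl^-1 by rewrite invr_gt0.
  have amgm w : `|f w * g w| <= dl^-1 * f w ^+ 2 + dl * g w ^+ 2.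
    rewrite normrM -[f w ^+ 2]real_normK ?num_real// -[g w ^+ 2]real_normK ?num_real//.
    have x0 := normr_ge0 (f w); have y0 := normr_ge0 (g w).
    set x := `|f w| in x0 *; set y := `|g w| in y0 *.
    have : 0 <= dl^-1 * (x - dl * y) ^+ 2 by apply: mulr_ge0; [exact: ltW|exact: sqr_ge0].
    rewrite (_ : dl^-1 * _ = dl^-1 * x ^+ 2 + dl * y ^+ 2 - 2 * (x * y)); last first.
      by field; rewrite gt_eqF.
    have : 0 <= x * y by exact: mulr_ge0.
    lra.
  have jfg := L2M jf jg.
  have jr : L1 P (fun w => dl^-1 * f w ^+ 2 + dl * g w ^+ 2).
    by apply: L1D; apply: L1Z; [exact: jf.2|exact: jg.2].
  have E1 : EE P (fun w => dl^-1 * f w ^+ 2 + dl * g w ^+ 2) <= dl^-1 * ef + dl * eg.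
    rewrite EED; [|by apply: L1Z; exact: jf.2|by apply: L1Z; exact: jg.2].
    rewrite (EEZ _ jf.2) (EEZ _ jg.2).
    by apply: lerD; rewrite ler_pM2l.
  apply: le_trans E1; rewrite ler_norml; apply/andP; split.
    rewrite lerNl -mulN1r -EEZ//; apply: EE_le => //; first exact: L1Z.
    by move=> w; rewrite mulN1r (le_trans _ (amgm w))// -normrN ler_norm.
  by apply: EE_le => // w; rewrite (le_trans _ (amgm w))// ler_norm.
have est (dl : R) n : 0 < dl -> `|EE P (fun w => U w * V w) - EE P (fun w => Un n w * Vn n w)| <=
    (dl^-1 + dl^-1 + 2) * e n + dl * S.
  move=> dl0.
  have j1 := L2M (jdU n) jV; have j2 := L2M (jdV n) jU; have j3 := L2M (jdU n) (jdV n).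
  rewrite -EEB//; last exact: L2M.
  (* Every product in this decomposition of U V - Un Vn contains a difference that is small in mean
     square. *)
  rewrite (EE_eq P (g := fun w => ((U w - Un n w) * V w + (V w - Vn n w) * U w) -
     (U w - Un n w) * (V w - Vn n w))); last by move=> w; ring.
  rewrite EEB//; last exact: L1D.
  rewrite EED//.
  have b1 := mulb dl _ _ _ _ dl0 (jdU n) jV (hU n) (lexx _).
  have b2 := mulb dl _ _ _ _ dl0 (jdV n) jU (hV n) (lexx _).
  have b3 := mulb 1 _ _ _ _ ltr01 (jdU n) (jdV n) (hU n) (hV n).
  rewrite invr1 !mul1r in b3.
  apply: (le_trans (ler_normB _ _)); apply: (@le_trans _ _ (_ + _ + _)).
    by apply: lerD b3; exact: le_trans (ler_normD _ _) (lerD b1 b2).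
  by rewrite /S; lra.
have lim (dl : R) : 0 < dl -> `|EE P (fun w => U w * V w) - c| <= 0 + dl * S.
  move=> dl0; rewrite -(mulr0 (dl^-1 + dl^-1 + 2)).
  have L1' : (dl^-1 + dl^-1 + 2) * e n + dl * S @[n --> \oo] --> (dl^-1 + dl^-1 + 2) * 0 + dl * S.
    by apply: cvgD; [apply: cvgM => //; exact: cvg_cst|exact: cvg_cst].
  have L2' : `|EE P (fun w => U w * V w) - EE P (fun w => Un n w * Vn n w)| @[n --> \oo]
      --> `|EE P (fun w => U w * V w) - c|.
    by apply: cvg_norm; apply: cvgB => //; exact: cvg_cst.
  by apply: (ler_cvg_to L2' L1'); apply: nearW => n; exact: (est dl n dl0).
apply/eqP; rewrite -subr_eq0 -normr_le0; apply: (@le_small _ _ _ S) => l /andP[l0 _].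
exact: lim.
Qed.

End L2_limits.

(** * Exchange of expectation and time integral *)

Section time_fubini.
Context {d : measure_display} {Omega : measurableType d} {R : realType}.
Variable P : probability Omega R.
Local Notation mu := (@lebesgue_measure R).

(** The uniform bound [C] on the absolute first moments gives integrability on the product by
    Tonelli's theorem. An indicator extends the integrand by zero, so that the time axis is the
    whole line. *)
Lemma EE_time_integral (f : R -> Omega -> R) (t C : R) : 0 <= t ->
  measurable_fun setT (fun p : R * Omega => f p.1 p.2) ->
  (forall w, mu.-integrable `[0, t] (EFin \o f ^~ w)) ->
  (forall s, 0 <= s <= t -> L1 P (f s) /\ EE P (fun w => `|f s w|) <= C) ->
  L1 P (fun w => \int[mu]_(s in `[0, t]) f s w) /\
  EE P (fun w => \int[mu]_(s in `[0, t]) f s w) = \int[mu]_(s in `[0, t]) EE P (f s).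
Proof.
move=> t0 mf intf jf.
pose g (p : Omega * R) : \bar R := (\1_(`[0, t]%classic : set R) p.2 * f p.2 p.1)%:E.
have mg : measurable_fun setT g.
  apply: measurableT_comp => //; apply: measurable_funM => //.
    exact: measurableT_comp.
  exact: (measurableT_comp mf (@measurable_swap _ _ Omega R)).
have gin s w : s \in `[0, t]%classic -> g (w, s) = (f s w)%:E.
  by move=> sin; rewrite /g indicE sin mul1r.
have gout s w : s \notin `[0, t]%classic -> g (w, s) = 0%E.
  by move=> sin; rewrite /g indicE (negbTE sin) mul0r.
have jg : (P \x mu)%E.-integrable setT g.
  apply/(integrable21ltyP P mu mg).
  apply: (@le_lt_trans _ _ (\int[mu]_s (C%:E * (\1_(`[0%R, t]%classic) s)%:E))%E).
    apply: ge0_le_integral => //.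
    - by move=> s _; exact: integral_ge0.
    - have := @measurable_fun_fubini_tonelli_G _ _ _ _ R P (fun p => `|g p|%E).
      by apply => //; exact: measurableT_comp.
    - by apply: measurable_funeM; exact: measurableT_comp.
    move=> s _; case: (boolP (s \in `[0, t]%classic)) => sin; last first.
      by under eq_integral do rewrite gout//= normr0; rewrite integral0 indicE (negbTE sin) mule0.
    have [j1 j2] : L1 P (f s) /\ EE P (fun w => `|f s w|) <= C.
      by apply: jf; move: sin; rewrite inE /= in_itv.
    under eq_integral do rewrite gin//=.
    by rewrite EE_EFin; [rewrite indicE sin mule1 lee_fin|exact: L1_abs].
  have C0 : (0 <= C%:E)%E.
    have [j1 j2] : L1 P (f 0) /\ EE P (fun w => `|f 0 w|) <= C by apply: jf; rewrite lexx.
    by rewrite lee_fin (le_trans _ j2)//; exact: EE_ge0.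
  rewrite ge0_integralZl//; last exact: measurableT_comp.
  rewrite integral_indic//= setIT lebesgue_measure_itv /= lte_fin.
  by case: ifP => _; rewrite ?mule0 ?ltry// -EFinB -EFinM ltry.
have inner w : (\int[mu]_s g (w, s) = (\int[mu]_(s in `[0, t]) f s w)%:E)%E.
  rewrite /Rintegral fineK; last by apply: integrable_fin_num => //; exact: intf.
  rewrite [RHS]integral_mkcond; apply: eq_integral => s _; rewrite /patch.
  by case: ifPn => [/gin|/gout].
have jG := integrable_fubini_F jg.
rewrite (_ : fubini_F _ _ = fun w => (\int[mu]_(s in `[0, t]) f s w)%:E) in jG; last first.
  by apply/funext => w; rewrite /fubini_F inner.
split => //.
have := Fubini jg; under [X in X = _ -> _]eq_integral do rewrite inner.
rewrite EE_EFin// => /(congr1 fine) /= ->.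
rewrite /Rintegral [in RHS]integral_mkcond; congr fine; apply: eq_integral => s _.
rewrite /patch; case: ifPn => sin; last first.
  by under eq_integral do rewrite gout//; rewrite integral0.
under eq_integral do rewrite gin//.
rewrite EE_EFin//; apply: (jf _ _).1; by move: sin; rewrite inE /= in_itv.
Qed.

End time_fubini.

(** * Primitives of continuous functions on the line *)

Section primitive.
Context {R : realType}.
Local Notation mu := (@lebesgue_measure R).
Implicit Types (f g : R -> R) (s t : R).

(* The primitive vanishing at 0.  The base point of the integrals is kept to
   the left of both 0 and t, so that it is differentiable on the whole line. *)
Definition prim f (t : R) : R :=
  \int[mu]_(u in `[- `|t| - 1, t]) f u - \int[mu]_(u in `[- `|t| - 1, 0]) f u.

Lemma Rintegral_cat f (b c t : R) : continuous f -> b <= c -> c <= t ->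
  \int[mu]_(u in `[b, t]) f u = \int[mu]_(u in `[b, c]) f u + \int[mu]_(u in `[c, t]) f u.
Proof.
move=> cf bc ct.
have i x : mu.-integrable `[b, x] (EFin \o f) by exact: continuous_integrable_itv.
have := @Rintegral_itvB R f (BLeft b) (BRight t) c (i t).
rewrite !bnd_simp => /(_ bc ct) e.
rewrite -[X in _ = _ + X]Rintegral_itv_obnd_cbnd; first by rewrite -e; ring.
by apply: (integrableS _ _ _ (i t)) => // x /=; rewrite !in_itv /= => /andP[/ltW/(le_trans bc) -> ->].
Qed.

(** The base point in [prim] moves with t; this lemma fixes one base point for a whole
    neighbourhood, as differentiation requires. *)
Lemma prim_base f (b t : R) : continuous f -> b <= 0 -> b <= t ->
  prim f t = \int[mu]_(u in `[b, t]) f u - \int[mu]_(u in `[b, 0]) f u.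
Proof.
move=> cf b0 bt; rewrite /prim; set c : R := - `|t| - 1.
have c0 : c <= 0 by rewrite /c; have := normr_ge0 t; lra.
have ct : c <= t by rewrite /c; have := ler_norm (- t); rewrite normrN; lra.
case: (leP b c) => bc.
  by rewrite (Rintegral_cat cf bc ct) (Rintegral_cat cf bc c0); ring.
by rewrite (Rintegral_cat cf (ltW bc) bt) (Rintegral_cat cf (ltW bc) b0); ring.
Qed.

Lemma prim0 f : prim f 0 = 0.
Proof. by rewrite /prim subrr. Qed.

Lemma primE f t : continuous f -> 0 <= t -> prim f t = \int[mu]_(u in `[0, t]) f u.
Proof.
by move=> cf t0; rewrite (prim_base (b := 0) cf)// set_itv1 Rintegral_set1 subr0.
Qed.

Lemma is_derive_prim f (t : R) : continuous f -> is_derive t 1 (prim f) (f t).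
Proof.
move=> cf; pose b : R := - `|t| - 1.
have b0 : b < 0 by rewrite /b; have := normr_ge0 t; lra.
have bt : b < t by rewrite /b; have := ler_norm (- t); rewrite normrN; lra.
pose F (x : R) : R := \int[mu]_(u in `[b, x]) f u.
have [d1 e1] : derivable F t 1 /\ derive1 F t = f t.
  apply: (@continuous_FTC1_closed R f b t (t + 1)) => //; first by rewrite ltrDl.
    exact: continuous_integrable_itv.
  exact: cf.
have d2 : is_derive t 1 F (f t) by rewrite derive1E in e1; exact: DeriveDef.
have d3 : is_derive t 1 (F - cst (F 0)) (f t - 0) by exact: is_deriveB.
rewrite subr0 in d3.
apply: (near_eq_is_derive _ d3) => //.
near=> x; rewrite (prim_base (b := b))// ?ltW//.
by near: x; exact: lt_nbhsr.
Unshelve. all: by end_near. Qed.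

Lemma continuous_prim f : continuous f -> continuous (prim f).
Proof.
move=> cf t; apply/differentiable_continuous/derivable1_diffP.
by have [] := is_derive_prim t cf.
Qed.

Lemma continuous_FTC_zero f g (t : R) : continuous g -> 0 <= t ->
  (forall s : R, is_derive s 1 f (g s)) ->
  \int[mu]_(u in `[0, t]) g u = f t - f 0.
Proof.
move=> cg; rewrite le_eqVlt => /predU1P[<- _|t0 df].
  by rewrite set_itv1 Rintegral_set1 subrr.
have cf : continuous f.
  by move=> s; apply/differentiable_continuous/derivable1_diffP; have [] := df s.
have d1 : derivable_oo_LRcontinuous f 0 t.
  split.
  - by move=> x _; have [] := df x.
  - by apply: cvg_at_right_filter; exact: cf.
  - by apply: cvg_at_left_filter; exact: cf.
have d2 : {in `]0, t[, derive1 f =1 g}.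
  by move=> x _; have dx := df x; rewrite derive1E derive_val.
by rewrite /Rintegral (continuous_FTC2 t0 (continuous_subspaceT cg) d1 d2) -EFinB.
Qed.

Lemma continuous_clamp (t : R) : continuous (fun s : R => Num.max 0 (Num.min s t)).
Proof.
move=> s; apply: (@continuous_max R R (fun=> 0) (fun s : R => Num.min s t) s).
  exact: cvg_cst.
by apply: (@continuous_min R R id (fun=> t) s); [exact: cvg_id|exact: cvg_cst].
Qed.

End primitive.

(** * Moments of the CIR process *)

Section cir_process.
Context {d : measure_display} {Omega : measurableType d} {R : realType}.
Variables (P : probability Omega R) (F : R -> set (set Omega)) (B : R -> Omega -> R).
Hypotheses (hF : filtration F) (hB : brownian_motion P F B).
Local Notation mu := (@lebesgue_measure R).

Variables (a h : R -> R) (sigma t0 : R) (X : R -> Omega -> R).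
Hypotheses (t0_gt0 : 0 < t0) (ca : continuous a) (ch : continuous h)
  (h_ge0 : forall s, 0 <= h s) (sigma_ge0 : 0 <= sigma)
  (aX : forall s, 0 <= s <= t0 -> measurable_wrt (F s) (X s))
  (mX : forall s, measurable_fun setT (X s))
  (X_clamp : forall s, X s = X (Num.max 0 (Num.min s t0)))
  (X_ge0 : forall s w, 0 <= X s w) (cX : forall w, continuous (X ^~ w)).

Definition diffusion (s : R) (w : Omega) : R := sigma * Num.sqrt (h s * X s w).

(** The martingale part is what remains of [X] once the drift is removed, so it inherits the
    regularity of the paths; [itoX] identifies it with the Ito integral of [diffusion]. *)
Definition mart (s : R) (w : Omega) : R :=
  X s w - \int[mu]_(u in `[0, s]) (a u - h u * X u w).

Hypothesis itoX : forall s : R, 0 <= s <= t0 -> ito_limit P F B diffusion s (mart s).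

Let t0_ge0 : 0 <= t0. Proof. exact: ltW. Qed.

Lemma diffusion_sqr s w : diffusion s w ^+ 2 = sigma ^+ 2 * (h s * X s w).
Proof. by rewrite exprMn sqr_sqrtr// mulr_ge0. Qed.

Lemma continuous_hX w : continuous (fun s => h s * X s w).
Proof. by move=> s; apply: cvgM; [exact: ch|exact: cX]. Qed.

Lemma continuous_diffusion w : continuous (diffusion ^~ w).
Proof.
move=> s; apply: cvgM; first exact: cvg_cst.
apply: (@cvg_comp _ _ _ (fun u => h u * X u w) Num.sqrt _ (nbhs (h s * X s w))).
  exact: continuous_hX.
exact: sqrt_continuous.
Qed.

Lemma measurable_diffusion s : measurable_fun setT (diffusion s).
Proof.
apply: measurable_funM => //.
have ms : measurable_fun setT (Num.sqrt : R -> R).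
  by apply: continuous_measurable; exact: sqrt_continuous.
by apply: (measurableT_comp ms); exact: measurable_funM.
Qed.

Lemma measurable_diffusion_joint : measurable_fun setT (fun p : R * Omega => diffusion p.1 p.2).
Proof. apply: continuous_measurable_joint; [exact: continuous_diffusion|exact: measurable_diffusion]. Qed.

Lemma measurable_X_joint : measurable_fun setT (fun p : R * Omega => X p.1 p.2).
Proof. exact: continuous_measurable_joint. Qed.

Lemma diffusion_bounded (t : R) w : exists C : R, forall s : R, 0 <= s <= t -> `|diffusion s w| <= C.
Proof. by have [C _ H] := continuous_bounded_itv 0 t (@continuous_diffusion w); exists C. Qed.

Let ia (s : R) : mu.-integrable `[0, s] (EFin \o a).
Proof. exact: continuous_integrable_itv. Qed.

Let ihX (s : R) w : mu.-integrable `[0, s] (EFin \o (fun u => h u * X u w)).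
Proof. apply: continuous_integrable_itv; exact: continuous_hX. Qed.

Lemma martE s w : mart s w = X s w - \int[mu]_(u in `[0, s]) a u +
  \int[mu]_(u in `[0, s]) (h u * X u w).
Proof. by rewrite /mart RintegralB//; ring. Qed.

Lemma measurable_int_hX s : measurable_fun setT (fun w => \int[mu]_(u in `[0, s]) (h u * X u w)).
Proof.
apply: measurableT_comp => //.
apply: (@measurable_time_integral _ _ _ s (fun p => h p.1 * X p.1 p.2)).
- apply: measurable_funM; last exact: measurable_X_joint.
  by apply: measurableT_comp => //; exact: continuous_measurable.
- by move=> p; rewrite mulr_ge0.
Qed.

Lemma measurable_mart s : measurable_fun setT (mart s).
Proof.
rewrite (_ : mart s = fun w => X s w - \int[mu]_(u in `[0, s]) a u +
  \int[mu]_(u in `[0, s]) (h u * X u w)); last by apply/funext => w; exact: martE.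
apply: measurable_funD; last exact: measurable_int_hX.
exact: measurable_funB.
Qed.

Definition zero_elementary : elementary F.
Proof.
refine (@Elementary _ _ _ F 0%N (fun=> 0) (fun _ _ => 0) _ _ _) => //.
by move=> i; apply: measurable_wrt_cst; exact: (filtration_sigma hF (lexx 0)).
Defined.

Let int_a_bound : exists2 A0 : R, 0 <= A0 & forall s : R, 0 <= s <= t0 ->
  \int[mu]_(u in `[0, s]) a u <= A0.
Proof.
have [C C0 aC] := continuous_bounded_itv 0 t0 ca.
exists (C * t0); first exact: mulr_ge0.
move=> s /andP[s0 st].
apply: (@le_trans _ _ (\int[mu]_(u in `[0, s]) C)).
  apply: le_Rintegral => //; first by apply: continuous_integrable_itv; exact: cst_continuous.
  move=> u /=; rewrite in_itv /= => /andP[u0 us]; apply: (le_trans (ler_norm _)); apply: aC.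
  by rewrite u0 (le_trans us).
rewrite Rintegral_cst//= lebesgue_measure_itv /= lte_fin.
by case: ifP => _ /=; rewrite ?mulr0 ?mulr_ge0// oppr0 addr0 ler_wpM2l.
Qed.

Lemma X_moment : exists2 K : R, 0 <= K & forall s : R, 0 <= s <= t0 ->
  L2 P (X s) /\ EE P (fun w => X s w ^+ 2) <= K.
Proof.
have [A0 A00 hA] := int_a_bound.
(* This value gives l^2 sigma^2 <= l, so the compensator l^2 sigma^2 \int h X is dominated by the l
   \int h X contained in l M. *)
pose l := (1 + sigma ^+ 2)^-1.
have den : 0 < 1 + sigma ^+ 2 by rewrite ltr_wpDr// sqr_ge0.
have l0 : 0 < l by rewrite invr_gt0.
have ls : l ^+ 2 * sigma ^+ 2 <= l.
  rewrite expr2 -mulrA ger_pMr// /l -ler_pdivlMl ?invr_gt0// invrK mulr1.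
  by rewrite lerDr.
(* The first factor comes from l^2 x^2 / 2 <= e^(l x) for x >= 0, the second from the integral of
   [a], bounded by [A0]. *)
pose K := 2 / l ^+ 2 * expR (l * A0).
have l2 : 0 < l ^+ 2 by rewrite exprn_gt0.
have K0 : 0 <= K by rewrite mulr_ge0 ?expR_ge0// divr_ge0// ltW.
exists K => // s s0t; have /andP[s0 st] := s0t.
pose E w := expR (l * (mart s w - el_integral B zero_elementary s w) -
    l ^+ 2 * sqdist diffusion s zero_elementary w).
have intE : (\int[P]_w (E w)%:E <= 1)%E :=
  @ito_exp_bound _ _ _ P F B hF hB diffusion s s0 measurable_diffusion_joint
  (diffusion_bounded s) (mart s) zero_elementary l (measurable_mart s) (itoX s0t).
have e0 w : el_integral B zero_elementary s w = 0 by rewrite /el_integral big_ord0.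
have d0 w : sqdist diffusion s zero_elementary w = sigma ^+ 2 * \int[mu]_(u in `[0, s]) (h u * X u w).
  rewrite /sqdist -RintegralZl//; apply: eq_Rintegral => u _.
  by rewrite /el_val big_ord0 sub0r sqrrN diffusion_sqr.
have pt w : X s w ^+ 2 <= K * E w.
  rewrite /E e0 d0 subr0 martE.
  have I0 : 0 <= \int[mu]_(u in `[0, s]) (h u * X u w).
    by apply: Rintegral_ge0 => u _; rewrite mulr_ge0.
  move: I0; set I := \int[mu]_(u in _) (_ * _) => I0.
  have hA' := hA s s0t; move: hA'; set A := \int[mu]_(u in _) _ => hA'.
  apply: (@le_trans _ _ (2 / l ^+ 2 * expR (l * X s w))).
    rewrite -ler_pdivrMl ?divr_gt0// invf_div.
    have := expR_ge1Dxn 1 (mulr_ge0 (ltW l0) (X_ge0 s w)).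
    rewrite exprMn (_ : (2`!)%:R = 2 :> R)//.
    rewrite (_ : l ^+ 2 / 2 * X s w ^+ 2 = l ^+ 2 * X s w ^+ 2 / 2); last by ring.
    by lra.
  rewrite /K -[leRHS]mulrA -expRD ler_pM2l ?divr_gt0// ler_expR.
  have h1 : l ^+ 2 * (sigma ^+ 2 * I) <= l * I by rewrite mulrA ler_wpM2r.
  have h2 : l * A <= l * A0 by rewrite ler_pM2l.
  by lra.
have mE : measurable_fun setT E.
  apply: measurableT_comp => //; apply: measurable_funB; apply: measurable_funM => //.
    apply: measurable_funB; first exact: measurable_mart.
    exact: (measurable_el_integral hF hB s0).
  exact: (measurable_sqdist hF _ measurable_diffusion_joint).
have jE : L1 P E by apply: (@L1_ge0 _ _ _ _ _ 1) => // w; exact: expR_ge0.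
have mX2 : measurable_fun setT (fun w => X s w ^+ 2) by exact: measurable_funX.
have jX2 : L1 P (fun w => X s w ^+ 2).
  apply: (@L1_le _ _ _ _ _ (fun w => K * E w)) => //; last exact: L1Z.
  by move=> w; rewrite ger0_norm ?sqr_ge0//; exact: pt.
split; first by split.
apply: (@le_trans _ _ (EE P (fun w => K * E w))).
  by apply: EE_le => //; exact: L1Z.
rewrite EEZ// ler_piMr//.
by rewrite -lee_fin -EE_EFin.
Qed.

Let clampP (s : R) : 0 <= Num.max 0 (Num.min s t0) <= t0.
Proof. by rewrite le_max lexx /= ge_max t0_ge0 ge_min lexx orbT. Qed.

Lemma X_moment_all : exists2 K : R, 0 <= K & forall s : R,
  L2 P (X s) /\ EE P (fun w => X s w ^+ 2) <= K.
Proof.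
by have [K K0 H] := X_moment; exists K => // s; rewrite X_clamp; exact: H.
Qed.

Lemma X_L2 s : L2 P (X s).
Proof. by have [K _ /(_ s)[]] := X_moment_all. Qed.

(** Continuity of paths and uniformly bounded second moments give convergence in mean. The weight
    allows two uses: k = 1 for the continuity of the mean, and k = sigma^2 h for the error of the
    grid approximation. *)
Lemma weighted_X_L1_continuous (k : R -> R) (u : nat -> R) (s r : R) : continuous k ->
  (forall n, `|u n - s| <= r) -> u n @[n --> \oo] --> s ->
  EE P (fun w => `|k (u n) * X (u n) w - k s * X s w|) @[n --> \oo] --> (0 : R).
Proof.
move=> ck us uns.
have [C C0 kC] := continuous_bounded_itv (s - r) (s + r) ck.
have [K K0 XK] := X_moment_all.
have kun n : `|k (u n)| <= C by apply: kC; have := us n; rewrite ler_norml => /andP[] *; apply/andP; split; lra.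
have r0 : 0 <= r by exact: le_trans (us 0%N).
have ks : `|k s| <= C by apply: kC; apply/andP; split; lra.
have sqC (x : R) : `|x| <= C -> x ^+ 2 <= C ^+ 2.
  by move=> xC; rewrite -[x ^+ 2]real_normK ?num_real// lerXn2r ?nnegrE.
have j n : L2 P (fun w => k (u n) * X (u n) w - k s * X s w).
  by apply: L2B; apply: L2Z; exact: X_L2.
apply: (@L1_convergence _ _ _ P _ (2 * (C ^+ 2 * K) + 2 * (C ^+ 2 * K))) => //.
- move=> n; have [_ j1] := X_L2 (u n); have [_ j2] := X_L2 s.
  apply: (@le_trans _ _ (EE P (fun w => (2 * k (u n) ^+ 2) * X (u n) w ^+ 2 + (2 * k s ^+ 2) * X s w ^+ 2))).
    apply: EE_le; [exact: (j n).2|by apply: L1D; exact: L1Z|move=> w].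
    have := sqr_ge0 (k (u n) * X (u n) w + k s * X s w).
    by rewrite -subr_ge0 => hh; rewrite -subr_ge0; apply: le_trans hh _; rewrite le_eqVlt; apply/orP; left; apply/eqP; ring.
  rewrite EED; [|exact: L1Z|exact: L1Z].
  have q x v : `|x| <= C -> 2 * x ^+ 2 * EE P (fun w => X v w ^+ 2) <= 2 * (C ^+ 2 * K).
    move=> xC; rewrite -mulrA ler_pM2l//; apply: ler_pM; [exact: sqr_ge0| |exact: sqC|exact: (XK _).2].
    by apply: EE_ge0 => w; exact: sqr_ge0.
  by rewrite !EEZ//; apply: lerD; exact: q.
- move=> w; rewrite -(subrr (k s * X s w)); apply: cvgB; last exact: cvg_cst.
  by apply: cvgM; [exact: (cvg_comp _ _ uns (ck s))|exact: (cvg_comp _ _ uns (@cX w s))].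
Qed.

Lemma continuous_mean : continuous (fun s => EE P (X s)).
Proof.
move=> s; apply/cvgrPdist_le => e e0.
(* Convergence in mean is available along sequences only, so a failure of continuity is turned into
   a sequence of times tending to s. *)
apply: contrapT => /= H.
have {}H n : exists u : R, `|u - s| <= n.+1%:R^-1 /\ e < `|EE P (X s) - EE P (X u)|.
  apply: contrapT => K; apply: H.
  exists (n.+1%:R^-1); first by rewrite /= invr_gt0.
  move=> u /= us; apply: contrapT => /negP; rewrite -ltNge => eu; apply: K.
  by exists u; split => //; rewrite distrC ltW.
have [u hu] := choice H.
have us1 n : `|u n - s| <= 1.
  by apply: (le_trans (hu n).1); rewrite invf_le1// ler1n.
have uns : u n @[n --> \oo] --> s.
  apply/cvgrPdist_le => r r0; near=> n.
  rewrite distrC (le_trans (hu n).1)// ltW//.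
  by near: n; exact: (near_infty_natSinv_lt (PosNum r0)).
have c1 : continuous (fun _ : R => 1 : R) by exact: cst_continuous.
have := @weighted_X_L1_continuous (fun=> 1) u s 1 c1 us1 uns.
move=> /cvgrPdist_le /(_ e e0) [N _ /(_ N (leqnn N)) /=].
rewrite sub0r normrN => hN.
have := (hu N).2; apply/negP; rewrite -leNgt.
have jd : L1 P (fun w => X (u N) w - X s w) by apply: L1B; apply: L2_L1; exact: X_L2.
apply: le_trans hN; rewrite distrC -EEB; [|by apply: L2_L1; exact: X_L2..].
apply: (le_trans _ (ler_norm _)).
have -> : EE P (fun w => `|1 * X (u N) w - 1 * X s w|) = EE P (fun w => `|X (u N) w - X s w|).
  by apply: EE_eq => w; rewrite !mul1r.
rewrite /EE; exact: le_normr_Rintegral.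
Unshelve. all: by end_near. Qed.

(** * Sampling the diffusion coefficient on a uniform grid *)

Section grid.
Variable n : nat.
Let dt : R := t0 / n.+1%:R.
Let dt_gt0 : 0 < dt. Proof. by rewrite divr_gt0. Qed.
(** The index is capped because an elementary process has adapted coefficients at every index,
    whereas [X] is known to be adapted up to [t0] only. *)
Let tm (i : nat) : R := (minn i n.+1)%:R * dt.

Let tm_ge0 i : 0 <= tm i.
Proof. by rewrite mulr_ge0 ?ler0n ?ltW. Qed.

Let tm_le i : tm i <= tm i.+1.
Proof. by rewrite ler_pM2r// ler_nat leq_min geq_minr andbT (leq_trans (geq_minl _ _)). Qed.

Let tm_t0 i : tm i <= t0.
Proof.
rewrite (_ : t0 = n.+1%:R * dt); last by rewrite /dt mulrC divfK.
by rewrite ler_pM2r// ler_nat geq_minr.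
Qed.

Let coef_meas i : measurable_wrt (F (tm i)) (diffusion (tm i)).
Proof.
apply: (@measurable_wrt_comp _ _ _ _ (filtration_sigma hF (tm_ge0 i)) (fun x => sigma * Num.sqrt (h (tm i) * x))).
- apply: measurable_funM => //.
  have ms : measurable_fun setT (Num.sqrt : R -> R).
    by apply: continuous_measurable; exact: sqrt_continuous.
  by apply: (measurableT_comp ms); exact: measurable_funM.
- by apply: aX; rewrite tm_ge0 tm_t0.
Qed.

Definition grid_elementary : elementary F :=
  @Elementary _ _ _ F n.+1 tm (fun i => diffusion (tm i)) (tm_ge0 0%N) tm_le coef_meas.

(** The sample is taken at the left end of the cell containing [s], hence within one step of it.
    Time 0 lies in no cell, and the grid process vanishes there. *)
Lemma grid_val (s : R) : 0 < s <= t0 -> exists u : R, [/\ 0 <= u <= t0, `|u - s| <= dt &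
  forall w, el_val grid_elementary s w = diffusion u w].
Proof.
move=> /andP[s0 st].
have ex : exists j, s <= j%:R * dt.
  by exists n.+1; rewrite /dt mulrC divfK.
(* The cell is found from the least j with s <= j dt. *)
case: (ex_minnP ex) => j sj jmin.
have jn : (j <= n.+1)%N by apply: jmin; rewrite /dt mulrC divfK.
case: j sj jmin jn => [|i] sj jmin iN; first by move: sj; rewrite mul0r leNgt s0.
have is_ : i%:R * dt < s.
  by rewrite ltNge; apply/negP => /jmin; rewrite ltnn.
have tmi : tm i = i%:R * dt by rewrite /tm (minn_idPl (ltnW iN)).
exists (tm i); split; first by rewrite tm_ge0 tm_t0.
  rewrite distrC tmi ger0_norm; last by rewrite subr_ge0 ltW.
  rewrite lerBlDl.
  by move: sj; rewrite -natr1 mulrDl mul1r.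
move=> w; rewrite /el_val /= (bigD1 (Ordinal iN)) //= big1 ?addr0.
  rewrite indicE mem_setE in_itv /= tmi is_ /tm (minn_idPl iN) sj mulr1.
  by rewrite /tm.
move=> k; rewrite -val_eqE /= => ki; rewrite indicE mem_setE in_itv /=.
rewrite (_ : (_ < s <= _) = false) ?mulr0//; apply/negP => /andP[ks sk].
move: ki; rewrite neq_ltn => /orP[ki|ki].
  have : s <= i%:R * dt.
    by apply: (le_trans sk); rewrite ler_pM2r// ler_nat geq_min ki.
  by rewrite leNgt is_.
have : tm k < (i.+1)%:R * dt by exact: lt_le_trans ks sj.
by rewrite ltr_pM2r// ltr_nat ltnNge leq_min ki iN.
Qed.

End grid.

(** The difference of squares is linear in [X], so convergence in mean of [X] controls it. It also
    dominates the squared difference, because (x - y)^2 <= |x^2 - y^2| for nonnegative x and y. *)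
Definition grid_error (n : nat) (s : R) (w : Omega) : R :=
  `|el_val (grid_elementary n) s w ^+ 2 - diffusion s w ^+ 2|.

Let c : R -> R := fun s => sigma ^+ 2 * h s.

Let continuous_c : continuous c.
Proof. by move=> s; apply: cvgM; [exact: cvg_cst|exact: ch]. Qed.

Lemma grid_coef_L2 n : L2_coef P (grid_elementary n).
Proof.
move=> i _; split; first exact: measurable_diffusion.
rewrite (_ : (fun w => _) = fun w => c (el_time (grid_elementary n) i) * X (el_time (grid_elementary n) i) w).
  by apply: L1Z; apply: L2_L1; exact: X_L2.
by apply/funext => w; rewrite diffusion_sqr mulrA.
Qed.

Let diffusion_sqrE s w : diffusion s w ^+ 2 = c s * X s w.
Proof. by rewrite diffusion_sqr mulrA. Qed.

Lemma X_L1 s : L1 P (X s).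
Proof. by apply: L2_L1; exact: X_L2. Qed.

Let diffusion_sqr_L1 s : L1 P (fun w => diffusion s w ^+ 2).
Proof. by under [X in L1 _ X]eq_fun do rewrite diffusion_sqrE; apply: L1Z; exact: X_L1. Qed.

Let el_sqr_L1 n s : L1 P (fun w => el_val (grid_elementary n) s w ^+ 2).
Proof. exact: (L2_el_val s (grid_coef_L2 (n := n))).2. Qed.

Lemma grid_error_L1 n s : L1 P (grid_error n s).
Proof. by apply: L1_abs; exact: L1B. Qed.

Lemma EE_X_bounded : exists2 K : R, 0 <= K & forall s, EE P (X s) <= K.
Proof.
have [K K0 H] := X_moment_all; exists (1 + K); first by rewrite addr_ge0.
move=> s; have [[_ j] XK] := H s.
apply: (@le_trans _ _ (EE P (fun w => 1 + X s w ^+ 2))).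
  apply: EE_le; [exact: X_L1|by apply: L1D => //; exact: L1_cst|move=> w].
  by have := sqr_ge0 (X s w - 1); have := X_ge0 s w; rewrite sqrrB1; lra.
by rewrite EED ?EE_cst ?lerD2l//; exact: L1_cst.
Qed.

Lemma grid_val0 n w : el_val (grid_elementary n) 0 w = 0.
Proof.
rewrite /el_val big1// => i _; rewrite indicE mem_setE in_itv /=.
by rewrite ltNge (el_time_ge0' (grid_elementary n)) /= mulr0.
Qed.

Lemma grid_error_bounded : exists C : R, forall n s, 0 <= s <= t0 ->
  EE P (grid_error n s) <= C.
Proof.
have [C C0 cC] := continuous_bounded_itv 0 t0 continuous_c.
have [K K0 XK] := EE_X_bounded.
have dC s : 0 <= s <= t0 -> EE P (fun w => diffusion s w ^+ 2) <= C * K.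
  move=> st; rewrite (EE_eq P (fun w => diffusion_sqrE s w)) EEZ; last exact: X_L1.
  apply: (@le_trans _ _ (C * EE P (X s))).
    by apply: ler_wpM2r; [exact: EE_ge0|exact: le_trans (ler_norm _) (cC _ st)].
  exact: ler_wpM2l.
exists (C * K + C * K) => n s s0t.
have eC : EE P (fun w => el_val (grid_elementary n) s w ^+ 2) <= C * K.
  have /andP[s0 st] := s0t; move: s0; rewrite le_eqVlt => /predU1P[<-|s0].
    rewrite (EE_eq P (g := fun=> 0)) ?EE_cst ?mulr_ge0// => w.
    by rewrite grid_val0 expr0n.
  have [|u [ut _ uE]] := @grid_val n s; first by rewrite s0.
  by rewrite (EE_eq P (g := fun w => diffusion u w ^+ 2)) ?dC// => w; rewrite uE.
apply: (@le_trans _ _ (EE P (fun w => el_val (grid_elementary n) s w ^+ 2 + diffusion s w ^+ 2))).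
  apply: EE_le; [exact: grid_error_L1|exact: L1D|move=> w].
  rewrite /grid_error (le_trans (ler_normB _ _))// !ger0_norm ?sqr_ge0//.
by rewrite EED//; apply: lerD => //; exact: dC.
Qed.

Lemma grid_error_cvg s : 0 < s <= t0 -> EE P (grid_error n s) @[n --> \oo] --> (0 : R).
Proof.
move=> s0t; have /choice[u hu] : forall n, exists u : R, `|u - s| <= t0 / n.+1%:R /\
    forall w, el_val (grid_elementary n) s w = diffusion u w.
  by move=> n; have [u [_ h1 h2]] := grid_val n s0t; exists u.
have us n : `|u n - s| <= t0.
  apply: (le_trans (hu n).1); rewrite ler_pdivrMr// ler_peMr// ler1n//.
have uns : u n @[n --> \oo] --> s.
  have t0n : t0 / n.+1%:R @[n --> \oo] --> (0 : R).
    by rewrite -(mulr0 t0); apply: cvgM; [exact: cvg_cst|exact: cvg_harmonic].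
  apply/cvgrPdist_le => r r0; have /cvgrPdist_le /(_ r r0) := t0n.
  apply: filterS => n; rewrite sub0r normrN distrC; apply: le_trans.
  exact: le_trans (hu n).1 (ler_norm _).
rewrite (_ : (fun n => _) = fun n => EE P (fun w => `|c (u n) * X (u n) w - c s * X s w|)).
  exact: (weighted_X_L1_continuous continuous_c us uns).
apply/funext => n; apply: EE_eq => w; rewrite /grid_error (hu n).2.
by rewrite !diffusion_sqrE.
Qed.

Definition grid_total (n : nat) : R := \int[mu]_(s in `[0, t0]) EE P (grid_error n s).

Lemma measurable_grid_error n : measurable_fun setT (fun p : R * Omega => grid_error n p.1 p.2).
Proof.
apply: measurableT_comp => //; apply: measurable_funB; apply: measurable_funX.
  exact: measurable_el_val_joint.
exact: measurable_diffusion_joint.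
Qed.

Let measurable_EE_grid_error n : measurable_fun setT (fun s => EE P (grid_error n s)).
Proof.
have mg : measurable_fun setT (fun p : R * Omega => (grid_error n p.1 p.2)%:E).
  by apply: measurableT_comp => //; exact: measurable_grid_error.
have := @measurable_fun_fubini_tonelli_F _ _ _ _ R P _ mg.
move=> /(_ (fun p => normr_ge0 _)) H.
by apply: (measurableT_comp _ H).
Qed.

Lemma grid_total_cvg : grid_total n @[n --> \oo] --> (0 : R).
Proof.
have [C HC] := grid_error_bounded.
have C0 : 0 <= C by apply: le_trans (HC 0%N 0 _); [apply: EE_ge0 => w; exact: normr_ge0|rewrite lexx].
(* Dominated convergence is applied on the interval without 0, where the grid processes need not
   converge to the diffusion coefficient. *)
have ic : mu.-integrable `]0, t0] (EFin \o (fun=> C)).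
  apply: (@integrableS _ _ _ mu `[0, t0]) => //.
    by move=> x /=; rewrite !in_itv /= => /andP[/ltW -> ->].
  by apply: continuous_integrable_itv; exact: cst_continuous.
have H := @dominated_cvg _ _ _ mu `]0, t0]%classic (measurable_itv _)
  (fun n s => (EE P (grid_error n s))%:E) (fun=> 0%E) (fun=> C%:E).
have {}H : (\int[mu]_(s in `]0%R, t0]) (EE P (grid_error n s))%:E)%E @[n --> \oo] -->
    (\int[mu]_(s in `]0%R, t0]) (0 : \bar R))%E.
  apply: H => //.
  - move=> n; apply: measurable_funTS.
    exact: (measurableT_comp (f := EFin) _ (measurable_EE_grid_error n)).
  - move=> s /=; rewrite in_itv /= => s0t.
    by apply: cvg_EFin; [exact: nearW|exact: grid_error_cvg].
  - move=> n s /=; rewrite in_itv /= => /andP[s0 st]; rewrite lee_fin.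
    rewrite ger0_norm; last by apply: EE_ge0 => w; exact: normr_ge0.
    by apply: HC; rewrite ltW.
rewrite integral0 in H.
have /fine_cvgP[_] := H.
suff -> : (fine \o (fun n => \int[mu]_(s in `]0%R, t0]) (EE P (grid_error n s))%:E))%E = grid_total by [].
apply/funext => n /=; rewrite /grid_total -Rintegral_itv_obnd_cbnd//.
apply: le_integrable ic => //.
  apply: measurable_funTS; exact: (measurableT_comp (f := EFin) _ (measurable_EE_grid_error n)).
move=> s /=; rewrite in_itv /= => /andP[s0 st]; rewrite lee_fin (ger0_norm C0).
by rewrite ger0_norm ?HC ?(ltW s0)//; apply: EE_ge0 => w; exact: normr_ge0.
Qed.

Let grid_error_itv n s w : mu.-integrable `[0, s] (EFin \o (grid_error n)^~ w).
Proof.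
have [C1 h1] := el_val_bounded (grid_elementary n) w; have [C2 h2] := diffusion_bounded s w.
apply: (@integrable_bounded_itv _ _ _ (C1 ^+ 2 + C2 ^+ 2)).
  exact: (measurable_fun_pair1 w (measurable_grid_error n)).
move=> u us; rewrite /grid_error normr_id (le_trans (ler_normB _ _))// lerD// normrX lerXn2r ?nnegrE//.
- by rewrite (le_trans _ (h1 0)).
- by rewrite (le_trans _ (h2 u us)).
- exact: h2.
Qed.

Let grid_error_total n s : 0 <= s <= t0 ->
  L1 P (fun w => \int[mu]_(u in `[0, s]) grid_error n u w) /\
  EE P (fun w => \int[mu]_(u in `[0, s]) grid_error n u w) <= grid_total n.
Proof.
move=> /andP[s0 st]; have [C HC] := grid_error_bounded.
have pre r : 0 <= r -> r <= t0 -> L1 P (fun w => \int[mu]_(u in `[0, r]) grid_error n u w) /\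
  EE P (fun w => \int[mu]_(u in `[0, r]) grid_error n u w) = \int[mu]_(u in `[0, r]) EE P (grid_error n u).
  move=> r0 rt; apply: (@EE_time_integral _ _ _ P _ r C r0 (measurable_grid_error n)).
    by move=> w; exact: grid_error_itv.
  move=> u /andP[u0 ur]; split; first exact: grid_error_L1.
  rewrite (EE_eq P (g := grid_error n u)) ?HC// ?u0 ?(le_trans ur)// => w.
  by rewrite /grid_error normr_id.
have [j1 _] := pre s s0 st; have [j2 e2] := pre t0 t0_ge0 (lexx _).
split => //; rewrite /grid_total -e2; apply: EE_le => // w.
apply: fine_le; [by apply: integrable_fin_num => //; exact: grid_error_itv..|].
apply: ge0_subset_integral => //.
- exact: (measurable_int _ (grid_error_itv n t0 w)).
- by move=> x; rewrite lee_fin normr_ge0.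
- by move=> x /=; rewrite !in_itv /= => /andP[-> /le_trans]; exact.
Qed.

Lemma grid_sqdist n s : 0 <= s <= t0 ->
  L1 P (sqdist diffusion s (grid_elementary n)) /\
  EE P (sqdist diffusion s (grid_elementary n)) <= grid_total n.
Proof.
move=> s0t; have [j1 e1] := grid_error_total n s0t.
have /andP[s0 st] := s0t.
have pos u w : 0 <= u <= s -> 0 <= el_val (grid_elementary n) u w.
  move=> /andP[u0 us]; move: u0; rewrite le_eqVlt => /predU1P[<-|u0].
    by rewrite grid_val0.
  have [|v [_ _ ->]] := @grid_val n u; first by rewrite u0 (le_trans us).
  by rewrite mulr_ge0// sqrtr_ge0.
have pt w : sqdist diffusion s (grid_elementary n) w <= \int[mu]_(u in `[0, s]) grid_error n u w.
  rewrite /sqdist; apply: le_Rintegral; [exact: measurable_itv| | |].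
  - exact: (sqdist_integrable measurable_diffusion_joint (diffusion_bounded s)).
  - exact: (grid_error_itv n s w).
  move=> u /=; rewrite in_itv /= => us; rewrite /grid_error.
  have x0 := pos u w us; set x := el_val _ _ _ in x0 *.
  have y0 : 0 <= diffusion u w by rewrite mulr_ge0// sqrtr_ge0.
  set y := diffusion u w in y0 *.
  rewrite subr_sqr normrM -[(x - y) ^+ 2]real_normK ?num_real// expr2 ler_wpM2l//.
  by rewrite (le_trans (ler_normB _ _))// (ger0_norm x0) (ger0_norm y0) ler_norm.
have j2 : L1 P (sqdist diffusion s (grid_elementary n)).
  apply: L1_le j1.
    exact: (measurable_sqdist hF _ measurable_diffusion_joint).
  by move=> w; rewrite ger0_norm ?pt// sqdist_ge0.
by split => //; apply: le_trans e1; exact: EE_le.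
Qed.

Lemma mart_sqr_bound n s : 0 <= s <= t0 ->
  L2 P (fun w => mart s w - el_integral B (grid_elementary n) s w) /\
  EE P (fun w => (mart s w - el_integral B (grid_elementary n) s w) ^+ 2) <= 2 * grid_total n.
Proof.
move=> s0t; have /andP[s0 st] := s0t; have [j1 e1] := grid_sqdist n s0t.
have [j2 e2] := @ito_sqr_bound _ _ _ P F B hF hB diffusion s s0 measurable_diffusion_joint
  (diffusion_bounded s) (mart s) (grid_elementary n) (measurable_mart s) (itoX s0t) j1.
by split => //; apply: (le_trans e2); rewrite ler_pM2l.
Qed.

Lemma mart_L2 s : 0 <= s <= t0 -> L2 P (mart s).
Proof.
move=> s0t; have /andP[s0 st] := s0t.
have [j1 _] := mart_sqr_bound 0%N s0t.
rewrite (_ : mart s = fun w => (mart s w - el_integral B (grid_elementary 0) s w) + el_integral B (grid_elementary 0) s w).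
  by apply: L2D => //; apply: (el_integral_L2 hF hB s0); exact: grid_coef_L2.
by apply/funext => w; rewrite subrK.
Qed.

(** The mean is treated as the mean of a product with the constant 1, so that [EE_mul_cvg]
    applies. *)
Lemma mart_mean0 s : 0 <= s <= t0 -> EE P (mart s) = 0.
Proof.
move=> s0t; have /andP[s0 st] := s0t.
have h2 : 2 * grid_total n @[n --> \oo] --> (0 : R).
  by rewrite -(mulr0 2); apply: cvgM; [exact: cvg_cst|exact: grid_total_cvg].
have g0 n : 0 <= 2 * grid_total n.
  by apply: le_trans (mart_sqr_bound n s0t).2; apply: EE_ge0 => w; exact: sqr_ge0.
have [] := @EE_mul_cvg _ _ _ P (mart s) (fun=> 1) (fun n => el_integral B (grid_elementary n) s)
  (fun _ _ => 1) (fun n => 2 * grid_total n) 0.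
- by move=> n; apply: (el_integral_L2 hF hB s0); exact: grid_coef_L2.
- by move=> n; exact: L2_cst.
- by move=> n; have [] := mart_sqr_bound n s0t.
- by move=> n; rewrite subrr; exact: L2_cst.
- by move=> n; have [] := mart_sqr_bound n s0t.
- by move=> n; rewrite subrr expr0n EE_cst.
- by [].
- rewrite (_ : (fun n => _) = fun=> 0); first exact: cvg_cst.
  apply/funext => n; rewrite -[RHS](el_integral_mean0 hF hB s0 (grid_coef_L2 (n := n))).
  by apply: EE_eq => w; rewrite mulr1.
by move=> _ <-; apply: EE_eq => w; rewrite mulr1.
Qed.

Definition qvar (s : R) : R := \int[mu]_(u in `[0, s]) (c u * EE P (X u)).

(** By the isometry the left-hand side is E \int_0^s phi_n^2, which differs from E \int_0^s H^2 by
    at most [grid_total n]. *)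
Lemma grid_isometry_cvg s r : 0 <= s <= r -> r <= t0 ->
  EE P (fun w => el_integral B (grid_elementary n) s w * el_integral B (grid_elementary n) r w)
    @[n --> \oo] --> qvar s.
Proof.
move=> sr rt; have /andP[s0 ler] := sr.
have s0t : 0 <= s <= t0 by rewrite s0 (le_trans ler).
have [C HC] := grid_error_bounded.
have i1 w : mu.-integrable `[0, s] (EFin \o (fun u => diffusion u w ^+ 2)).
  apply: continuous_integrable_itv => u.
  apply: (@cvg_comp _ _ _ (diffusion ^~ w) (fun x : R => x ^+ 2) _ (nbhs (diffusion u w))).
    exact: continuous_diffusion.
  exact: exprn_continuous.
have i2 n w : mu.-integrable `[0, s] (EFin \o (fun u => el_val (grid_elementary n) u w ^+ 2)).
  have [C1 h1] := el_val_bounded (grid_elementary n) w.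
  apply: (@integrable_bounded_itv _ _ _ (C1 ^+ 2)).
    by apply: measurable_funX; exact: measurable_el_val.
  move=> u us; rewrite normrX lerXn2r ?nnegrE//.
  by rewrite (le_trans _ (h1 0)).
have [K K0 XK] := EE_X_bounded; have [D D0 cD] := continuous_bounded_itv 0 t0 continuous_c.
have [jq eq] : L1 P (fun w => \int[mu]_(u in `[0, s]) (diffusion u w ^+ 2)) /\
    EE P (fun w => \int[mu]_(u in `[0, s]) (diffusion u w ^+ 2)) = qvar s.
  have [|u us|j e] := @EE_time_integral _ _ _ P (fun u w => diffusion u w ^+ 2) s (D * K) s0 _ i1.
  - by apply: measurable_funX; exact: measurable_diffusion_joint.
  - split; first exact: diffusion_sqr_L1.
    rewrite (EE_eq P (g := fun w => c u * X u w)); last first.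
      by move=> w; rewrite ger0_norm ?sqr_ge0// diffusion_sqrE.
    rewrite EEZ; last exact: X_L1.
    apply: (@le_trans _ _ (D * EE P (X u))); last exact: ler_wpM2l.
    apply: ler_wpM2r; first exact: EE_ge0.
    apply: (le_trans (ler_norm _)); apply: cD.
    by have /andP[u0 us'] := us; rewrite u0 (le_trans us')// (le_trans ler).
  split => //; rewrite e; apply: eq_Rintegral => u _.
  by rewrite (EE_eq P (fun w => diffusion_sqrE u w)) EEZ//; exact: X_L1.
have je n : L1 P (fun w => \int[mu]_(u in `[0, s]) (el_val (grid_elementary n) u w ^+ 2)) /\
    EE P (fun w => \int[mu]_(u in `[0, s]) (el_val (grid_elementary n) u w ^+ 2)) =
    EE P (fun w => el_integral B (grid_elementary n) s w * el_integral B (grid_elementary n) r w).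
  have := el_integral_isometry hF hB sr (grid_coef_L2 (n := n)).
  have e w : (\int[mu]_(u in `[0%R, s]) (el_val (grid_elementary n) u w ^+ 2)%:E =
     (\int[mu]_(u in `[0, s]) (el_val (grid_elementary n) u w ^+ 2))%:E)%E.
    by rewrite /Rintegral fineK//; apply: integrable_fin_num => //; exact: i2.
  under [X in _ = X -> _]eq_integral do rewrite e.
  move=> iso; have jj : L1 P (fun w => \int[mu]_(u in `[0, s]) (el_val (grid_elementary n) u w ^+ 2)).
    apply: (@L1_ge0 _ _ _ _ _ (EE P (fun w => el_integral B (grid_elementary n) s w *
       el_integral B (grid_elementary n) r w))); last by rewrite iso.
      apply: measurableT_comp => //.
      apply: (@measurable_time_integral _ _ _ s (fun p => el_val (grid_elementary n) p.1 p.2 ^+ 2)).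
        by apply: measurable_funX; exact: measurable_el_val_joint.
      by move=> p; exact: sqr_ge0.
    by move=> w; apply: Rintegral_ge0 => u _; exact: sqr_ge0.
  by split => //; apply: EFin_inj; rewrite -EE_EFin.
apply/cvgrPdist_le => e e0.
have /cvgrPdist_le /(_ e e0) := grid_total_cvg.
apply: filterS => n; rewrite sub0r normrN => gn.
rewrite distrC -(je n).2 -eq -EEB//; last exact: (je n).1.
have [j1 e1] := grid_error_total n s0t.
apply: (le_trans _ (le_trans (ler_norm _) gn)); apply: le_trans e1.
apply: (@le_trans _ _ (EE P (fun w => `|\int[mu]_(u in `[0, s]) (el_val (grid_elementary n) u w ^+ 2)
   - \int[mu]_(u in `[0, s]) (diffusion u w ^+ 2)|))).
  by rewrite /EE; apply: le_normr_Rintegral => //; apply: L1B => //; exact: (je n).1.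
apply: EE_le => //; first by apply: L1_abs; apply: L1B => //; exact: (je n).1.
move=> w; rewrite -RintegralB//; apply: le_normr_Rintegral => //.
by under [_ \o _]eq_fun do rewrite /= EFinB; apply: integrableB => //; [exact: i2|exact: i1].
Qed.

Lemma mart_cov s r : 0 <= s <= r -> r <= t0 -> EE P (fun w => mart s w * mart r w) = qvar s.
Proof.
move=> /andP[s0 sr] rt.
have r0 := le_trans s0 sr.
have hs : 0 <= s <= t0 by rewrite s0 (le_trans sr).
have hr : 0 <= r <= t0 by rewrite r0.
have h2 : 2 * grid_total n @[n --> \oo] --> (0 : R).
  by rewrite -(mulr0 2); apply: cvgM; [exact: cvg_cst|exact: grid_total_cvg].
have [] := @EE_mul_cvg _ _ _ P (mart s) (mart r) (fun n => el_integral B (grid_elementary n) s)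
  (fun n => el_integral B (grid_elementary n) r) (fun n => 2 * grid_total n) (qvar s) => //.
- by move=> n; apply: (el_integral_L2 hF hB s0); exact: grid_coef_L2.
- by move=> n; apply: (el_integral_L2 hF hB r0); exact: grid_coef_L2.
- by move=> n; have [] := mart_sqr_bound n hs.
- by move=> n; have [] := mart_sqr_bound n hr.
- by move=> n; have [] := mart_sqr_bound n hs.
- by move=> n; have [] := mart_sqr_bound n hr.
- by apply: grid_isometry_cvg; rewrite ?s0.
Qed.

Let cl (s : R) : R := Num.max 0 (Num.min s t0).

(** Frozen outside [0, t0], so that path continuity, square integrability and zero mean hold at all
    real times without side conditions. *)
Definition mart_clamp (s : R) (w : Omega) : R := mart (cl s) w.
Local Notation M1 := mart_clamp.

Let cl_id (s : R) : 0 <= s <= t0 -> cl s = s.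
Proof. by move=> /andP[s0 st]; rewrite /cl (min_idPl st) (max_idPr s0). Qed.

Let continuous_cl : continuous cl.
Proof. exact: continuous_clamp. Qed.

Lemma X_mart_clamp s w : 0 <= s <= t0 ->
  X s w = \int[mu]_(u in `[0, s]) (a u - h u * X u w) + M1 s w.
Proof. by move=> st; rewrite /M1 cl_id// /mart; ring. Qed.

Lemma continuous_mart_clamp w : continuous (M1 ^~ w).
Proof.
have cd : continuous (fun u => a u - h u * X u w).
  by move=> u; apply: cvgB; [exact: ca|exact: continuous_hX].
pose mp s := X s w - prim (fun u => a u - h u * X u w) s.
have cmp : continuous mp by move=> s; apply: cvgB; [exact: cX|exact: continuous_prim].
rewrite (_ : M1 ^~ w = mp \o cl); last first.
  apply/funext => s /=; rewrite /M1 /mart /mp primE//.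
  by have /andP[] := clampP s.
by move=> s; apply: (@cvg_comp _ _ _ cl mp _ (nbhs (cl s))); [exact: continuous_cl|exact: cmp].
Qed.

Definition qvar_density (s : R) : R := sigma ^+ 2 * h s * EE P (X s).
Local Notation cm := qvar_density.

Lemma continuous_qvar_density : continuous cm.
Proof. by move=> s; apply: cvgM; [exact: continuous_c|exact: continuous_mean]. Qed.

Let qvarE s : 0 <= s -> qvar s = prim cm s.
Proof. by move=> s0; rewrite /qvar primE//; exact: continuous_qvar_density. Qed.

Lemma mart_clamp_L2 s : L2 P (M1 s).
Proof. by apply: mart_L2; exact: clampP. Qed.

Lemma mart_clamp_mean0 s : EE P (M1 s) = 0.
Proof. by apply: mart_mean0; exact: clampP. Qed.

Lemma mart_clamp_cov s r : 0 <= s -> s <= r -> r <= t0 ->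
  EE P (fun w => M1 s w * M1 r w) = prim cm s.
Proof.
move=> s0 sr rt; rewrite -qvarE// /M1 !cl_id ?mart_cov ?s0 ?(le_trans s0)//.
exact: le_trans rt.
Qed.

Lemma mart_clamp_bound : exists2 Q : R, 0 <= Q & forall s r, EE P (fun w => `|M1 s w * M1 r w|) <= Q.
Proof.
have [Q Q0 HQ] := continuous_bounded_itv 0 t0 (continuous_prim continuous_qvar_density).
exists (Q + Q) => [|s r]; first exact: addr_ge0.
have sqQ x : EE P (fun w => M1 x w ^+ 2) <= Q.
  have clx := clampP x.
  rewrite (EE_eq P (g := fun w => M1 (cl x) w * M1 (cl x) w)); last first.
    by move=> w; rewrite expr2 /M1 (cl_id clx).
  have /andP[x0 xt] := clx.
  by rewrite mart_clamp_cov// (le_trans (ler_norm _))// HQ.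
apply: (@le_trans _ _ (EE P (fun w => M1 s w ^+ 2 + M1 r w ^+ 2))).
  apply: EE_le.
  - by apply: L1_abs; apply: L2M; exact: mart_clamp_L2.
  - by apply: L1D; [exact: (mart_clamp_L2 s).2|exact: (mart_clamp_L2 r).2].
  move=> w; rewrite normrM -[M1 s w ^+ 2]real_normK ?num_real// -[M1 r w ^+ 2]real_normK ?num_real//.
  have := normr_ge0 (M1 s w); have := normr_ge0 (M1 r w).
  set x := `|M1 s w|; set y := `|M1 r w| => y0 x0.
  by have := sqr_ge0 (x - y); have := mulr_ge0 x0 y0; rewrite sqrrB; lra.
by rewrite EED; [apply: lerD|exact: (mart_clamp_L2 s).2|exact: (mart_clamp_L2 r).2].
Qed.

End cir_process.

(** * Variation of constants *)

Section monotone.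
Import HBNNSimple.

(* Integration is monotone without measurability of the smaller nonnegative function. *)
Lemma Rintegral_le_cst {R : realType} (f : R -> R) (s C : R) : 0 <= s ->
  (forall u, 0 <= u <= s -> 0 <= f u <= C) ->
  \int[@lebesgue_measure R]_(u in `[0, s]) f u <= C * s.
Proof.
move=> s0 fC.
have C0 : 0 <= C.
  by have /andP[f0 /(le_trans f0)] : 0 <= f 0 <= C by apply: fC; rewrite lexx.
have -> : C * s = fine (C * s)%:E by [].
have intC : (\int[@lebesgue_measure R]_(u in `[0%R, s]) C%:E = (C * s)%:E)%E.
  by rewrite integral_cst//= lebesgue_measure_itv /= lte_fin; case: ltgtP s0 => // [s0 _|<- _]; rewrite ?subr0 ?mulr0 ?mule0// -EFinB subr0.
have le : (\int[@lebesgue_measure R]_(u in `[0%R, s]) (f u)%:E <= (C * s)%:E)%E.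
  rewrite ge0_integralE; last by move=> u; rewrite /= in_itv /= lee_fin => /fC /andP[].
  apply: ge_ereal_sup => _ [g gf <-].
  rewrite -integralT_nnsfun -intC [leRHS]integral_mkcond.
  apply: ge0_le_integral => //.
  - by move=> u _; rewrite lee_fin; exact: (@fun_ge0 _ _ g).
  - by apply: measurableT_comp => //; exact: measurable_funPT.
  - by apply/(measurable_restrictT _ _).1.
  move=> u _; apply: le_trans (gf u) _; rewrite /patch; case: ifPn => //.
  by rewrite inE /= in_itv /= lee_fin => /fC /andP[].
have ge : (0 <= \int[@lebesgue_measure R]_(u in `[0%R, s]) (f u)%:E)%E.
  by apply: integral_ge0 => u; rewrite /= in_itv /= lee_fin => /fC /andP[].
rewrite /Rintegral fine_le// ?ge0_fin_numE// (le_lt_trans le)// ltry//.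
Qed.

End monotone.

Section linear_drift.
Context {d : measure_display} {Omega : measurableType d} {R : realType}.
Variable P : probability Omega R.
Local Notation mu := (@lebesgue_measure R).
Variables (a h e k q : R -> R) (t0 : R) (X M : R -> Omega -> R).
Hypotheses (t0_ge0 : 0 <= t0) (ca : continuous a) (ch : continuous h)
  (ce : continuous e) (ck : continuous k) (cq : continuous q)
  (de : forall s : R, is_derive s 1 e (k s)) (ke : forall s : R, k s = e s * h s).
Hypotheses (cX : forall w, continuous (X ^~ w)) (cM : forall w, continuous (M ^~ w))
  (XM : forall (s : R) w, 0 <= s <= t0 ->
    X s w = \int[mu]_(u in `[0, s]) (a u - h u * X u w) + M s w)
  (X_L1 : L1 P (X t0)) (M_L2 : forall s : R, L2 P (M s)) (M_mean0 : forall s : R, EE P (M s) = 0)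
  (M_cov : forall s r : R, 0 <= s -> s <= r -> r <= t0 -> EE P (fun w => M s w * M r w) = prim q s)
  (M_bound : exists2 Q : R, 0 <= Q & forall s r : R, EE P (fun w => `|M s w * M r w|) <= Q).

Let t0t : 0 <= t0 <= t0. Proof. by rewrite t0_ge0 lexx. Qed.

Let mM (s : R) : measurable_fun setT (M s).
Proof. by have [] := M_L2 s. Qed.

Let continuous_kM w : continuous (fun u => k u * M u w).
Proof. by move=> u; apply: cvgM; [exact: ck|exact: cM]. Qed.

Let measurable_M_joint : measurable_fun setT (fun p : R * Omega => M p.1 p.2).
Proof. exact: continuous_measurable_joint. Qed.

Definition kM_int (s : R) (w : Omega) : R := prim (fun u => k u * M u w) s.
Local Notation W := kM_int.

Let WE (s : R) w : 0 <= s -> W s w = \int[mu]_(u in `[0, s]) (k u * M u w).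
Proof. by move=> s0; rewrite /W primE. Qed.

(** The product rule is applied to e D, where D = X - M is differentiable along each path: (e D)' =
    e (a - h X) + e h D = e a - e h M. No stochastic calculus enters. *)
Lemma integrating_factor w : e t0 * X t0 w =
  \int[mu]_(s in `[0, t0]) (e s * a s) + (e t0 * M t0 w - W t0 w).
Proof.
pose D := prim (fun u => a u - h u * X u w).
have cdr : continuous (fun u => a u - h u * X u w).
  move=> u; apply: cvgB; first exact: ca.
  by apply: cvgM; [exact: ch|exact: cX].
have cea : continuous (fun s => e s * a s).
  by move=> s; apply: cvgM; [exact: ce|exact: ca].
have ckm : continuous (fun s => k s * (X s w - D s)).
  move=> s; apply: cvgM; first exact: ck.
  by apply: cvgB; [exact: cX|exact: continuous_prim].
have MD s : 0 <= s <= t0 -> M s w = X s w - D s.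
  by move=> st; rewrite XM// /D primE//; [ring|case/andP: st].
have H : \int[mu]_(u in `[0, t0]) (e u * a u - k u * (X u w - D u)) = e t0 * D t0 - e 0 * D 0.
  apply: (@continuous_FTC_zero R (fun s => e s * D s)) => //.
    by move=> s; apply: cvgB; [exact: cea|exact: ckm].
  move=> s; have d1 := de s; have d2 := is_derive_prim s cdr.
  have d3 : is_derive s 1 (e * D) (e s *: (a s - h s * X s w) + D s *: k s).
    exact: is_deriveM.
  apply: is_derive_eq d3 _; rewrite /GRing.scale /= ke; ring.
have HB := @RintegralB _ _ _ mu `[0, t0]%classic _ _ (measurable_itv _)
   (continuous_integrable_itv 0 t0 cea) (continuous_integrable_itv 0 t0 ckm).
have HW : W t0 w = \int[mu]_(u in `[0, t0]) (k u * (X u w - D u)).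
  rewrite WE//; apply: eq_Rintegral => u; rewrite inE /= in_itv /= => u0.
  by rewrite MD.
have HD0 : D 0 = 0 by exact: prim0.
rewrite HW (MD _ t0t) mulrBr.
rewrite HD0 mulr0 subr0 in H.
by rewrite -H HB; ring.
Qed.

Let k_bound : exists2 C : R, 0 <= C & forall s : R, 0 <= s <= t0 -> `|k s| <= C.
Proof. exact: continuous_bounded_itv. Qed.

Let mk : measurable_fun setT (fun p : R * Omega => k p.1).
Proof. by apply: measurableT_comp => //; exact: continuous_measurable. Qed.

Let M_bound' : exists2 Q : R, 0 <= Q & forall s r : R, 0 <= s <= t0 -> `|k s| * EE P (fun w => `|M s w * M r w|) <= Q.
Proof.
have [Q Q0 HQ] := M_bound; have [C C0 HC] := k_bound.
exists (C * Q) => [|s r st]; first exact: mulr_ge0.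
by apply: ler_pM => //; [exact: EE_ge0|exact: HC].
Qed.

(** Fubini's theorem under the time integral that defines [W]. The third clause supplies the bound
    on absolute moments that a second use of Fubini, in [W_sqr], requires. *)
Let W_mul (s r : R) : 0 <= s <= t0 ->
  [/\ L1 P (fun w => W s w * M r w),
      EE P (fun w => W s w * M r w) = \int[mu]_(u in `[0, s]) (k u * EE P (fun w => M u w * M r w)) &
      EE P (fun w => `|W s w * M r w|) <= \int[mu]_(u in `[0, s]) (`|k u| * EE P (fun w => `|M u w * M r w|))].
Proof.
move=> st; have /andP[s0 sle] := st.
have [Q Q0 HQ] := M_bound; have [C C0 HC] := k_bound.
have jM u : L1 P (fun w => M u w * M r w) by apply: L2M.
have cont w : continuous (fun u => k u * (M u w * M r w)).
  by move=> u; apply: cvgM; [exact: ck|apply: cvgM; [exact: cM|exact: cvg_cst]].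
have conta w : continuous (fun u => `|k u * (M u w * M r w)|).
  by move=> u; apply: cvg_norm; exact: cont.
have mf : measurable_fun setT (fun p : R * Omega => k p.1 * (M p.1 p.2 * M r p.2)).
  apply: measurable_funM => //; apply: measurable_funM => //.
  exact: measurableT_comp.
have absE u : EE P (fun w => `|k u * (M u w * M r w)|) = `|k u| * EE P (fun w => `|M u w * M r w|).
  rewrite -EEZ; last exact: L1_abs.
  by apply: EE_eq => w; rewrite normrM.
have absb u : 0 <= u <= s -> EE P (fun w => `|k u * (M u w * M r w)|) <= C * Q.
  move=> /andP[u0 us]; rewrite absE; apply: ler_pM => //; first exact: EE_ge0.
  by apply: HC; rewrite u0 (le_trans us).
have [j1 e1] := @EE_time_integral _ _ _ P (fun u w => k u * (M u w * M r w)) s (C * Q) s0 mf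
  (fun w => continuous_integrable_itv 0 s (cont w)) (fun u us => conj (L1Z (k u) (jM u)) (absb u us)).
have absb2 u : 0 <= u <= s -> EE P (fun w => `| `|k u * (M u w * M r w)| |) <= C * Q.
  by move=> us; under EE_eq do rewrite normr_id; exact: absb.
have [j2 e2] := @EE_time_integral _ _ _ P (fun u w => `|k u * (M u w * M r w)|) s (C * Q) s0
  (measurableT_comp (@normr_measurable _ _) mf)
  (fun w => continuous_integrable_itv 0 s (conta w)) (fun u us => conj (L1_abs (L1Z (k u) (jM u))) (absb2 u us)).
have eW w : \int[mu]_(u in `[0, s]) (k u * (M u w * M r w)) = W s w * M r w.
  rewrite WE// mulrC.
  have <- : \int[mu]_(u in `[0, s]) (M r w * (k u * M u w)) = M r w * \int[mu]_(u in `[0, s]) (k u * M u w).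
    by apply: RintegralZl => //; exact: (continuous_integrable_itv 0 s (@continuous_kM w)).
  by apply: eq_Rintegral => u _; ring.
have jW : L1 P (fun w => W s w * M r w).
  by move: j1; under [X in L1 _ X -> _]eq_fun do rewrite eW.
split => //.
- rewrite -(EE_eq P eW) e1; apply: eq_Rintegral => u _; by rewrite EEZ.
- under eq_Rintegral do rewrite -absE.
  rewrite -e2; apply: EE_le => //; first exact: L1_abs.
  move=> w; rewrite -eW; apply: le_normr_Rintegral => //.
  exact: continuous_integrable_itv.
Qed.

Let W_L1 (s : R) : 0 <= s <= t0 -> L1 P (W s) /\ EE P (W s) = 0.
Proof.
move=> st; have /andP[s0 sle] := st.
have [Q Q0 HQ] := M_bound; have [C C0 HC] := k_bound.
have jM u : L1 P (M u) by exact: L2_L1.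
have absb u : 0 <= u <= s -> EE P (fun w => `|k u * M u w|) <= C * (1 + Q).
  move=> us; rewrite (EE_eq P (g := fun w => `|k u| * `|M u w|)); last by move=> w; rewrite normrM.
  rewrite EEZ; last exact: L1_abs.
  apply: ler_pM => //; first exact: EE_ge0.
    by apply: HC; have /andP[-> /le_trans] := us; exact.
  have jMM : L1 P (fun w => `|M u w * M u w|) by apply: L1_abs; exact: L2M.
  apply: (@le_trans _ _ (EE P (fun w => 1 + `|M u w * M u w|))).
    apply: EE_le; [exact: L1_abs|by apply: L1D => //; exact: L1_cst|move=> w].
    rewrite normrM -expr2; have := sqr_ge0 (`|M u w| - 1); have := normr_ge0 (M u w).
    by set x := `|M u w|; rewrite sqrrB1; lra.
  rewrite EED//; last exact: L1_cst.
  by rewrite EE_cst lerD2l.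
have [j1 e1] := @EE_time_integral _ _ _ P (fun u w => k u * M u w) s (C * (1 + Q)) s0
  (measurable_funM mk measurable_M_joint)
  (fun w => continuous_integrable_itv 0 s (@continuous_kM w)) (fun u us => conj (L1Z (k u) (jM u)) (absb u us)).
have eW : W s = fun w => \int[mu]_(u in `[0, s]) (k u * M u w) by apply/funext => w; rewrite WE.
rewrite eW; split => //; rewrite e1.
rewrite (@eq_Rintegral _ _ _ _ _ (fun=> 0)) ?Rintegral_cst//= ?mul0r// => u _.
by rewrite EEZ// M_mean0 mulr0.
Qed.

Lemma mean_formula : e t0 * EE P (X t0) = \int[mu]_(s in `[0, t0]) (e s * a s).
Proof.
have [jW eW] := W_L1 t0t.
have jM : L1 P (M t0) by exact: L2_L1.
rewrite -EEZ// (EE_eq P integrating_factor) EED; [|exact: L1_cst|by apply: L1B => //; exact: L1Z].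
rewrite EE_cst EEB//; last exact: L1Z.
by rewrite EEZ// M_mean0 eW; ring.
Qed.

(** The covariance of W_s and M_r for r >= s, which does not depend on r since E (M_u M_r) depends
    only on u when u <= r. *)
Let p (s : R) : R := prim (fun u => k u * prim q u) s.

Let continuous_kq : continuous (fun u => k u * prim q u).
Proof. by move=> u; apply: cvgM; [exact: ck|exact: continuous_prim]. Qed.

Let WM_cov (s r : R) : 0 <= s -> s <= r -> r <= t0 -> EE P (fun w => W s w * M r w) = p s.
Proof.
move=> s0 sr rt; have [|_ -> _] := @W_mul s r; first by rewrite s0 (le_trans sr).
rewrite /p primE//; apply: eq_Rintegral => u; rewrite inE /= in_itv /= => /andP[u0 us].
by rewrite M_cov// (le_trans us).
Qed.

Let continuous_W w : continuous (W ^~ w).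
Proof. exact: continuous_prim. Qed.

(** Along each path W^2 is the time integral of 2 W W' = 2 k W M, so only the covariance of W_s and
    M_s is needed, and no double integral. *)
Let W_sqr : L1 P (fun w => W t0 w ^+ 2) /\
  EE P (fun w => W t0 w ^+ 2) = \int[mu]_(s in `[0, t0]) (2 * (k s * p s)).
Proof.
have [Q Q0 HQ] := M_bound'; have [C C0 HC] := k_bound.
pose cl (s : R) : R := Num.max 0 (Num.min s t0).
have clP (s : R) : 0 <= cl s <= t0.
  by rewrite /cl le_max lexx /= ge_max t0_ge0 ge_min lexx orbT.
have cl_id (s : R) : 0 <= s <= t0 -> cl s = s.
  by move=> /andP[s0 st]; rewrite /cl (min_idPl st) (max_idPr s0).
have ccl : continuous cl by exact: continuous_clamp.
have cWc w : continuous (fun s => W (cl s) w).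
  by move=> s; apply: (@cvg_comp _ _ _ cl (W ^~ w) _ (nbhs (cl s))); [exact: ccl|exact: continuous_W].
have mWj : measurable_fun setT (fun p : R * Omega => W (cl p.1) p.2).
  apply: (@continuous_measurable_joint _ _ _ (fun s => W (cl s))) => // s.
  by apply: L1_meas; exact: (W_L1 (clP s)).1.
pose f s w := 2 * (k s * (W (cl s) w * M s w)).
have cf w : continuous (f ^~ w).
  move=> s; apply: cvgM; first exact: cvg_cst.
  by apply: cvgM; [exact: ck|apply: cvgM; [exact: cWc|exact: cM]].
have mf : measurable_fun setT (fun p : R * Omega => f p.1 p.2).
  apply: measurable_funM => //; apply: measurable_funM => //.
  exact: measurable_funM.
have jWM s : 0 <= s <= t0 -> L1 P (fun w => W (cl s) w * M s w).
  by move=> st; have [] := @W_mul (cl s) s (clP s).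
have Wb s : 0 <= s <= t0 -> EE P (fun w => `|W (cl s) w * M s w|) <= Q * t0.
  move=> st; have [_ _] := @W_mul (cl s) s (clP s); rewrite cl_id// => /le_trans; apply.
  have /andP[s0 sle] := st.
  apply: (@le_trans _ _ (Q * s)); last exact: ler_wpM2l.
  apply: Rintegral_le_cst => // u /andP[u0 us].
  by rewrite mulr_ge0 ?EE_ge0//= HQ// u0 (le_trans us).
have fb s : 0 <= s <= t0 -> EE P (fun w => `|f s w|) <= 2 * (C * (Q * t0)).
  move=> st; rewrite (EE_eq P (g := fun w => (2 * `|k s|) * `|W (cl s) w * M s w|)); last first.
    by move=> w; rewrite /f normrM normrM ger0_norm// mulrA.
  rewrite EEZ; last by apply: L1_abs; exact: jWM.
  rewrite -mulrA; apply: ler_wpM2l => //; apply: ler_pM => //; first exact: EE_ge0.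
  - exact: HC.
  - exact: Wb.
have [j1 e1] := @EE_time_integral _ _ _ P f t0 (2 * (C * (Q * t0))) t0_ge0 mf
  (fun w => continuous_integrable_itv 0 t0 (cf w))
  (fun s st => conj (L1Z 2 (L1Z (k s) (jWM s st))) (fb s st)).
have eW w : \int[mu]_(s in `[0, t0]) f s w = W t0 w ^+ 2.
  pose g s := 2 * (k s * (W s w * M s w)).
  have cg : continuous g.
    move=> s; apply: cvgM; first exact: cvg_cst.
    by apply: cvgM; [exact: ck|apply: cvgM; [exact: continuous_W|exact: cM]].
  transitivity (\int[mu]_(s in `[0, t0]) g s).
    by apply: eq_Rintegral => s; rewrite inE /= in_itv /= => st; rewrite /f cl_id.
  have -> : \int[mu]_(s in `[0, t0]) g s = W t0 w * W t0 w - W 0 w * W 0 w.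
    apply: (@continuous_FTC_zero R (fun s => W s w * W s w)) => // s.
    have d1 := is_derive_prim s (@continuous_kM w).
    have d2 : is_derive s 1 (W ^~ w * W ^~ w) (W s w *: (k s * M s w) + W s w *: (k s * M s w)).
      exact: is_deriveM.
    apply: is_derive_eq d2 _; rewrite /GRing.scale /= /g; ring.
  by rewrite [W 0 w]prim0 mul0r subr0 expr2.
split; first by move: j1; under [X in L1 _ X -> _]eq_fun do rewrite eW.
rewrite -(EE_eq P eW) e1; apply: eq_Rintegral => s; rewrite inE /= in_itv /= => st.
have /andP[s0 sle] := st.
rewrite EEZ; last by apply: L1Z; exact: jWM.
by rewrite EEZ ?jWM// cl_id// WM_cov.
Qed.

Lemma variance_formula :
  L2 P (fun w => e t0 * (X t0 w - EE P (X t0))) /\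
  EE P (fun w => (e t0 * (X t0 w - EE P (X t0))) ^+ 2) = \int[mu]_(s in `[0, t0]) (e s ^+ 2 * q s).
Proof.
have [jW2 eW2] := W_sqr; have [jWM eWM _] := W_mul t0 t0t.
have [jW eW] := W_L1 t0t.
have Z w : e t0 * (X t0 w - EE P (X t0)) = e t0 * M t0 w - W t0 w.
  by rewrite mulrBr mean_formula integrating_factor; ring.
have jM2 : L1 P (fun w => M t0 w ^+ 2) := (M_L2 t0).2.
have WL2 : L2 P (W t0) := conj (L1_meas jW) jW2.
rewrite (_ : (fun w => e t0 * (X t0 w - EE P (X t0))) = fun w => e t0 * M t0 w - W t0 w); last exact/funext.
split; first by apply: L2B => //; exact: L2Z.
rewrite (EE_eq P (g := fun w => (e t0 ^+ 2 * M t0 w ^+ 2 - (2 * e t0) * (W t0 w * M t0 w)) + W t0 w ^+ 2)); last first.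
  by move=> w; rewrite Z; ring.
rewrite EED//; last by apply: L1B; exact: L1Z.
rewrite EEB; [|exact: L1Z|exact: L1Z].
rewrite !EEZ// eW2 (WM_cov t0_ge0 (lexx _) (lexx _)).
rewrite (EE_eq P (g := fun w => M t0 w * M t0 w)); last by move=> w; rewrite expr2.
rewrite (M_cov t0_ge0 (lexx _) (lexx _)).
have cp : continuous p by exact: continuous_prim.
have ckp : continuous (fun s => 2 * (k s * p s)).
  by move=> s; apply: cvgM; [exact: cvg_cst|apply: cvgM; [exact: ck|exact: cp]].
have ceq : continuous (fun s => e s ^+ 2 * q s).
  move=> s; apply: cvgM; last exact: cq.
  by apply: (@cvg_comp _ _ _ e (fun x : R => x ^+ 2) _ (nbhs (e s))); [exact: ce|exact: exprn_continuous].
pose r := prim (fun s => 2 * (k s * p s)).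
(* [G] is E (e M - W)^2 as a function of time: the three terms are e^2 E M^2, - 2 e E (W M) and E
   W^2. In its derivative all terms containing k cancel, which leaves e^2 q. *)
pose G s := e s * e s * prim q s - 2 * (e s * p s) + r s.
have -> : \int[mu]_(s in `[0, t0]) (e s ^+ 2 * q s) = G t0 - G 0.
  apply: (@continuous_FTC_zero R G) => // s.
  have d1 := de s; have d2 := is_derive_prim s cq.
  have d3 : is_derive s 1 p (k s * prim q s) by exact: is_derive_prim.
  have d4 : is_derive s 1 r (2 * (k s * p s)) by exact: is_derive_prim.
  have d5 : is_derive s 1 (e * e) (e s *: k s + e s *: k s) by exact: is_deriveM.
  have d6 : is_derive s 1 (e * e * prim q) ((e * e) s *: q s + prim q s *: (e s *: k s + e s *: k s)).
    exact: is_deriveM.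
  have d7 : is_derive s 1 (e * p) (e s *: (k s * prim q s) + p s *: k s) by exact: is_deriveM.
  have d8 : is_derive s 1 (2 *: (e * p)) (2 *: (e s *: (k s * prim q s) + p s *: k s)).
    exact: is_deriveZ.
  have d9 : is_derive s 1 G (e s * e s * q s + prim q s * (e s * k s + e s * k s) -
      2 * (e s * (k s * prim q s) + p s * k s) + 2 * (k s * p s)).
    exact: (is_deriveD (is_deriveB d6 d8) d4).
  by apply: is_derive_eq d9 _; ring.
have -> : \int[mu]_(s in `[0, t0]) (2 * (k s * p s)) = r t0 by rewrite /r primE.
have [p0 r0] : p 0 = 0 /\ r 0 = 0 by split; exact: prim0.
rewrite /G p0 r0 prim0; ring.
Qed.

End linear_drift.

(** * The bridge before and at the terminal time *)

Section negligible.
Context {d : measure_display} {T : measurableType d} {R : realType}.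
Variable P : probability T R.

Lemma negligible_le (A D K : set T) : measurable A -> measurable D ->
  P.-negligible K -> A `<=` D `|` K -> (P A <= P D)%E.
Proof.
move=> mA mD [K0 [mK0 PK0 KK0]] ADK.
apply: (@le_trans _ _ (P (D `|` K0))).
  apply: le_measure; rewrite ?inE//; first exact: measurableU.
  by move=> x /ADK[|/KK0]; [left|right].
rewrite (le_trans (measureU2 _ mD mK0))// [X in (_ + X)%E]PK0 adde0; exact: lexx.
Qed.

Lemma negligible_cvg0 (A D : nat -> set T) (K : set T) : (forall n, measurable (A n)) ->
  (forall n, measurable (D n)) -> P.-negligible K -> (forall n, A n `<=` D n `|` K) ->
  P (D n) @[n --> \oo] --> 0%E -> P (A n) @[n --> \oo] --> 0%E.
Proof.
move=> mA mD nK ADK D0.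
apply: (@squeeze_cvge _ _ _ _ (fun=> 0%E) (fun n => P (A n)) (fun n => P (D n))) => //.
  by apply: nearW => n; rewrite measure_ge0/=; apply: negligible_le (ADK n).
exact: cvg_cst.
Qed.

End negligible.

(** * Extension of functions beyond an interval, and a bound on weighted means *)

Section real_functions.
Context {R : realType}.
Implicit Types (f : R -> R).

Definition clamp (t s : R) : R := Num.max 0 (Num.min s t).

Lemma clamp_itv (t s : R) : 0 <= t -> 0 <= clamp t s <= t.
Proof. by move=> t0; rewrite /clamp le_max lexx /= ge_max t0 ge_min lexx orbT. Qed.

Lemma clamp_id (t s : R) : 0 <= s <= t -> clamp t s = s.
Proof. by move=> /andP[s0 st]; rewrite /clamp (min_idPl st) (max_idPr s0). Qed.

(** Coefficients and paths that are continuous on an interval only thus become continuous on the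
    whole line without changing on [0, t]. *)
Lemma continuous_within_clamp f (A : set R) (t : R) : 0 <= t ->
  {within A, continuous f} -> `[0, t] `<=` A -> continuous (f \o clamp t).
Proof.
move=> t0 cf sA s.
have Ac : A (clamp t s) by apply: sA; rewrite /= in_itv /=; exact: clamp_itv.
have /subspace_continuousP/(_ _ Ac) h := cf.
apply: (@cvg_comp _ _ _ (clamp t) f _ (within A (nbhs (clamp t s)))) => //.
move=> U wU.
have h2 : \forall u \near s, A (clamp t u) -> U (clamp t u) := @continuous_clamp R t s _ wU.
apply: filterS h2 => u; apply.
by apply: sA; rewrite /= in_itv /=; exact: clamp_itv.
Qed.

(** The increment f u - f t is the difference quotient, which converges, times u - t. *)
Lemma C1_on_co_continuous (T : R) f : C1_on_co T f -> {within `[0, T[, continuous f}.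
Proof.
move=> [df [_ hdf]]; apply/subspace_continuousP => t tT.
have q := hdf t; rewrite /= in_itv /= in tT; have {q} := q tT.
move=> q; have c0 : (fun u : R => u - t) @ within `[0, T[ (t^') --> (0 : R).
  rewrite -[X in _ --> X](subrr t); apply: cvgB; last exact: cvg_cst.
  by apply: (@cvg_within_filter _ _ id); exact: nbhs_dnbhs.
have h0 : (fun u : R => (f u - f t) / (u - t) * (u - t)) @ within `[0, T[ (t^') --> (0 : R).
  by rewrite -[X in _ --> X](mulr0 (df t)); apply: cvgM; [exact: q|exact: c0].
move: h0 => /cvgrPdist_lt h.
apply/cvgrPdist_lt => e e0; have := h e e0.
rewrite !near_withinE; apply: filterS => u hu Au.
have [->|ut] := eqVneq u t; first by rewrite subrr normr0.
have := hu ut Au; rewrite sub0r normrN divfK ?subr_eq0// distrC; exact.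
Qed.

Lemma Rintegral_le_cst_itv (f : R -> R) (b c k : R) : continuous f -> b <= c ->
  (forall u : R, b <= u <= c -> f u <= k) -> \int[@lebesgue_measure R]_(u in `[b, c]) f u <= k * (c - b).
Proof.
move=> cf bc fk.
apply: (@le_trans _ _ (\int[@lebesgue_measure R]_(u in `[b, c]) k)).
  apply: le_Rintegral => //; first exact: continuous_integrable_itv.
    by apply: continuous_integrable_itv => u; exact: cvg_cst.
rewrite Rintegral_cst//= lebesgue_measure_itv /= lte_fin.
by case: ltgtP bc => //= ->; rewrite subrr.
Qed.

(** The integral is split at r: before r the increasing weight is at most e r, after r at most e t.
    For the bridge the first term vanishes as t tends to T with r fixed, and the second is small
    when r is close to T. *)
Lemma weighted_mean_le (e f : R -> R) (r t C m : R) : continuous e -> continuous f ->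
  0 <= r -> r <= t -> 0 <= C -> (forall s : R, 0 <= f s <= C) -> (forall s, 0 < e s) ->
  (forall s u : R, 0 <= s -> s <= u -> u <= t -> e s <= e u) ->
  e t * m = \int[@lebesgue_measure R]_(s in `[0, t]) (e s * f s) ->
  m <= C * r * (e r / e t) + C * (t - r).
Proof.
move=> ce cf r0 rt C0 fC e0 e_le em.
have cef : continuous (fun s => e s * f s).
  by move=> s; apply: cvgM; [exact: ce|exact: cf].
have b1 : \int[@lebesgue_measure R]_(s in `[0, r]) (e s * f s) <= e r * C * (r - 0).
  apply: Rintegral_le_cst_itv => // u /andP[u0 ur].
  by have /andP[f0 f1] := fC u; apply: ler_pM => //; [exact: ltW|exact: e_le].
have b2 : \int[@lebesgue_measure R]_(s in `[r, t]) (e s * f s) <= e t * C * (t - r).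
  apply: Rintegral_le_cst_itv => // u /andP[u0 ur].
  have /andP[f0 f1] := fC u; apply: ler_pM => //; first exact: ltW.
  by apply: e_le => //; exact: le_trans u0.
have et0 := e0 t.
rewrite -(ler_pM2l et0) em (Rintegral_cat cef r0 rt).
apply: le_trans (lerD b1 b2) _; rewrite subr0.
by rewrite le_eqVlt; apply/orP; left; apply/eqP; field; rewrite gt_eqF.
Qed.

End real_functions.

(** * A version of the bridge with continuous paths, and its moments *)

Section version.
Context {d : measure_display} {Omega : measurableType d} {R : realType}.
Variables (P : probability Omega R) (F : R -> set (set Omega)) (B X : R -> Omega -> R).
Variables (T sigma : R) (a h : R -> R).
Hypotheses (hF : usual_filtration P F) (hB : brownian_motion P F B) (hT : 0 < T)
  (hsigma : 0 <= sigma) (ha_ge0 : forall t, 0 <= t <= T -> 0 <= a t)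
  (ha_cont : {within `[0, T], continuous a})
  (hh_gt0 : forall t, 0 <= t < T -> 0 < h t)
  (hh_cont : {within `[0, T[, continuous h})
  (hX : cir_bridge P T a h sigma F B X).
Local Notation mu := (@lebesgue_measure R).

Lemma bridge_exceptional_set : exists N : set Omega, [/\ measurable N, P N = 0%E &
  forall w, ~ N w -> {within `[0, T], continuous (X ^~ w)} /\ X 0 w = 0].
Proof.
case: hX => _ _ c0 x0 _.
have [N [mN PN sN]] : P.-negligible (~` [set w | {within `[0, T], continuous (X ^~ w)} /\ X 0 w = 0]).
  by apply: filterS2 c0 x0 => w; split.
exists N; split => // w Nw; apply: contrapT => h0; exact: Nw (sN _ h0).
Qed.

Variable N : set Omega.
Hypotheses (mN : measurable N) (PN : P N = 0%E)
  (XN : forall w, ~ N w -> {within `[0, T], continuous (X ^~ w)} /\ X 0 w = 0).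

Let fF : filtration F. Proof. by case: hF. Qed.

Let T0 : 0 <= T. Proof. exact: ltW. Qed.

(** Zero on the exceptional null set and frozen outside [0, T], so every path is continuous on the
    whole line. Adaptedness survives because null sets lie in F_0. *)
Definition bridge_version (s : R) (w : Omega) : R := \1_(~` N) w * X (clamp T s) w.
Local Notation Y := bridge_version.

Let nN : P.-negligible N. Proof. by exists N; split. Qed.

Lemma bridge_versionE (s : R) w : 0 <= s <= T -> ~ N w -> Y s w = X s w.
Proof. by move=> sT Nw; rewrite /Y indicE mem_set// mul1r clamp_id. Qed.

Lemma bridge_version_out (s : R) w : N w -> Y s w = 0.
Proof. by move=> Nw; rewrite /Y indicE memNset ?mul0r// => /(_ Nw). Qed.

Lemma bridge_version_ge0 (s : R) w : 0 <= Y s w.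
Proof.
by rewrite /Y mulr_ge0//; case: hX => _ + _ _ _; apply; exact: clamp_itv.
Qed.

Lemma bridge_version0 w : Y 0 w = 0.
Proof.
case: (pselect (N w)) => Nw; first exact: bridge_version_out.
by rewrite bridge_versionE ?lexx// (XN Nw).2.
Qed.

Lemma continuous_bridge_version w : continuous (Y ^~ w).
Proof.
case: (pselect (N w)) => Nw.
  rewrite (_ : Y ^~ w = cst 0); first by move=> s; exact: cvg_cst.
  by apply/funext => s; exact: bridge_version_out.
move=> s; apply: cvgM; first exact: cvg_cst.
exact: (continuous_within_clamp T0 (XN Nw).1 (@subset_refl _ _)).
Qed.

Lemma bridge_version_adapted (s : R) : 0 <= s <= T -> measurable_wrt (F s) (Y s).
Proof.
move=> sT; have /andP[s0 _] := sT; have sF := filtration_sigma fF s0.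
apply: measurable_wrtM => //; last by rewrite clamp_id//; case: hX => + _ _ _ _; exact.
apply/measurable_wrtP => //; apply: measurable_indic; apply: measurableC.
apply: sub_sigma_algebra; case: fF => _ _ /(_ 0 s (lexx _) s0); apply.
by case: hF => _ + _; apply; exact: nN.
Qed.

Lemma bridge_version_meas (s : R) : measurable_fun setT (Y s).
Proof.
have sT := clamp_itv s T0; have /andP[s0 _] := sT.
rewrite (_ : Y s = Y (clamp T s)); last first.
  by apply/funext => w; rewrite /Y [clamp T (clamp _ _)]clamp_id.
exact: (adapted_meas fF s0 (bridge_version_adapted sT)).
Qed.

Lemma bridge_version_ae (t : R) (f : R -> R) : 0 <= t <= T -> measurable_fun setT f ->
  (\int[P]_w (f (X t w))%:E = \int[P]_w (f (Y t w))%:E)%E.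
Proof.
move=> tT mf; have /andP[t0 _] := tT.
have mX : measurable_fun setT (X t).
  by apply: (adapted_meas fF t0); case: hX => + _ _ _ _; exact.
apply: ae_eq_integral => //.
- by apply: measurableT_comp => //; exact: measurableT_comp.
- by apply: measurableT_comp => //; apply: (measurableT_comp mf); exact: bridge_version_meas.
exists N; split => // w /= h0; apply: contrapT => Nw; apply: h0 => _.
by rewrite bridge_versionE.
Qed.

Lemma bridge_expectation (t : R) : 0 <= t <= T -> L1 P (Y t) -> 'E_P[X t]%E = (EE P (Y t))%:E.
Proof.
move=> tT jY; rewrite unlock -EE_EFin//.
exact: (bridge_version_ae (f := id)).
Qed.

Lemma bridge_variance (t : R) : 0 <= t <= T -> L2 P (Y t) ->
  'V_P[X t]%E = (EE P (fun w => (Y t w - EE P (Y t)) ^+ 2))%:E.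
Proof.
move=> tT jY; have jY1 := L2_L1 jY; rewrite /variance unlock bridge_expectation//= unlock.
rewrite -EE_EFin; last by have [] := L2B jY (L2_cst P (EE P (Y t))).
rewrite -(@bridge_version_ae t (fun x => (x - EE P (Y t)) ^+ 2))//.
by apply: measurable_funX; exact: measurable_funB.
Qed.

Section before_T.
Variable t0 : R.
Hypotheses (t0_gt0 : 0 < t0) (t0T : t0 < T).
Let t0_ge0 : 0 <= t0. Proof. exact: ltW. Qed.

Local Notation hc := (h \o clamp t0).
Local Notation ac := (a \o clamp t0).
Local Notation Yc := (fun s => Y (clamp t0 s)).

Lemma continuous_hc : continuous hc.
Proof.
apply: (continuous_within_clamp t0_ge0 hh_cont) => s /=.
by rewrite !in_itv /= => /andP[-> /le_lt_trans]; apply.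
Qed.

Lemma continuous_ac : continuous ac.
Proof.
apply: (continuous_within_clamp t0_ge0 ha_cont) => s /=.
by rewrite !in_itv /= => /andP[-> /le_trans]; apply; exact: ltW.
Qed.

Lemma continuous_Yc w : continuous (Yc ^~ w).
Proof.
move=> s; apply: (@cvg_comp _ _ _ (clamp t0) (Y ^~ w) _ (nbhs (clamp t0 s))).
  exact: continuous_clamp.
exact: continuous_bridge_version.
Qed.

Let clampT (s : R) : 0 <= clamp t0 s <= T.
Proof. by have /andP[-> /le_trans] := clamp_itv s t0_ge0; apply; exact: ltW. Qed.

Let hc_ge0 (s : R) : 0 <= hc s.
Proof. by apply/ltW/hh_gt0; have /andP[-> /le_lt_trans] := clamp_itv s t0_ge0; exact. Qed.

Let Yc_ge0 (s : R) w : 0 <= Yc s w.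
Proof. exact: bridge_version_ge0. Qed.

Let mYc (s : R) : measurable_fun setT (Yc s).
Proof. exact: bridge_version_meas. Qed.

Let aYc (s : R) : 0 <= s <= t0 -> measurable_wrt (F s) (Yc s).
Proof.
move=> st; rewrite /= clamp_id//; apply: bridge_version_adapted.
by have /andP[-> /le_trans] := st; apply; exact: ltW.
Qed.

Let Yc_clamp (s : R) : Yc s = Yc (Num.max 0 (Num.min s t0)).
Proof. by rewrite /= [clamp t0 (Num.max _ _)]clamp_id//; exact: clamp_itv. Qed.

(** Off the null sets where the version differs from [X] or the equation fails, both error terms are
    those given for [X], so convergence in probability carries over. *)
Lemma bridge_ito_limit (s : R) : 0 <= s <= t0 ->
  ito_limit P F B (diffusion hc sigma Yc) s (mart ac hc Yc s).
Proof.
move=> st; have /andP[s0 st0] := st.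
have sT : 0 <= s < T by rewrite s0 (le_lt_trans st0).
have sub (u : R) : 0 <= u <= s -> 0 <= u <= t0 by move=> /andP[-> /le_trans]; exact.
have subT (u : R) : 0 <= u <= s -> 0 <= u <= T.
  by move=> /sub /andP[-> /le_trans]; apply; exact: ltW.
case: hX => _ _ _ _ /(_ s sT) [M [[mM [phi [[mD cD] [mI cI]]]] eqM]].
have YcE (u : R) w : ~ N w -> 0 <= u <= s -> Yc u w = X u w.
  by move=> Nw us; rewrite /= clamp_id ?bridge_versionE//; [exact: subT|exact: sub].
have hcE (u : R) : 0 <= u <= s -> hc u = h u by move=> us; rewrite /= clamp_id//; exact: sub.
have acE (u : R) : 0 <= u <= s -> ac u = a u by move=> us; rewrite /= clamp_id//; exact: sub.
have mset (Z : Omega -> \bar R) (e : R) : measurable_fun setT Z ->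
    measurable [set w | (e%:E <= `|Z w|)%E].
  move=> mZ; rewrite -[X in measurable X]setTI; apply: emeasurable_fun_c_infty => //.
  exact: measurableT_comp.
have mH := measurable_diffusion_joint sigma continuous_hc mYc continuous_Yc.
exists (fun n => elementary_of_simple (phi n)) => e e0; split.
- apply: (@negligible_cvg0 _ _ _ P _ (fun n => [set w | (e%:E <= `|\int[mu]_(u in `[0%R, s])
      ((sp_val (phi n) u w - sigma * Num.sqrt (h u * X u w)) ^+ 2)%:E|)%E]) N) => //.
  + by move=> n; apply: measurable_ge_set; exact: measurable_sqdist.
  + by move=> n; apply: mset; exact: mD.
  + move=> n w /= ew; case: (pselect (N w)) => Nw; [by right|left].
    rewrite /= gee0_abs; last by apply: integral_ge0 => u _; rewrite lee_fin sqr_ge0.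
    move: ew; set D := sqdist _ _ _ _.
    have -> : D = \int[mu]_(u in `[0, s]) ((sp_val (phi n) u w - sigma * Num.sqrt (h u * X u w)) ^+ 2).
      apply: eq_Rintegral => u; rewrite inE /= in_itv /= => us.
      by rewrite /diffusion (hcE _ us) (YcE _ _ Nw us).
    rewrite /Rintegral; set I := integral _ _ _.
    have : (0 <= I)%E by apply: integral_ge0 => u _; rewrite lee_fin sqr_ge0.
    by case: I => //= _ _; rewrite leey.
  + exact: cD.
- have [K [mK PK sK]] := eqM.
  apply: (@negligible_cvg0 _ _ _ P _ (fun n => [set w | (e%:E <= `|(sp_integral B (phi n) s w - M w)%:E|)%E]) (N `|` K)) => //.
  + move=> n; apply: measurable_ge_set; apply: measurableT_comp => //; apply: measurable_funB.
      exact: (measurable_el_integral fF hB s0).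
    exact: (measurable_mart continuous_ac continuous_hc hc_ge0 mYc Yc_ge0 continuous_Yc).
  + by move=> n; apply: mset; exact: mI.
  + by apply: negligibleU => //; exists K; split.
  + move=> n w /= ew; case: (pselect (N w)) => Nw; first by right; left.
    case: (pselect (K w)) => Kw; first by right; right.
    left; rewrite /= lee_fin; move: ew; rewrite /mart.
    have -> : \int[mu]_(u in `[0, s]) (ac u - hc u * Yc u w) = \int[mu]_(u in `[0, s]) (a u - h u * X u w).
      apply: eq_Rintegral => u; rewrite inE /= in_itv /= => us.
      by have /= -> := hcE _ us; have /= -> := acE _ us; have /= -> := YcE _ _ Nw us.
    have /= -> : Yc s w = X s w by apply: YcE => //; rewrite s0 lexx.
    have -> : X s w = \int[mu]_(u in `[0, s]) (a u - h u * X u w) + M w.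
      by apply: contrapT => hne; exact: Kw (sK _ hne).
    by rewrite (addrC _ (M w)) addrK.
  + exact: cI e e0.
Qed.

Local Notation ec := (fun s => expR (prim hc s)).

Lemma continuous_ec : continuous ec.
Proof.
move=> s; apply: (@cvg_comp _ _ _ (prim hc) expR _ (nbhs (prim hc s))).
  by apply: continuous_prim; exact: continuous_hc.
exact: continuous_expR.
Qed.

Let is_derive_ec (s : R) : is_derive s 1 ec (ec s * hc s).
Proof.
exact: (is_derive1_comp (is_derive_expR (prim hc s)) (is_derive_prim s continuous_hc)).
Qed.

Lemma bridge_moments :
  [/\ L2 P (Y t0),
      ec t0 * EE P (Y t0) = \int[mu]_(s in `[0, t0]) (ec s * ac s),
      EE P (fun w => (ec t0 * (Y t0 w - EE P (Y t0))) ^+ 2) =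
        \int[mu]_(s in `[0, t0]) (ec s ^+ 2 * (sigma ^+ 2 * hc s * EE P (Yc s))),
      continuous (fun s => EE P (Yc s)) &
      forall s : R, L1 P (Yc s)].
Proof.
have ca := continuous_ac; have ch := continuous_hc; have cY := continuous_Yc.
have ito := bridge_ito_limit.
have eY : Y t0 = Yc t0 by rewrite /= clamp_id// t0_ge0 lexx.
have jL1s := X_L1 fF hB t0_gt0 ca ch hc_ge0 mYc Yc_clamp Yc_ge0 cY ito.
have jL1 := jL1s t0.
have jL2 := X_L2 fF hB t0_gt0 ca ch hc_ge0 mYc Yc_clamp Yc_ge0 cY ito t0.
have cm := continuous_mean fF hB t0_gt0 ca ch hc_ge0 mYc Yc_clamp Yc_ge0 cY ito.
have cq := continuous_qvar_density fF hB t0_gt0 ca ch hc_ge0 mYc Yc_clamp Yc_ge0 cY ito.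
have cM w : continuous (mart_clamp ac hc t0 Yc ^~ w) by exact: continuous_mart_clamp.
have ML2 := mart_clamp_L2 fF hB t0_gt0 ca ch hc_ge0 hsigma aYc mYc Yc_clamp Yc_ge0 cY ito.
have M0 := mart_clamp_mean0 fF hB t0_gt0 ca ch hc_ge0 hsigma aYc mYc Yc_clamp Yc_ge0 cY ito.
have Mc := mart_clamp_cov fF hB t0_gt0 ca ch hc_ge0 hsigma aYc mYc Yc_clamp Yc_ge0 cY ito.
have Mb := mart_clamp_bound fF hB t0_gt0 ca ch hc_ge0 hsigma aYc mYc Yc_clamp Yc_ge0 cY ito.
have ck : continuous (fun s => ec s * hc s).
  by move=> s; apply: cvgM; [exact: continuous_ec|exact: ch].
have XM s w := @X_mart_clamp _ _ _ ac hc t0 Yc s w.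
rewrite eY.
have [_ V] := variance_formula (h := hc) (k := fun s => ec s * hc s) (q := qvar_density P hc sigma Yc)
  t0_ge0 ca ch continuous_ec ck cq is_derive_ec (fun=> erefl) cY cM XM jL1 ML2 M0 Mc Mb.
have m := mean_formula (h := hc) (k := fun s => ec s * hc s)
  t0_ge0 ca ch continuous_ec ck is_derive_ec (fun=> erefl) cY cM XM jL1 ML2 M0 Mb.
by split.
Qed.

Lemma integral_h (s r : R) : 0 <= s -> s <= r -> r <= t0 ->
  (\int[mu]_(u in `[s, r[) (h u)%:E = (prim hc r - prim hc s)%:E)%E.
Proof.
move=> s0 sr rt; have ch := continuous_hc.
transitivity (\int[mu]_(u in `[s, r[) (hc u)%:E)%E.
  apply: eq_integral => u; rewrite inE /= in_itv /= => /andP[su /ltW ut].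
  by rewrite clamp_id// (le_trans s0)// (le_trans ut).
rewrite integral_itv_bndo_bndc; last first.
  by apply: measurable_funTS; apply: measurableT_comp => //; exact: continuous_measurable.
rewrite !primE//; last exact: le_trans sr.
rewrite (Rintegral_cat ch s0 sr) addrAC subrr add0r /Rintegral fineK//.
by apply: integrable_fin_num => //; exact: continuous_integrable_itv.
Qed.

Lemma expeR_integral_h (s k : R) : 0 <= s <= t0 ->
  expeR (- (k%:E * \int[mu]_(u in `[s, t0[) (h u)%:E))%E = (expR (k * (prim hc s - prim hc t0)))%:E.
Proof. by move=> /andP[s0 st]; rewrite integral_h//= -mulrN opprB. Qed.

Lemma integral_itv_EFin (f : R -> R) : continuous f ->
  (\int[mu]_(s in `[0%R, t0]) (f s)%:E = (\int[mu]_(s in `[0, t0]) f s)%:E)%E.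
Proof.
move=> cf; rewrite /Rintegral fineK//.
by apply: integrable_fin_num => //; exact: continuous_integrable_itv.
Qed.

Lemma bridge_mean_before :
  ('E_P[X t0] = \int[mu]_(s in `[0%R, t0]) ((a s)%:E *
     expeR (- \int[mu]_(u in `[s, t0[) (h u)%:E)))%E.
Proof.
have [jY m _ _ _] := bridge_moments; have ca := continuous_ac; have ce := continuous_ec.
have t0T' : 0 <= t0 <= T by rewrite t0_ge0 ltW.
rewrite bridge_expectation//; last exact: L2_L1.
have e0 : 0 < ec t0 := expR_gt0 _.
have cf : continuous (fun s => (ec t0)^-1 * (ec s * ac s)).
  by move=> s; apply: cvgM; [exact: cvg_cst|apply: cvgM; [exact: ce|exact: ca]].
transitivity (\int[mu]_(s in `[0%R, t0]) ((ec t0)^-1 * (ec s * ac s))%:E)%E.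
  rewrite integral_itv_EFin// RintegralZl//.
    by rewrite -m mulKf// gt_eqF.
  by apply: continuous_integrable_itv => s; apply: cvgM; [exact: ce|exact: ca].
apply: eq_integral => s; rewrite inE /= in_itv /= => st.
have := expeR_integral_h 1 st; rewrite mul1e => ->.
by rewrite mul1r expRB [clamp t0 s]clamp_id// -EFinM; congr EFin; ring.
Qed.

Lemma bridge_variance_before :
  ('V_P[X t0] = (sigma ^+ 2)%:E * \int[mu]_(s in `[0%R, t0[)
     ((h s)%:E * 'E_P[X s] * expeR (- (2%:E * \int[mu]_(u in `[s, t0[) (h u)%:E))))%E.
Proof.
have [jY m v cm j1] := bridge_moments; have ch := continuous_hc; have ce := continuous_ec.
have t0T' : 0 <= t0 <= T by rewrite t0_ge0 ltW.
rewrite bridge_variance//.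
have e0 : 0 < ec t0 := expR_gt0 _.
pose G (s : R) : R := ec s ^+ 2 * (hc s * EE P (Yc s)).
have cG : continuous G.
  move=> s; apply: cvgM; last by apply: cvgM; [exact: ch|exact: cm].
  by apply: (@cvg_comp _ _ _ ec (fun x : R => x ^+ 2) _ (nbhs (ec s))); [exact: ce|exact: exprn_continuous].
have cf : continuous (fun s => ec t0 ^- 2 * G s).
  by move=> s; apply: cvgM; [exact: cvg_cst|exact: cG].
have iG : mu.-integrable `[0, t0] (EFin \o G) by exact: continuous_integrable_itv.
have IG k : \int[mu]_(s in `[0, t0]) (k * G s) = k * \int[mu]_(s in `[0, t0]) G s.
  exact: RintegralZl.
have V2 : ec t0 ^+ 2 * EE P (fun w => (Y t0 w - EE P (Y t0)) ^+ 2) = sigma ^+ 2 * \int[mu]_(s in `[0, t0]) G s.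
  have j2 := (L2B jY (L2_cst P (EE P (Y t0)))).2.
  rewrite -(EEZ _ j2) -IG.
  rewrite (EE_eq P (g := fun w => (ec t0 * (Y t0 w - EE P (Y t0))) ^+ 2)); last first.
    by move=> w; rewrite exprMn.
  by rewrite v; apply: eq_Rintegral => s _; rewrite /G; ring.
transitivity ((sigma ^+ 2)%:E * \int[mu]_(s in `[0%R, t0[) (ec t0 ^- 2 * G s)%:E)%E.
  rewrite integral_itv_bndo_bndc; last first.
    by apply: measurable_funTS; apply: measurableT_comp => //; exact: continuous_measurable.
  rewrite integral_itv_EFin// -EFinM; congr EFin.
  apply: (mulfI (x := ec t0 ^+ 2)); first by rewrite sqrf_eq0 gt_eqF.
  by rewrite V2 IG mulrCA mulVKf// sqrf_eq0 gt_eqF.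
rewrite /G.
congr (_ * _)%E; apply: eq_integral => s; rewrite inE /= in_itv /= => /andP[s0 st].
have sT : 0 <= s <= t0 by rewrite s0 ltW.
have eY : Yc s = Y s by rewrite /= clamp_id.
have hs : h (clamp t0 s) = h s by rewrite clamp_id.
rewrite expeR_integral_h// bridge_expectation; last 2 first.
- by rewrite s0 ltW// (lt_trans st).
- by rewrite -eY.
rewrite eY hs -!EFinM; congr EFin.
have -> : expR (2 * (prim hc s - prim hc t0)) = (ec s / ec t0) ^+ 2.
  by rewrite -expRB -expRM_natl.
have ident (x y u z : R) : x != 0 -> x ^- 2 * (y ^+ 2 * (u * z)) = u * z * (y / x) ^+ 2.
  by move=> x0; field.
by apply: ident; rewrite gt_eqF.
Qed.

End before_T.

(** * Behaviour at the terminal time *)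

Section terminal.
Variables (hbar C : R).
Hypotheses (hbar_gt0 : 0 < hbar) (hh_lb : forall t, 0 < t < T -> hbar / (T - t) <= h t)
  (aC : forall t, 0 <= t <= T -> a t <= C).
Local Notation I s t := (\int[mu]_(u in `[s, t[) (h u)%:E)%E.

Let I_ge0 (s t : R) : 0 <= s -> t <= T -> (0 <= I s t)%E.
Proof.
move=> s0 tT; apply: integral_ge0 => u; rewrite /= in_itv /= => /andP[su ut].
by rewrite lee_fin ltW// hh_gt0// (le_trans s0)// (lt_le_trans ut).
Qed.

Let I_cat (s r t : R) : 0 <= s -> s <= r -> r <= t -> 0 < t < T -> (I s t = I s r + I r t)%E.
Proof.
move=> s0 sr rt /andP[t0 tT]; rewrite !(integral_h t0 tT)//; try exact: le_trans rt.
  by rewrite -EFinD; congr EFin; ring.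
exact: le_trans sr.
Qed.

(** On this interval h >= hbar / (T - t), and the length is (T - t) / 2. Every halving of the
    remaining time thus adds hbar / 2 to the integral, and repeated halving makes it exceed any
    bound, without the logarithm. *)
Let I_half (t : R) : 0 < t < T -> ((hbar / 2)%:E <= I t ((t + T) / 2)%R)%E.
Proof.
move=> /andP[t0 tT]; set r := (t + T) / 2.
have tr : t < r by rewrite /r; lra.
have rT : r < T by rewrite /r; lra.
have r0 : 0 < r by exact: lt_trans tr.
apply: (@le_trans _ _ (\int[mu]_(u in `[t, r[) (hbar / (T - t))%:E)%E).
  rewrite integral_cst//= lebesgue_measure_itv /= lte_fin tr -EFinB -EFinM lee_fin.
  have -> // : hbar / (T - t) * (r - t) = hbar / 2.
  by rewrite /r; field; lra.
(* The clamped function agrees with h on the interval and is continuous everywhere, hence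
   measurable. *)
apply: (@le_trans _ _ (\int[mu]_(u in `[t, r[) (h (clamp r u))%:E)%E).
  apply: ge0_le_integral => //.
  - by move=> u _; rewrite lee_fin divr_ge0 ?subr_ge0 ?ltW.
  - apply: measurable_funTS; apply: measurableT_comp => //; apply: continuous_measurable.
    exact: (continuous_hc r0 rT).
  move=> u /=; rewrite in_itv /= => /andP[tu ur]; rewrite lee_fin clamp_id; last first.
    by rewrite (ltW ur) (le_trans (ltW t0)).
  have uT : 0 < u < T by rewrite (lt_le_trans t0 tu) (lt_trans ur).
  apply: le_trans (hh_lb uT); rewrite ler_pM2l// lef_pV2 ?posrE; lra.
rewrite le_eqVlt; apply/orP; left; apply/eqP.
apply: eq_integral => u; rewrite inE /= in_itv /= => /andP[tu ur].
by rewrite clamp_id// (ltW ur) (le_trans (ltW t0)).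
Qed.

Lemma integral_h_unbounded (s K : R) : 0 <= s < T ->
  exists2 t : R, s < t < T & (K%:E <= I s t)%E.
Proof.
move=> /andP[s0 sT].
have H n : exists2 t : R, s < t < T & ((n%:R * (hbar / 2))%:E <= I s t)%E.
  elim: n => [|n [t /andP[st tT] IH]].
    by exists ((s + T) / 2); [lra|rewrite mul0r I_ge0//; lra].
  have t0 : 0 < t by exact: le_lt_trans st.
  exists ((t + T) / 2); first lra.
  rewrite (@I_cat s t)//; [|lra|lra|lra].
  rewrite -natr1 mulrDl mul1r EFinD; apply: leeD => //.
  by apply: I_half; rewrite t0.
have [t st h1] := H (Num.trunc (`|K| / (hbar / 2))).+1; exists t => //.
apply: le_trans h1; rewrite lee_fin -ler_pdivrMr ?divr_gt0//.
apply: le_trans (ltW (truncnS_gt _)).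
by apply: ler_wpM2r; [rewrite invr_ge0 divr_ge0// ltW|exact: ler_norm].
Qed.

Lemma integral_h_infty (s : R) : 0 <= s < T -> (I s T = +oo)%E.
Proof.
move=> sT; apply/eqyP => K _.
have [t /andP[st tT] /le_trans] := integral_h_unbounded K sT; apply.
have /andP[s0 _] := sT.
have mh : measurable_fun (`[s, T[%classic : set R) h.
  apply: (@measurable_funS _ _ _ _ (`[0, T[%classic : set R)) => //.
    by move=> u; rewrite /= !in_itv /= => /andP[/(le_trans s0) -> ->].
  exact: subspace_continuous_measurable_fun.
apply: ge0_subset_integral => //.
- exact: measurableT_comp.
- move=> u; rewrite /= in_itv /= => /andP[su uT].
  by rewrite lee_fin ltW// hh_gt0// uT (le_trans s0).
- by move=> u; rewrite /= !in_itv /= => /andP[-> /lt_trans]; apply.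
Qed.

Let C_ge0 : 0 <= C.
Proof. by apply: le_trans (ha_ge0 _) (aC (t := 0) _); rewrite ?lexx ?T0. Qed.

Lemma bridge_mean_le (r t : R) : 0 <= r -> r <= t -> 0 < t < T ->
  EE P (Y t) <= C * T * expR (- fine (I r t)) + C * (T - r).
Proof.
move=> r0 rt /andP[t0 tT].
have [_ m _ _ _] := bridge_moments t0 tT.
have ac (s : R) : 0 <= a (clamp t s) <= C.
  have st : 0 <= clamp t s <= T.
    by have /andP[-> /le_trans] := clamp_itv s (ltW t0); apply; exact: ltW.
  by rewrite ha_ge0//= aC.
have e_le (s u : R) : 0 <= s -> s <= u -> u <= t ->
    expR (prim (h \o clamp t) s) <= expR (prim (h \o clamp t) u).
  move=> s0 su ut; rewrite ler_expR -subr_ge0 -lee_fin -(integral_h t0 tT)//.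
  by apply: I_ge0 => //; apply: le_trans ut _; exact: ltW.
have := weighted_mean_le (continuous_ec t0 tT) (continuous_ac t0 tT) r0 rt C_ge0 ac
  (fun s => expR_gt0 _) e_le m.
have -> : expR (- fine (I r t)) = expR (prim (h \o clamp t) r) / expR (prim (h \o clamp t) t).
  by rewrite (integral_h t0 tT)//= opprB expRB.
set x := _ / _ => /le_trans; apply; apply: lerD; last first.
  by apply: ler_wpM2l; [exact: C_ge0|rewrite lerB// ltW].
apply: ler_wpM2r; first by rewrite divr_ge0 ?expR_ge0.
by apply: ler_wpM2l; [exact: C_ge0|rewrite (le_trans rt)// ltW].
Qed.

Lemma bridge_mean_small (e : R) : 0 < e ->
  exists2 r : R, 0 < r < T & forall t, r <= t < T -> EE P (Y t) <= e.
Proof.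
(* With T - r <= eta the term C (T - r) is at most e / 2; C + 1 keeps the denominator positive when
   C = 0. *)
move=> e0; pose eta := e / (2 * (C + 1)).
have C1 : 0 < 2 * (C + 1) by have := C_ge0; lra.
have eta0 : 0 < eta by exact: divr_gt0.
pose r := Num.max 0 (T - eta).
have r0 : 0 <= r by rewrite le_max lexx.
have rT : r < T by rewrite gt_max hT/=; lra.
have Tr : C * (T - r) <= e / 2.
  have h1 : T - r <= eta by rewrite lerBlDr -lerBlDl le_max lexx orbT.
  apply: le_trans (ler_wpM2l C_ge0 h1) _.
  rewrite /eta mulrA ler_pdivrMr//; have := mulr_ge0 C_ge0 (ltW e0); lra.
(* Once the integral of h from r reaches K, the exponential is at most 1 / (1 + K), and C T / (1 +
   K) <= e / 2. Hence r is fixed before t1. *)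
pose K := 2 * (C * T) / e.
have CT0 : 0 <= C * T by exact: mulr_ge0 C_ge0 T0.
have K0 : 0 <= K by apply: divr_ge0; [exact: mulr_ge0|exact: ltW].
have [t1 /andP[rt1 t1T] Kt1] := integral_h_unbounded K (s := r) (introT andP (conj r0 rT)).
have t10 : 0 < t1 by exact: le_lt_trans rt1.
exists t1; first by rewrite t10.
move=> t /andP[t1t tT]; have t0 : 0 < t < T by rewrite (lt_le_trans t10).
apply: le_trans (bridge_mean_le r0 (le_trans (ltW rt1) t1t) t0) _.
have fin : (I r t = (fine (I r t))%:E)%E.
  by have /andP[t00 _] := t0; rewrite (integral_h t00 tT)//; exact: le_trans (ltW rt1) t1t.
have Kt : K <= fine (I r t).
  rewrite -lee_fin -fin (@I_cat r t1 t)//; last exact: ltW.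
  by apply: le_trans Kt1 _; rewrite leeDl// I_ge0 ?ltW.
have h2 : C * T * expR (- fine (I r t)) <= e / 2.
  apply: (@le_trans _ _ (C * T * (1 + K)^-1)).
    apply: ler_wpM2l => //; rewrite expRN lef_pV2 ?posrE ?expR_gt0 ?ltr_pwDl//.
    by apply: le_trans (expR_ge1Dx _) _; rewrite ler_expR.
  rewrite ler_pdivrMr ?ltr_pwDl// mulrDr mulr1 /K.
  rewrite (_ : e / 2 * _ = C * T); last by field; rewrite gt_eqF.
  by rewrite lerDr divr_ge0 ?ltW.
lra.
Qed.

Lemma bridge_terminal : (\int[P]_w (Y T w)%:E = 0)%E.
Proof.
apply/eqP; rewrite eq_le; apply/andP; split; last first.
  by apply: integral_ge0 => w _; rewrite lee_fin bridge_version_ge0.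
apply/lee_addgt0Pr => e e0; rewrite add0e.
have [r /andP[r0 rT] hr] := bridge_mean_small e0.
(* A sequence in [r, T[ that tends to T: the means are small along it, and path continuity at T
   allows Fatou's lemma. *)
pose u (n : nat) : R := T - (T - r) / n.+1%:R.
have ur n : r <= u n < T.
  have n0 : 0 < n.+1%:R :> R by rewrite ltr0n.
  apply/andP; split; last by rewrite ltrBlDr ltrDl divr_gt0// subr_gt0.
  rewrite lerBrDr -lerBrDl ler_pdivrMr// ler_peMr ?subr_ge0 ?(ltW rT)//.
  by rewrite ler1n.
have uT : u n @[n --> \oo] --> T.
  rewrite -[X in _ --> X]subr0; apply: cvgB; first exact: cvg_cst.
  rewrite -[X in _ --> X](mulr0 (T - r)); apply: cvgM; first exact: cvg_cst.
  exact: cvg_harmonic.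
apply: (@fatou_le _ _ _ P (fun n => Y (u n)) (Y T)).
- by move=> n; exact: bridge_version_meas.
- by move=> n w; exact: bridge_version_ge0.
- move=> w; apply: (@cvg_comp _ _ _ u (Y ^~ w) _ (nbhs T)) => //.
  exact: continuous_bridge_version.
move=> n; have /andP[run unT] := ur n.
have [jY _ _ _ _] := bridge_moments (lt_le_trans r0 run) unT.
by rewrite EE_EFin ?lee_fin ?hr//; exact: L2_L1.
Qed.

End terminal.

(** A nonnegative variable of zero mean vanishes almost surely, so its variance is zero as well.
    Used at both ends, t = 0 and t = T. *)
Lemma bridge_null_moments (t : R) : 0 <= t <= T -> (\int[P]_w (Y t w)%:E = 0)%E ->
  'E_P[X t]%E = 0%E /\ 'V_P[X t]%E = 0%E.
Proof.
move=> tT Y0.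
have EX : 'E_P[X t]%E = 0%E by rewrite unlock -Y0; exact: (bridge_version_ae (f := id)).
split => //; rewrite /variance unlock EX /= unlock.
have mf : measurable_fun setT (fun x : R => (x - 0) * (x - 0)).
  by apply: measurable_funM; exact: measurable_funB.
have := bridge_version_ae tT mf => /= ->.
have mY : measurable_fun setT (fun w => (Y t w)%:E).
  by apply: measurableT_comp => //; exact: bridge_version_meas.
have [N0 [mN0 PN0 sN0]] : ae_eq P setT (fun w => (Y t w)%:E) (cst 0%E).
  apply/ae_eq_integral_abs => //; rewrite -[RHS]Y0; apply: eq_integral => w _.
  by rewrite gee0_abs// lee_fin bridge_version_ge0.
rewrite (@ae_eq_integral _ _ _ P setT (cst 0%E)) ?integral0//.
  apply: measurableT_comp => //; apply: (measurableT_comp mf); exact: bridge_version_meas.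
exists N0; split => // w /= h0; apply: sN0 => /= h1; apply: h0 => _.
by have := h1 Logic.I => -[->]; rewrite subr0 mulr0.
Qed.

End version.

(** At s = T the inner integral is over an empty interval and the exponential is 1, so the integrand
    of the mean formula need not vanish there; a single point does not affect the integral. *)
Lemma integral_terminal (R : realType) (T : R) (f : R -> \bar R) : 0 < T ->
  (forall s, 0 <= s < T -> f s = 0%E) ->
  (\int[@lebesgue_measure R]_(s in `[0%R, T]) f s = 0)%E.
Proof.
move=> T0 f0; rewrite -integral_itv_bndo_bndc; last first.
  apply: (eq_measurable_fun (cst 0%E)) => // s; rewrite inE /= in_itv /= => sT.
  by rewrite f0.
by apply: integral0_eq => s; rewrite /= in_itv /= => /f0.
Qed.

(* The inner integrals are extended-real valued and expeR -oo = 0, which covers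
   t = T; the half-open intervals keep h inside its domain [0, T[. *)
Theorem proposition2 (R : realType) (d : measure_display)
    (Omega : measurableType d) (P : probability Omega R)
    (F : R -> set (set Omega)) (B X : R -> Omega -> R)
    (T sigma : R) (a h : R -> R) (hbar omega : R)
    (hP : measure_is_complete P)
    (hF : usual_filtration P F)
    (hB : brownian_motion P F B)
    (hT : 0 < T) (hsigma : 0 <= sigma)
    (ha_ge0 : forall t, 0 <= t <= T -> 0 <= a t)
    (ha_bounded : exists C : R, forall t, 0 <= t <= T -> a t <= C)
    (ha_cont : {within `[0, T], continuous a})
    (hh_gt0 : forall t, 0 <= t < T -> 0 < h t)
    (hh_C1 : C1_on_co T h)
    (hhbar : 0 < hbar) (homega : 0 <= omega)
    (hh_bounds : forall t, 0 < t < T ->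
       hbar / (T - t) <= h t /\ h t <= hbar / (T - t) + omega)
    (hX : cir_bridge P T a h sigma F B X) :
  forall t, 0 <= t <= T ->
    ('E_P[X t] =
       \int[lebesgue_measure]_(s in `[0%R, t]) ((a s)%:E *
         expeR (- \int[lebesgue_measure]_(u in `[s, t[) (h u)%:E)))%E
    /\
    ('V_P[X t] =
       (sigma ^+ 2)%:E * \int[lebesgue_measure]_(s in `[0%R, t[)
         ((h s)%:E * 'E_P[X s] *
          expeR (- (2%:E * \int[lebesgue_measure]_(u in `[s, t[) (h u)%:E))))%E.

Proof.
have hc := C1_on_co_continuous hh_C1.
have lb t : 0 < t < T -> hbar / (T - t) <= h t by move=> /hh_bounds[].
have [C aC] := ha_bounded.
have [N [mN PN XN]] := bridge_exceptional_set hX.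
have null t tT := @bridge_null_moments _ _ _ _ _ _ _ _ _ _ _ hF hT hX _ mN PN t tT.
(* At t = 0 and t = T both sides of each formula vanish; the integrated moment identities serve for
   0 < t < T. *)
move=> t tT; have /andP[] := tT; rewrite le_eqVlt => /predU1P[t0 _|t0].
  have [] := null t tT.
    by rewrite -t0; under eq_integral do rewrite (bridge_version0 hT XN); rewrite integral0.
  rewrite -t0 => -> ->.
  by rewrite set_itv1 integral_set1 set_itvco0 integral_set0 mule0.
rewrite le_eqVlt => /predU1P[tE|tltT]; last first.
  split; first exact: (bridge_mean_before hF hB hT hsigma ha_cont hh_gt0 hc hX mN PN XN).
  exact: (bridge_variance_before hF hB hT hsigma ha_cont hh_gt0 hc hX mN PN XN).
have [] := null t tT.
  by rewrite tE; apply: (bridge_terminal hF hB hT hsigma ha_ge0 ha_cont hh_gt0 hc hX mN PN XN hhbar lb aC).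
rewrite tE => -> ->.
have Iy s := @integral_h_infty _ _ _ hh_gt0 hc _ hhbar lb s.
split.
  by rewrite integral_terminal// => s sT; rewrite Iy//= mule0.
rewrite integral0_eq ?mule0// => s; rewrite /= in_itv /= => sT.
by rewrite Iy// gt0_muley//= mule0.
Qed.
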